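(* Let $X \subset\mathbb{R}^N$, $N \in \mathbb{N}$, be a compact set, let $T\colon X \to X$ be a Lipschitz map and let $\mu$ be a Borel probability measure on $X$. Fix $k \in \mathbb{N}$. Then, for a prevalent Lipschitz observable $h \colon X \to \mathbb{R}$ and the $k$-delay coordinate map $\phi_h$, the following hold. (a) $\underline{\dim}_H T^{k-1}(\mu_{h, \phi_h(x)}) \geq \underline{\dim}_H T^{k-1} \mu - k$ for $\mu$-almost every $x \in X$. (b) For every $\varepsilon > 0$, there holds $\dim_H T^{k-1}(\mu_{h, \phi_h(x)}) \geq \dim_H T^{k-1} \mu - k - \varepsilon$ for $x$ from a set of positive $\mu$-measure.
   Context: For an observable $h\colon X\to\mathbb{R}$ the $k$-delay coordinate map is $\phi_h\colon X\to\mathbb{R}^k$, $\phi_h(x)=(h(x),h(Tx),\ldots,h(T^{k-1}x))$. The system of conditional measures $\{\mu_{h,y}\}_{y\in\mathbb{R}^k}$ of (the completion of) $\mu$ with respect to $\phi_h$ is defined by the weak-$^*$ limit $\mu_{h,y}=\lim_{\delta\to0}\frac{1}{\mu(\phi_h^{-1}(B(y,\delta)))}\mu|_{\phi_h^{-1}(B(y,\delta))}$ whenever the limit exists, and $\mu_{h,y}=0$ otherwise. (The limit exists for $\phi_h\mu$-almost every $y$, and the system is characterized $\phi_h\mu$-almost surely uniquely by $\mu(E)=\int_{\mathbb{R}^k}\mu_{h,y}(E)\,d(\phi_h\mu)(y)$ for every $\mu$-measurable $E\subset X$ and $\mu_{h,y}(\phi_h^{-1}(y))=1$ for $\phi_h\mu$-almost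 every $y$.) For a Borel map $\phi$, $\phi\mu(E)=\mu(\phi^{-1}(E))$ is the push-forward; $\mu|_A(E)=\mu(A\cap E)$; $\mathbb{N}$ is the set of positive integers. For a finite Borel measure $\mu$ on $\mathbb{R}^N$, $\dim_H\mu=\inf\{\dim_H E:\mu(\mathbb{R}^N\setminus E)=0\}$ and $\underline{\dim}_H\mu=\inf\{\dim_HE:\mu(E)>0\}$ (infima over Borel sets $E$; $\dim_HE$ is the Hausdorff dimension). Prevalence: $\mathrm{Lip}(X)$ is the Banach space of Lipschitz functions $h\colon X\to\mathbb{R}$ with norm $\sup_X|h|+\mathrm{Lip}(h)$, where $\mathrm{Lip}(h)$ is the least Lipschitz constant. A Borel set $\mathcal{S}\subset V=\mathrm{Lip}(X)$ is prevalent if there is a Borel measure $\nu$ on $V$, positive and finite on some compact set, such that for every $v\in V$ one has $v+e\in\mathcal{S}$ for $\nu$-almost every $e\in V$; a non-Borel set is prevalent if it contains a prevalent Borel subset. A property holds for a prevalent Lipschitz observable if the set of $h\in\mathrm{Lip}(X)$ having it is prevalent. *)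

(* Defs.v *)
From HB Require Import structures.
From mathcomp Require Import all_boot all_order all_algebra.
From mathcomp Require Import all_classical all_reals all_analysis.

Set Implicit Arguments.
Unset Strict Implicit.
Unset Printing Implicit Defensive.

Import Order.TTheory GRing.Theory Num.Theory.
Import numFieldNormedType.Exports.

Local Open Scope classical_set_scope.
Local Open Scope ring_scope.

Notation borel T := (g_sigma_algebraType (@open T)).

(* The library norm on 'rV[R]_n is the sup norm; it induces the same topology,
   hence the same Borel sets and compact sets, as the Euclidean norm. *)
Definition enorm (R : realType) (n : nat) (v : 'rV[R]_n) : R :=
  Num.sqrt (\sum_(i < n) v 0 i ^+ 2).

Definition eball (R : realType) (n : nat) (y : 'rV[R]_n) (r : R) :
    set 'rV[R]_n :=
  [set z | enorm (z - y) < r].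

Section hausdorff.
Context {R : realType} {n : nat}.
Implicit Types E U : set 'rV[R]_n.
Local Open Scope ereal_scope.

Definition ediam U : \bar R :=
  ereal_sup [set (enorm (p.1 - p.2))%:E | p in U `*` U].

(* |U|^s with |set0|^s = 0 for all s, and |{x}|^0 = 1. *)
Definition diam_pow (s : R) U : \bar R :=
  if pselect (U = set0) then 0 else poweR (ediam U) s.

Definition hausdorff_pre (s delta : R) E : \bar R :=
  ereal_inf [set \sum_(0 <= i <oo) diam_pow s (F i) |
    F in [set F : (set 'rV[R]_n)^nat |
      (forall i, ediam (F i) <= delta%:E) /\ E `<=` \bigcup_i F i]].

Definition hausdorff_measure (s : R) E : \bar R :=
  ereal_sup [set hausdorff_pre s delta E | delta in [set d : R | (0 < d)%R]].

Definition dimH E : \bar R :=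
  ereal_inf [set s%:E | s in
    [set s : R | (0 <= s)%R /\ hausdorff_measure s E = 0]].

Definition dimH_measure (m : set (borel 'rV[R]_n) -> \bar R) : \bar R :=
  ereal_inf [set dimH E | E in
    [set E : set (borel 'rV[R]_n) | measurable E /\ m (~` E) = 0]].

Definition lower_dimH_measure (m : set (borel 'rV[R]_n) -> \bar R) : \bar R :=
  ereal_inf [set dimH E | E in
    [set E : set (borel 'rV[R]_n) | measurable E /\ 0 < m E]].

End hausdorff.

(* X with its subspace topology; the proof X0 makes it a pointed type, as
   measurable types are required to be. *)
Section psubspace.
Context {R : realType} {N : nat} {X : set 'rV[R]_N}.

Definition psubspace (X0 : X !=set0) : Type := X.

Variable X0 : X !=set0.

HB.instance Definition _ := Topological.copy (psubspace X0) X.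
HB.instance Definition _ :=
  isPointed.Build (psubspace X0) (SigSub (mem_set (projT2 (cid X0)))).

End psubspace.

Definition lipschitz_self_map (R : realType) (N : nat) (X : set 'rV[R]_N)
    (T : X -> X) : Prop :=
  exists L : R, forall x y : X,
    enorm (set_val (T x) - set_val (T y)) <= L * enorm (set_val x - set_val y).

Section Lip.
Context {R : realType} {N : nat} {X : set 'rV[R]_N}.
Implicit Types h : X -> R.

Definition lip_consts h : set R :=
  [set L | 0 <= L /\ forall x y : X,
    `|h x - h y| <= L * enorm (set_val x - set_val y)].

Definition is_lipschitz h : Prop := lip_consts h !=set0.

Definition lip_const h : R := inf (lip_consts h).

Definition lip_norm h : R := sup [set `|h x| | x in [set: X]] + lip_const h.

Definition lip_pred : {pred X -> R} := mem [set h | is_lipschitz h].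

(* Compactness of X makes Lipschitz functions bounded, which is needed for
   [lip_norm] to be a norm on this type. *)
Record Lip (cX : compact X) := MkLip {
  lip_fun :> X -> R ;
  lip_funP : lip_fun \in lip_pred }.

End Lip.

Section Lip_normed.
Context {R : realType} {N : nat} {X : set 'rV[R]_N}.
Implicit Types h : X -> R.

Lemma enorm_ge0 n (v : 'rV[R]_n) : 0 <= enorm v.
Proof. exact: sqrtr_ge0. Qed.

Lemma enorm0_eq0 n (v : 'rV[R]_n) : enorm v = 0 -> v = 0.
Proof.
move=> /eqP; rewrite sqrtr_eq0 => v0.
have s0 : 0 <= \sum_(i < n) v 0 i ^+ 2 by apply: sumr_ge0 => i _; exact: sqr_ge0.
have /eqP : \sum_(i < n) v 0 i ^+ 2 = 0 by apply/eqP; rewrite eq_le v0 s0.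
rewrite psumr_eq0; last by move=> i _; exact: sqr_ge0.
move=> /allP vi0; apply/rowP => i; rewrite mxE.
by have := vi0 i (mem_index_enum _); rewrite /= sqrf_eq0 => /eqP.
Qed.

Lemma lip_pred_submod_closed : submod_closed (@lip_pred R N X).
Proof.
split.
  rewrite inE; exists 0; split => // x y.
  by rewrite mul0r subrr normr0.
move=> a f g; rewrite !inE => -[L [L0 fL]] [M [M0 gM]].
exists (`|a| * L + M); split; first by rewrite addr_ge0// mulr_ge0.
move=> x y.
have -> : (a *: f + g) x - (a *: f + g) y = a * (f x - f y) + (g x - g y).
  by rewrite mulrBr opprD addrACA.
rewrite (le_trans (ler_normD _ _))// mulrDl lerD// normrM -mulrA.
by rewrite ler_wpM2l.
Qed.

HB.instance Definition _ :=
  GRing.isSubmodClosed.Build R (X -> R) lip_pred lip_pred_submod_closed.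

Variable cX : compact X.

HB.instance Definition _ := [isSub for @lip_fun R N X cX].
HB.instance Definition _ := [Choice of Lip cX by <:].
HB.instance Definition _ := [SubChoice_isSubLmodule of Lip cX by <:].

Lemma lip_constP (h : Lip cX) : lip_consts h (lip_const h).
Proof.
have := lip_funP h; rewrite inE => -[L0 L0h].
split; first by apply: lb_le_inf; [exists L0 | move=> L []].
move=> x y; have [e0|] := eqVneq (enorm (set_val x - set_val y)) 0.
  move/enorm0_eq0/eqP : (e0); rewrite subr_eq0 => /eqP/val_inj ->.
  by rewrite subrr normr0 mulr_ge0 ?enorm_ge0//; apply: lb_le_inf;
    [exists L0 | move=> L []].
move=> ne0; have e0 : 0 < enorm (set_val x - set_val y).
  by rewrite lt_neqAle eq_sym ne0 enorm_ge0.
rewrite -ler_pdivrMr//; apply: lb_le_inf; first by exists L0.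
by move=> L [_ /(_ x y)]; rewrite ler_pdivrMr.
Qed.

Lemma lip_const_le h L : lip_consts h L -> lip_const h <= L.
Proof. by move=> hL; apply: ge_inf => //; exists 0 => M []. Qed.

Lemma lip_bounded (h : Lip cX) : exists M, forall x, `|h x| <= M.
Proof.
have [[x0 _] | nX] := pselect (exists x0 : X, True); last first.
  by exists 0 => x; exfalso; apply: nX; exists x.
have [M [_ XM]] := compact_bounded cX.
have {}XM x : X x -> `|x| <= M + 1 by move=> Xx; apply: XM => //; rewrite ltrDl.
have [L0 hL] := lip_constP h.
exists (`|h x0| + lip_const h *
  Num.sqrt (\sum_(i < N) (M + 1 + (M + 1)) ^+ 2)) => x.
rewrite -lerBlDl (le_trans (lerB_dist _ _))// (le_trans (hL _ _))//.
rewrite ler_wpM2l// ler_wsqrtr// ler_sum// => i _.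
have xM (y : X) : `|set_val y 0 i| <= M + 1.
  apply: le_trans (XM (set_val y) (set_mem (valP y))).
  by rewrite [leRHS]mx_normrE; exact: (le_bigmax _ _ (0, i)).
rewrite -[leLHS]real_normK ?num_real// lerXn2r ?nnegrE//.
  by rewrite (le_trans _ (lerD (xM x) (xM x)))// addr_ge0.
by rewrite !mxE (le_trans (ler_normB _ _))// lerD.
Qed.

Let sup_norm (h : X -> R) : R := sup [set `|h x| | x in [set: X]].

Let sup_norm_ub (h : Lip cX) x : `|h x| <= sup_norm h.
Proof.
have [M hM] := lip_bounded h.
by apply: ub_le_sup; [exists M => _ [y _ <-] | exists x].
Qed.

Let sup_norm_le (h : X -> R) M : 0 <= M -> (forall x, `|h x| <= M) ->
  sup_norm h <= M.
Proof.
move=> M0 hM; have [[x0 _] | nX] := pselect (exists x0 : X, True).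
  by apply: ge_sup => [|_ [y _ <-] //]; exists `|h x0|, x0.
rewrite /sup_norm (_ : [set _ | _ in _] = set0) ?sup0//.
by rewrite -subset0 => t [x _ _]; apply: nX; exists x.
Qed.

Let sup_norm_ge0 (h : Lip cX) : 0 <= sup_norm h.
Proof.
have [[x0 _] | nX] := pselect (exists x0 : X, True).
  exact: le_trans (sup_norm_ub h x0).
rewrite /sup_norm (_ : [set _ | _ in _] = set0) ?sup0//.
by rewrite -subset0 => t [x _ _]; apply: nX; exists x.
Qed.

Let lip_const_ge0 (h : Lip cX) : 0 <= lip_const h.
Proof. by have [] := lip_constP h. Qed.

Let lip_normD (f g : Lip cX) :
  lip_norm (f + g : Lip cX) <= lip_norm f + lip_norm g.
Proof.
rewrite /lip_norm addrACA lerD//.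
  apply: sup_norm_le; first by rewrite addr_ge0 ?sup_norm_ge0.
  move=> x; rewrite (le_trans (ler_normD _ _))// lerD ?sup_norm_ub//.
apply: lip_const_le; split; first by rewrite addr_ge0 ?lip_const_ge0.
move=> x y; rewrite mulrDl.
have -> : (f + g : Lip cX) x - (f + g : Lip cX) y = (f x - f y) + (g x - g y).
  by rewrite opprD addrACA.
rewrite (le_trans (ler_normD _ _))// lerD//.
  by have [_] := lip_constP f; apply.
by have [_] := lip_constP g; apply.
Qed.

Let lip_normZ_le a (f : Lip cX) :
  lip_norm (a *: f : Lip cX) <= `|a| * lip_norm f.
Proof.
rewrite /lip_norm mulrDr lerD//.
  apply: sup_norm_le; first by rewrite mulr_ge0 ?sup_norm_ge0.
  by move=> x; rewrite normrM ler_wpM2l ?sup_norm_ub.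
apply: lip_const_le; split; first by rewrite mulr_ge0 ?lip_const_ge0.
move=> x y; rewrite -mulrBr normrM -mulrA ler_wpM2l//.
by have [_] := lip_constP f; apply.
Qed.

Let lip_norm_ge0 (f : Lip cX) : 0 <= lip_norm f.
Proof. by rewrite addr_ge0 ?sup_norm_ge0 ?lip_const_ge0. Qed.

Let lip_normZ a (f : Lip cX) : lip_norm (a *: f : Lip cX) = `|a| * lip_norm f.
Proof.
have [->|a0] := eqVneq a 0.
  apply/eqP; rewrite eq_le lip_normZ_le normr0 mul0r.
  exact: lip_norm_ge0.
apply/eqP; rewrite eq_le lip_normZ_le/= -ler_pdivlMl ?normr_gt0//.
rewrite -normfV -{1}[f](scalerK a0).
exact: lip_normZ_le.
Qed.

Let lip_norm0_eq0 (f : Lip cX) : lip_norm f = 0 -> f = 0.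
Proof.
move=> /eqP; rewrite paddr_eq0 ?sup_norm_ge0 ?lip_const_ge0// => /andP[/eqP f0 _].
apply/val_inj/funext => x /=; apply/eqP; rewrite -normr_le0 -f0.
exact: sup_norm_ub.
Qed.

HB.instance Definition _ :=
  Lmodule_isNormed.Build R (Lip cX) lip_normD lip_normZ lip_norm0_eq0.

End Lip_normed.

Section prevalence.
Context {R : realType} {V : normedModType R}.
Local Open Scope ereal_scope.

Definition borel_prevalent (S : set V) : Prop :=
  exists nu : {measure set (borel V) -> \bar R},
    (exists K : set V, [/\ compact K, 0 < nu K & nu K < +oo]) /\
    forall v : V, {ae nu, forall e, S (v + e)%R}.

Definition prevalent (S : set V) : Prop :=
  exists B : set V,
    [/\ (measurable : set (set (borel V))) B, B `<=` S & borel_prevalent B].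

End prevalence.

Section delay.
Context {R : realType} {N : nat} {X : set 'rV[R]_N}.

Definition delay_map (k : nat) (T : X -> X) (h : X -> R) (x : X) : 'rV[R]_k :=
  \row_(i < k) h (iter i T x).

Variable X0 : X !=set0.

(* nu is the weak-* limit, as delta -> 0+, of the normalized restrictions of mu
   to phi^-1(B(y, delta)).  If these sets become null, 0^-1 = 0 makes nu the
   zero measure, in accordance with the convention for nonexistent limits. *)
Definition is_cond_measure (k : nat)
    (mu : {measure set (borel (psubspace X0)) -> \bar R})
    (phi : X -> 'rV[R]_k) (y : 'rV[R]_k)
    (nu : {measure set (borel (psubspace X0)) -> \bar R}) : Prop :=
  forall f : psubspace X0 -> R, continuous f ->
    (fun delta : R =>
       ((fine (mu (phi @^-1` eball y delta)))^-1%R%:E *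
        \int[mu]_(x in phi @^-1` eball y delta) (f x)%:E)%E)
      @ 0^'+ --> (\int[nu]_x (f x)%:E)%E.

(* On Borel sets, at most one nu satisfies [is_cond_measure]: a Borel measure on a compact
   metric space is determined by the integrals of continuous functions. *)
Definition cond_measure (k : nat)
    (mu : {measure set (borel (psubspace X0)) -> \bar R})
    (phi : X -> 'rV[R]_k) (y : 'rV[R]_k) :
    {measure set (borel (psubspace X0)) -> \bar R} :=
  if pselect (exists nu, is_cond_measure mu phi y nu) is left e
  then projT1 (cid e) else mzero.

(* The push-forward, on R^N, of a measure on X under the n-th iterate of T. *)
Definition iter_push (T : X -> X) (n : nat)
    (m : set (borel (psubspace X0)) -> \bar R) : set (borel 'rV[R]_N) -> \bar R :=
  pushforward m
    ((fun x => set_val (iter n T x)) : borel (psubspace X0) -> borel 'rV[R]_N).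

End delay.

(* Main.v *)
Require Import Defs.
From HB Require Import structures.
From mathcomp Require Import all_boot all_order all_algebra.
From mathcomp Require Import all_classical all_reals all_analysis.
From mathcomp Require Import measurable_realfun ring lra.
Import Order.TTheory GRing.Theory Num.Theory.
Import numFieldNormedType.Exports.
Local Open Scope classical_set_scope.
Local Open Scope ring_scope.
Set Implicit Arguments.
Unset Strict Implicit.
Unset Printing Implicit Defensive.

(** Write phi for the delay map of h, pi for T^(k-1), and mu_x for the conditional
measure of mu on the fibre of phi through x.  The dimension bounds follow from
a statement about null sets: if t + k < s' < s and A0 is a Borel set such that
mu does not charge pi^-1 (E `&` A0) when E is Borel with vanishing
s-dimensional Hausdorff measure, then, for a prevalent h and almost every x,
mu_x does not charge pi^-1 (E `&` A0) when E has vanishing t-dimensional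
Hausdorff measure (scale_lemma).  For the lower dimension A0 is the whole
space, for the upper dimension it is the part of the space that is left when a
set of vanishing s-dimensional measure and maximal mass is removed
(exhaustion).  Only rational t matter, so that countably many prevalent
sets are intersected.

Null sets turn into ball bounds by the Frostman lemma (frostman): almost every
point of pi^-1 A0 satisfies mu (pi^-1 A0 `&` near x 2^-n) <= C 2^(-n s'), where
near x r consists of the y with |pi x - pi y| < r.  Ball bounds for mu_x turn
back into null sets by the mass distribution principle (mass_distribution).
What has to be proved is therefore that mu_x (H `&` near y 2^-l) <= C 2^(-l t)
on pieces H that cover almost all of pi^-1 A0.

The observable is perturbed inside the span of the products of k factors taken
from 1, the coordinates and |u|^2.  If q is the number of distinct points among
x, T x, ..., T^(k-1) x, Hermite interpolation yields elements of the span whose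
differences near those points are as close as wanted to a prescribed coordinate
of u - v at one of them and to 0 at the others (directions).  As T is
Lipschitz, |T^i x - T^i y| is at least a constant times |pi x - pi y| for all
i < k.  Hence the perturbations for which phi x and phi y are delta-close have
measure at most a constant times (delta / |pi x - pi y|)^q (pair_bound).
Integrating |pi x - pi y|^(-t) over the delta-close pairs of a piece and
dividing by delta^q gives an energy whose mean over the perturbations is at
most a Riesz energy of exponent t + q < s', and the ball bounds make that
finite (energy_bound).  By the Fatou lemma, for almost every perturbation the
energies are bounded along infinitely many delta of the sequence 1/(n+1).
Since the mass of the ball of radius delta about phi x is at least a constant
times delta^q outside a set of small mass (thin_le), the relative mass of
H `&` near x 2^-l in that ball is at most C 2^(-l t) for all l and infinitely
many delta (good_points).

Relative masses control the conditional measures.  Balls in R^k satisfy a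
Besicovitch covering property, hence a maximal inequality (weak_type_ineq),
hence relative masses of Borel sets converge almost everywhere (ratio_cvg).
On a compact space this makes the averages of continuous functions converge
(cond_exists), and it gives mu_x (H `&` U) <= a for Borel H and open U as soon
as the relative masses of H `&` U are at most a infinitely often (cond_upper).
A null set of mu is null for almost every mu_x (cond_null), and mu_x lives on a
single fibre (cond_fiber), so that a bound valid at mu-almost every point of H
is valid at mu_x-almost every point of H (piece_null). *)

(** * Separated families and the Euclidean norm *)

(** A greedy choice terminates because the sizes are bounded, and a separated
    family of maximal size meets every point of Z. *)
Lemma maximal_separated (T : eqType) (Z : set T) (sep : rel T) (M : nat) :
  (forall s : seq T, (forall x, x \in s -> Z x) -> pairwise sep s ->
     (size s <= M)%N) ->
  exists s : seq T, [/\ forall x, x \in s -> Z x, pairwise sep s &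
    forall z, Z z -> exists2 x, x \in s & ~~ sep z x].
Proof.
move=> sM.
pose P n := `[< exists s : seq T, [/\ size s = n, forall x, x \in s -> Z x &
  pairwise sep s] >].
have exP : exists n, P n by exists 0%N; apply/asboolP; exists [::]; split.
have ubP n : P n -> (n <= M)%N.
  by move=> /asboolP[s [<- sZ ps]]; exact: sM.
case: (ex_maxnP exP ubP) => n /asboolP[s [sn sZ ps]] nmax.
exists s; split => // z Zz; apply: contrapT => zs.
have : P n.+1.
  apply/asboolP; exists (z :: s); split; first by rewrite /= sn.
    by move=> x; rewrite inE => /predU1P[->//|/sZ].
  rewrite pairwise_cons ps andbT; apply/allP => x xs.
  by apply: contrapT => /negP nsep; apply: zs; exists x.
by move=> /nmax; rewrite ltnn.
Qed.

(** Rounding f / eta down sends distinct members of the family to distinct points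
    of an integer grid. *)
Lemma separated_size_le (R : realType) (T : eqType) (q : nat) (f : T -> 'I_q -> R)
    (M eta : R) (s : seq T) : 0 <= M -> 0 < eta ->
  (forall x, x \in s -> forall c, `|f x c| <= M) ->
  pairwise (fun x y => [exists c, eta <= `|f x c - f y c|]) s ->
  (size s)%:R <= ((2 * M) / eta + 1) ^+ q.
Proof.
move=> M0 e0 fM ps.
pose K := Num.truncn (2 * M / eta).
have K0 : 0 <= 2 * M / eta by rewrite divr_ge0 ?mulr_ge0// ltW.
pose cell x : {ffun 'I_q -> 'I_K.+1} :=
  [ffun c => inord (Num.truncn ((f x c + M) / eta))].
have rng x c : x \in s -> 0 <= (f x c + M) / eta <= 2 * M / eta.
  move=> /fM/(_ c); rewrite ler_norml => /andP[h1 h2].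
  rewrite divr_ge0 ?(ltW e0)//=; last by rewrite -lerBlDr sub0r.
  by rewrite ler_pM2r ?invr_gt0// mulr_natl mulr2n lerD2r.
have uc : uniq (map cell s).
  rewrite uniq_pairwise pairwise_map.
  have := ps; apply: (@sub_in_pairwise _ (mem s)); last exact/allP.
  move=> x y xs ys /= /existsP[c]; apply: contraL => /eqP exy.
  have := congr1 (fun g : {ffun 'I_q -> 'I_K.+1} => val (g c)) exy.
  rewrite !ffunE /= !inordK; last first.
  - by rewrite ltnS; apply: le_truncn; case/andP: (rng x c xs).
  - by rewrite ltnS; apply: le_truncn; case/andP: (rng y c ys).
  move=> E.
  have /andP[x1 x2] := truncn_itv (proj1 (andP (rng x c xs))).
  have /andP[y1 y2] := truncn_itv (proj1 (andP (rng y c ys))).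
  rewrite -ltNge -(ltr_pM2r (x := eta^-1)) ?invr_gt0// mulfV ?gt_eqF//.
  have -> : `|f x c - f y c| / eta =
      `|(f x c + M) / eta - (f y c + M) / eta|.
    rewrite -mulrBl normrM (gtr0_norm (x := eta^-1)) ?invr_gt0//.
    by congr (`|_| * _); lra.
  rewrite E in x1 x2; rewrite -natr1 in x2; rewrite -natr1 in y2.
  by rewrite ltr_norml; apply/andP; split; lra.
have : (size (map cell s) <= #|{ffun 'I_q -> 'I_K.+1}|)%N.
  by rewrite -(card_uniqP uc); apply: max_card.
rewrite size_map card_ffun !card_ord => sK.
have : (size s)%:R <= (K.+1%:R : R) ^+ q by rewrite -natrX ler_nat.
move=> /le_trans; apply; rewrite lerXn2r ?nnegrE ?addr_ge0//.
by rewrite -natr1 lerD2r; have /andP[] := truncn_itv K0.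
Qed.

Section euclid.
Variables (R : realType) (k : nat).
Implicit Types u v w p : 'rV[R]_k.

Definition nsq v : R := \sum_(i < k) v 0 i ^+ 2.

Lemma nsq_ge0 v : 0 <= nsq v.
Proof. by apply: sumr_ge0 => i _; exact: sqr_ge0. Qed.

Lemma enormE v : enorm v = Num.sqrt (nsq v). Proof. by []. Qed.

Lemma enorm_sqr v : enorm v ^+ 2 = nsq v.
Proof. by rewrite enormE sqr_sqrtr ?nsq_ge0. Qed.

Lemma nsqN v : nsq (- v) = nsq v.
Proof. by apply: eq_bigr => i _; rewrite mxE sqrrN. Qed.

Lemma enormN v : enorm (- v) = enorm v.
Proof. by rewrite !enormE nsqN. Qed.

Lemma enormC u v : enorm (u - v) = enorm (v - u).
Proof. by rewrite -enormN opprB. Qed.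

Lemma enorm_ltP v r : 0 < r -> (enorm v < r) = (nsq v < r ^+ 2).
Proof.
move=> r0; rewrite -enorm_sqr ltr_pXn2r// ?nnegrE ?enorm_ge0 ?ltW//.
Qed.

Lemma enorm_leP v r : 0 <= r -> (r <= enorm v) = (r ^+ 2 <= nsq v).
Proof.
move=> r0; rewrite -enorm_sqr ler_pXn2r// ?nnegrE ?enorm_ge0//.
Qed.

Lemma coord_le_enorm v i : `|v 0 i| <= enorm v.
Proof.
rewrite -(ger0_norm (enorm_ge0 v)) -ler_sqr ?nnegrE// !real_normK ?num_real//.
rewrite enorm_sqr /nsq (bigD1 i)//= lerDl.
by apply: sumr_ge0 => j _; exact: sqr_ge0.
Qed.

(** The constant k.+1 in place of the square root of k makes the statement hold
    for k = 0 and avoids roots. *)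
Lemma enorm_coord_ge v r : 0 < r -> r <= enorm v ->
  exists c, r / k.+1%:R <= `|v 0 c|.
Proof.
move=> r0 rv; apply: contrapT => nc.
have kp : 0 < k.+1%:R :> R by rewrite ltr0n.
have vc c : `|v 0 c| < r / k.+1%:R.
  by rewrite ltNge; apply/negP => h; apply: nc; exists c.
move: rv; rewrite (enorm_leP _ (ltW r0)) leNgt => /negP; apply.
have : nsq v <= \sum_(i < k) (r / k.+1%:R) ^+ 2.
  apply: ler_sum => i _; rewrite -(real_normK (num_real (v 0 i))).
  by rewrite lerXn2r ?nnegrE ?normr_ge0 ?divr_ge0 ?ltW.
move/le_lt_trans; apply; rewrite sumr_const card_ord -[_ *+ k]mulr_natr.
rewrite expr_div_n -mulrA -[ltRHS]mulr1 ltr_pM2l ?exprn_gt0//.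
rewrite mulrC ltr_pdivrMr ?exprn_gt0// mul1r -natrX ltr_nat.
by rewrite (@leq_trans (k.+1 ^ 1))// leq_pexp2l.
Qed.

Lemma nsqB u v : nsq (u - v) = nsq u + nsq v - 2 * \sum_(i < k) u 0 i * v 0 i.
Proof.
rewrite /nsq mulr_sumr -big_split -sumrB /=; apply: eq_bigr => i _.
by rewrite !mxE; ring.
Qed.

Lemma nsqZ a u : nsq (a *: u) = a ^+ 2 * nsq u.
Proof. by rewrite /nsq mulr_sumr; apply: eq_bigr => i _; rewrite mxE exprMn. Qed.

Lemma dotZ a b u v : \sum_(i < k) (a *: u) 0 i * (b *: v) 0 i =
  a * b * \sum_(i < k) u 0 i * v 0 i.
Proof. by rewrite mulr_sumr; apply: eq_bigr => i _; rewrite !mxE; ring. Qed.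

(** If u - v is longer than u and than v, the angle between u and v exceeds 60
    degrees. *)
Lemma unit_vectors_apart u v : nsq u < nsq (u - v) -> nsq v < nsq (u - v) ->
  1 <= enorm ((enorm u)^-1 *: u - (enorm v)^-1 *: v).
Proof.
move=> hu hv.
have gt0 w w' : nsq w < nsq (w' - w) -> nsq w' < nsq (w' - w) -> 0 < enorm w'.
  move=> h h'; rewrite lt_neqAle enorm_ge0 eq_sym andbT; apply/eqP.
  by move/enorm0_eq0 => w0; move: h; rewrite w0 sub0r nsqN ltxx.
have u0 := gt0 v u hv hu.
have v0 : 0 < enorm v by apply: (gt0 u v); rewrite -opprB nsqN.
rewrite enorm_leP// expr1n nsqB !nsqZ dotZ -!enorm_sqr.
have -> : (enorm u)^-1 ^+ 2 * enorm u ^+ 2 = 1.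
  by rewrite -exprMn mulVf ?gt_eqF ?expr1n.
have -> : (enorm v)^-1 ^+ 2 * enorm v ^+ 2 = 1.
  by rewrite -exprMn mulVf ?gt_eqF ?expr1n.
move: hu hv; rewrite nsqB -!enorm_sqr; set S := \sum_(i < k) _.
move=> hu hv; suff : 2 * ((enorm u)^-1 / enorm v * S) <= 1 by lra.
rewrite -invfM mulrCA mulrC ler_pdivrMr ?mulr_gt0// mul1r.
case: (leP (enorm u) (enorm v)) => uv; nra.
Qed.

End euclid.

(** * Besicovitch selection *)

(** The number of unit vectors at mutual distance at least 1 is at most this
    bound, which counts the points of a grid. *)
Definition overlap_bound (R : realType) (k : nat) : R :=
  ((2 * 1) / (1 / k.+1%:R) + 1) ^+ k.

(** Radii are treated in decreasing order; for each radius a maximal separated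
    set of the centres not covered so far is added.  The distance of two chosen
    centres is then at least the larger of the two radii. *)
Lemma besicovitch_selection (R : realType) (k : nat) (A : R -> set 'rV[R]_k)
    (M : R) (rs : seq R) : 0 <= M ->
  (forall r, r \in rs -> 0 < r) -> sorted <=%R rs ->
  (forall r z, A r z -> forall c, `|z 0 c| <= M) ->
  exists s : seq ('rV[R]_k * R),
    [/\ forall p, p \in s -> p.2 \in rs /\ A p.2 p.1,
        pairwise (fun p p' => Num.max p.2 p'.2 <= enorm (p.1 - p'.1)) s &
        forall r z, r \in rs -> A r z ->
          exists2 p, p \in s & enorm (z - p.1) < p.2].
Proof.
move=> M0 + + AM; elim: rs => [|r rs ih] rs0 rs_sorted.
  by exists [::]; split.
have [] := ih; first by move=> r' rr; apply: rs0; rewrite inE rr orbT.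
  exact: path_sorted rs_sorted.
move=> s [sA sp scov].
have r0 : 0 < r by apply: rs0; rewrite inE eqxx.
have rle r' : r' \in rs -> r <= r'.
  by move: rs_sorted => /= /order_path_min => /(_ le_trans)/allP; apply.
pose Z := [set z | A r z /\ forall p, p \in s -> p.2 <= enorm (z - p.1)].
pose sep (x y : 'rV[R]_k) := r <= enorm (x - y).
pose B := (2 * M / (r / k.+1%:R) + 1) ^+ k.
have kp : 0 < k.+1%:R :> R by rewrite ltr0n.
have [|s' [s'Z s'p s'cov]] := @maximal_separated _ Z sep (Num.truncn B).
  move=> t tZ tp; suff tB : (size t)%:R <= B.
    have B0 : 0 <= B by apply: le_trans tB; rewrite ler0n.
    by rewrite truncn_ge_nat.
  apply: (@separated_size_le _ _ _ (fun (z : 'rV[R]_k) c => z 0 c)) => //.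
  - by rewrite divr_gt0.
  - by move=> x /tZ[/AM].
  - apply: sub_pairwise tp => x y /(enorm_coord_ge r0)[c].
    by rewrite !mxE => xy; apply/existsP; exists c.
exists ([seq (z, r) | z <- s'] ++ s); split.
- move=> p; rewrite mem_cat => /orP[/mapP[z zs' ->/=]|/sA[h1 h2]].
    by rewrite inE eqxx; split => //; case: (s'Z _ zs').
  by rewrite inE h1 orbT.
- rewrite pairwise_cat sp andbT pairwise_map; apply/andP; split.
    apply/allrelP => _ p' /mapP[z zs' ->] p's /=.
    rewrite ge_max; have [_ zp] := s'Z _ zs'; rewrite zp// andbT.
    by rewrite (le_trans _ (zp _ p's))// rle//; case: (sA _ p's).
  by apply: sub_pairwise s'p => x y; rewrite /sep /= maxxx.
- move=> r' z; rewrite inE => /predU1P[->|r'rs] Arz.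
    have [[p ps zp]|np] := pselect (exists2 p, p \in s & enorm (z - p.1) < p.2).
      by exists p => //; rewrite mem_cat ps orbT.
    have /s'cov[x xs'] : Z z.
      by split=> // p ps; rewrite leNgt; apply/negP => h; apply: np; exists p.
    rewrite -ltNge => zx; exists (x, r) => //.
    by rewrite mem_cat; apply/orP; left; apply/mapP; exists x.
  have [p ps zp] := scov _ _ r'rs Arz.
  by exists p => //; rewrite mem_cat ps orbT.
Qed.

(** Seen from z, the centres of the balls that contain z lie in directions that
    differ by more than 60 degrees, by [unit_vectors_apart]. *)
Lemma besicovitch_overlap (R : realType) (k : nat) (s : seq ('rV[R]_k * R)) z :
  pairwise (fun p p' => Num.max p.2 p'.2 <= enorm (p.1 - p'.1)) s ->
  (size [seq p <- s | enorm (z - p.1) < p.2])%:R <= overlap_bound R k.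
Proof.
move=> sp.
(* the directions in which the centres are seen from z *)
pose f (p : 'rV[R]_k * R) c := ((enorm (p.1 - z))^-1 *: (p.1 - z)) 0 c.
apply: (@separated_size_le _ _ _ f) => //.
- move=> p _ c; rewrite /f mxE normrM ger0_norm ?invr_ge0 ?enorm_ge0//.
  have [->|e0] := eqVneq (enorm (p.1 - z)) 0; first by rewrite invr0 mul0r.
  by rewrite ler_pdivrMl ?mulr1 ?coord_le_enorm// lt_neqAle eq_sym e0 enorm_ge0.
- have : pairwise (fun p p' => Num.max p.2 p'.2 <= enorm (p.1 - p'.1))
     [seq p <- s | enorm (z - p.1) < p.2] by exact: pairwise_filter.
  apply: (@sub_in_pairwise _ [pred p | enorm (z - p.1) < p.2]); last first.
    exact: filter_all.
  move=> p p'; rewrite !inE => zp zp'; rewrite ge_max => /andP[h1 h2].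
  have pos (q : 'rV[R]_k * R) : enorm (z - q.1) < q.2 -> 0 < q.2.
    by apply: le_lt_trans; exact: enorm_ge0.
  have E : p.1 - p'.1 = (p.1 - z) - (p'.1 - z).
    by rewrite opprB addrA subrK.
  have [||c fc] := @enorm_coord_ge R k
    ((enorm (p.1 - z))^-1 *: (p.1 - z) - (enorm (p'.1 - z))^-1 *: (p'.1 - z)) 1.
  + by [].
  + apply: unit_vectors_apart; rewrite -E.
      rewrite (enorm_leP _ (ltW (pos _ zp))) in h1; apply: lt_le_trans h1.
      by rewrite -(enorm_ltP _ (pos _ zp)) enormC.
    rewrite (enorm_leP _ (ltW (pos _ zp'))) in h2; apply: lt_le_trans h2.
    by rewrite -(enorm_ltP _ (pos _ zp')) enormC.
  + by apply/existsP; exists c; move: fc; rewrite /f !mxE.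
Qed.

(** * A maximal inequality for balls in the image space *)

Section weak_type.
Context {R : realType} d {Y : measurableType d}.
Variables (mu : probability Y R) (k : nat) (phi : Y -> 'rV[R]_k).
Hypothesis mphi : forall c, measurable_fun setT (fun y => phi y 0 c).

Definition pball (x : Y) (r : R) : set Y := [set y | enorm (phi y - phi x) < r].

Lemma measurable_pball2 r :
  measurable [set p : Y * Y | enorm (phi p.2 - phi p.1) < r].
Proof.
have [r0|r0] := ltP 0 r; last first.
  rewrite (_ : [set p | _] = set0) -?subset0//.
  by move=> p /= h; have := lt_le_trans h r0; rewrite ltNge enorm_ge0.
pose f (p : Y * Y) := nsq (phi p.2 - phi p.1).
have -> : [set p : Y * Y | enorm (phi p.2 - phi p.1) < r] =
    setT `&` [set p | f p < cst (r ^+ 2) p].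
  by rewrite setTI; apply/seteqP; split => p /=; rewrite enorm_ltP.
have mf : measurable_fun setT f.
  apply: measurable_sum => i; apply: measurable_funX.
  rewrite (_ : (fun x : Y * Y => _) =
     (fun x => phi x.2 0 i - phi x.1 0 i)); last by apply/funext => x; rewrite !mxE.
  apply: measurable_funB.
    exact: (measurableT_comp (mphi i) measurable_snd).
  exact: (measurableT_comp (mphi i) measurable_fst).
rewrite setTI (_ : [set p | _] = (fun p => f p < cst (r ^+ 2) p) @^-1` [set true]) //.
rewrite -[X in measurable X]setTI.
by apply: measurable_fun_ltr => //.
Qed.

Lemma measurable_pball x r : measurable (pball x r).
Proof.
rewrite (_ : pball x r = xsection
    [set p : Y * Y | enorm (phi p.2 - phi p.1) < r] x).
  by apply: measurable_xsection; exact: measurable_pball2.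
by apply/seteqP; split => y; rewrite /xsection /= inE.
Qed.

Lemma measurable_mu_section (A : set (Y * Y)) : measurable A ->
  measurable_fun setT (fun x => mu [set y | A (x, y)]).
Proof.
move=> mA; rewrite (_ : (fun x => _) = mu \o xsection A).
  exact: measurable_fun_xsection.
apply/funext => x /=; congr (mu _).
by apply/seteqP; split => y; rewrite /xsection /= inE.
Qed.

Lemma measurable_mu_pball E r : measurable E ->
  measurable_fun setT (fun x => mu (E `&` pball x r)).
Proof.
move=> mE; apply: (@measurable_mu_section
   ((snd @^-1` E) `&` [set p : Y * Y | enorm (phi p.2 - phi p.1) < r])).
apply: measurableI; last exact: measurable_pball2.
by rewrite -[X in measurable X]setTI; apply: measurable_snd.
Qed.

(** For finitely many radii the selection of balls is a finite process; the bound
    does not depend on the radii, which are exhausted by the rational ones later. *)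
Definition bad_ratio (E : set Y) (lam : R) (rs : seq R) : set Y :=
  [set x | exists2 r, r \in rs & (lam%:E * mu (pball x r) <= mu (E `&` pball x r))%E].

Lemma measurable_bad_ratio E lam rs : measurable E ->
  measurable (bad_ratio E lam rs).
Proof.
move=> mE; elim: rs => [|r rs ih].
  by rewrite (_ : bad_ratio _ _ _ = set0)// -subset0 => x [].
rewrite (_ : bad_ratio _ _ _ =
  (setT `&` [set x | (lam%:E * mu (setT `&` pball x r) <= mu (E `&` pball x r))%E])
    `|` bad_ratio E lam rs).
  apply: measurableU => //; apply: measurable_lee => //.
    by apply: measurable_funeM; exact: measurable_mu_pball.
  exact: measurable_mu_pball.
apply/seteqP; split => x.
  by move=> [r']; rewrite inE => /predU1P[->|r'rs] h;
    [left; split => //=; rewrite setTI|right; exists r'].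
move=> [[_ /=]|[r' r'rs h]].
  by rewrite setTI => h; exists r => //; rewrite inE eqxx.
by exists r' => //; rewrite inE r'rs orbT.
Qed.

Hypothesis bphi : exists M, forall y c, `|phi y 0 c| <= M.

(** The selected balls cover the bad set up to their overlap, and each of them
    carries a proportion of at least lam of the mass of E. *)
Lemma weak_type_ineq E lam rs : measurable E -> 0 < lam ->
  (forall r, r \in rs -> 0 < r) ->
  (lam%:E * mu (bad_ratio E lam rs) <= (overlap_bound R k)%:E * mu E)%E.
Proof.
move=> mE lam0; wlog rs_sorted : rs / sorted <=%R rs.
  move=> wl rs0; have -> : bad_ratio E lam rs = bad_ratio E lam (sort <=%R rs).
    by apply/seteqP; split => x [r rs_ h]; exists r => //; move: rs_; rewrite mem_sort.
  apply: wl; first exact: sort_le_sorted.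
  by move=> r; rewrite mem_sort; exact: rs0.
move=> rs0; have [M0 M0P] := bphi.
pose A r : set 'rV[R]_k := [set z | exists2 x, z = phi x &
  (lam%:E * mu (pball x r) <= mu (E `&` pball x r))%E].
have [r z [x -> _] c|s [sA sp scov]] := @besicovitch_selection R k A `|M0| rs (normr_ge0 _) rs0 rs_sorted.
  by apply: le_trans (M0P x c) (ler_norm _).
pose B (p : 'rV[R]_k * R) : set Y := [set y | enorm (phi y - p.1) < p.2].
have sB p : p \in s -> exists2 x, B p = pball x p.2 &
    (lam%:E * mu (B p) <= mu (E `&` B p))%E.
  by move=> /sA[_ [x px h]]; exists x; rewrite /B px.
have mB p : p \in s -> measurable (B p).
  by move=> /sB[x -> _]; exact: measurable_pball.
pose U := \big[setU/set0]_(p <- s) B p.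
have mU : measurable U by rewrite /U big_seq; apply: bigsetU_measurable.
have step1 : (mu (bad_ratio E lam rs) <= \sum_(p <- s) mu (B p))%E.
  apply: (@le_trans _ _ (mu U)).
    apply: le_measure; rewrite ?inE//; first exact: measurable_bad_ratio.
    move=> x [r rs_ h]; rewrite /U -bigcup_seq.
    by have [|p ps xp] := scov r (phi x) rs_; [exists x|exists p].
  suff : forall t, {subset t <= s} ->
      (mu (\big[setU/set0]_(p <- t) B p) <= \sum_(p <- t) mu (B p))%E by apply.
  elim=> [_|p t ih ts]; first by rewrite !big_nil measure0.
  have ps : p \in s by apply: ts; rewrite inE eqxx.
  have ts' : {subset t <= s} by move=> q qt; apply: ts; rewrite inE qt orbT.
  have m2 : measurable (\big[setU/set0]_(j <- t) B j).
    by rewrite big_seq; apply: bigsetU_measurable => q /ts'; exact: mB.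
  rewrite !big_cons; apply: (le_trans (measureU2 mu (mB p ps) m2)).
  by rewrite leeD2l// ih.
apply: (@le_trans _ _ (\sum_(p <- s) mu (E `&` B p))%E).
  apply: (@le_trans _ _ (lam%:E * \sum_(p <- s) mu (B p))%E).
    by rewrite lee_pmul2l ?lte_fin.
  rewrite ge0_sume_distrr// big_seq [leRHS]big_seq; apply: lee_sum => p ps.
  by have [] := sB p ps.
have -> : (\sum_(p <- s) mu (E `&` B p) =
    \int[mu]_(x in E) (\sum_(p <- s) (\1_(if p \in s then B p else set0) x)%:E))%E.
  rewrite ge0_integral_sum//; last first.
    move=> p; apply/measurable_EFinP; apply: measurable_indic.
    by case: ifP => // /mB.
  rewrite big_seq [RHS]big_seq; apply: eq_bigr => p ps; rewrite ps.
  by rewrite (integral_indic mu mE (mB p ps)) setIC.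
(* the sum of the indicators is the overlap of the selected balls *)
rewrite -integral_cst//; apply: ge0_le_integral => //.
- by move=> x _; apply: sume_ge0.
- apply: emeasurable_sum => p; apply/measurable_EFinP; apply: measurable_indic.
  by case: ifP => // /mB.
- move=> x _ /=; rewrite sumEFin lee_fin.
  apply: le_trans (besicovitch_overlap (phi x) sp).
  rewrite size_filter -sum1_count natr_sum big_seq [leRHS]big_mkcond/=.
  rewrite [leRHS]big_seq; apply: ler_sum => p ps; rewrite ps indicE.
  by rewrite /B; case: ifPn => h; [rewrite mem_set|rewrite memNset//=; exact/negP].
Qed.

End weak_type.

Lemma measure_bigcup_le {R : realType} d {Y : measurableType d}
    (mu : {measure set Y -> \bar R}) (F : nat -> set Y) (c : \bar R) :
  (forall n, measurable (F n)) -> {homo F : n m / (n <= m)%N >-> n `<=` m} ->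
  (forall n, mu (F n) <= c)%E -> (mu (\bigcup_n F n) <= c)%E.
Proof.
move=> mF ndF Fc.
have h : mu (F n) @[n --> \oo] --> mu (\bigcup_n F n).
  apply: nondecreasing_cvg_mu => //; first exact: bigcupT_measurable.
  by move=> n m nm; apply/subsetPset; exact: ndF.
rewrite -(cvg_lim _ h)//; apply: lime_le => //.
  by apply/cvg_ex; exists (mu (\bigcup_n F n)).
by apply: nearW.
Qed.

Section vanishing.
Context {R : realType} d {Y : measurableType d}.
Variables (mu : probability Y R) (k : nat) (phi : Y -> 'rV[R]_k).
Hypothesis mphi : forall c, measurable_fun setT (fun y => phi y 0 c).
Hypothesis bphi : exists M, forall y c, `|phi y 0 c| <= M.

Lemma pball_subset (x : Y) (r s : R) : r <= s -> pball phi x r `<=` pball phi x s.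
Proof. by move=> rs y /= h; apply: lt_le_trans h rs. Qed.

(** An open ball is the increasing union of the smaller concentric ones. *)
Lemma mu_pball_le (E : set Y) (x : Y) (r : R) (c : \bar R) : measurable E -> 0 < r ->
  (forall t : R, (t < r)%R -> mu (E `&` pball phi x t) <= c)%E ->
  (mu (E `&` pball phi x r) <= c)%E.
Proof.
move=> mE r0 h.
have -> : E `&` pball phi x r = \bigcup_n (E `&` pball phi x (r - r / n.+1%:R)).
  rewrite -setI_bigcupr; congr (_ `&` _); apply/seteqP; split => y /=.
    move=> hy; have gap : 0 < (r - enorm (phi y - phi x)) / r.
      by rewrite divr_gt0 ?subr_gt0.
    exists (Num.truncn ((r - enorm (phi y - phi x)) / r)^-1) => //=.
    have := truncnS_gt (((r - enorm (phi y - phi x)) / r)^-1).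
    set n := (Num.truncn _).+1 => hn.
    have n0 : 0 < n%:R :> R by rewrite ltr0n.
    rewrite invf_plt ?posrE// in hn.
    rewrite /pball /= ltrBrDr -ltrBrDl -ltr_pdivlMl//.
    by rewrite mulrC.
  move=> [n _ /=]; apply: pball_subset.
  by rewrite lerBlDr lerDl divr_ge0// ltW.
apply: measure_bigcup_le.
- by move=> n; apply: measurableI => //; exact: measurable_pball.
- move=> n m nm; apply: setIS; apply: pball_subset.
  by rewrite lerD2l lerN2 ler_pM2l// lef_pV2 ?posrE// ler_nat.
- by move=> n; apply: h; rewrite ltrBlDr ltrDl divr_gt0.
Qed.

(** The maximal inequality applied to the rational radii shows that the set where
    S j has large relative mass in some ball is small along with S j.  Taking all
    S j empty gives the positivity of the masses of the balls. *)
Lemma maximal_vanishing (S : nat -> set Y) : (forall j, measurable (S j)) ->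
  (forall e : R, 0 < e -> exists j, (mu (S j) <= e%:E)%E) ->
  {ae mu, forall x, forall eps : R, 0 < eps -> exists j, forall r, 0 < r ->
    (0 < mu (pball phi x r))%E /\
    (mu (S j `&` pball phi x r) <= eps%:E * mu (pball phi x r))%E}.
Proof.
move=> mS S0.
pose q i : R := if unpickle i is Some q then if 0 < q :> rat then ratr q else 1
  else 1.
have q0 i : 0 < q i.
  by rewrite /q; case: unpickle => // a; case: ifPn => // a0; rewrite ltr0q.
have qdense s r : s < r -> 0 < r -> exists i, s < q i < r.
  move=> sr r0; have [|a] := @rat_in_itvoo _ (Num.max s 0) r.
    by rewrite gt_max sr r0.
  rewrite in_itv /= gt_max => /andP[/andP[h1 h2] h3].
  by exists (pickle a); rewrite /q pickleK -(@ltr0q R) h2 h1 h3.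
pose F n := [seq q i | i <- iota 0 n].
have F0 n r : r \in F n -> 0 < r by move=> /mapP[i _ ->].
have lam0 (m : nat) : 0 < m.+1%:R^-1 :> R by rewrite invr_gt0 ltr0n.
pose W j m := \bigcup_n bad_ratio mu phi (S j) m.+1%:R^-1 (F n).
have mW j m : measurable (W j m).
  by apply: bigcupT_measurable => n; exact: measurable_bad_ratio.
have muW j m : (m.+1%:R^-1%:E * mu (W j m) <= (overlap_bound R k)%:E * mu (S j))%E.
  rewrite -lee_pdivlMl ?invr_gt0//; apply: measure_bigcup_le.
  - by move=> n; exact: measurable_bad_ratio.
  - move=> n n' nn' x [r rF h]; exists r => //.
    move: rF => /mapP[i]; rewrite mem_iota add0n /= => lin ->.
    by apply/mapP; exists i => //; rewrite mem_iota add0n /= (leq_trans lin).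
  - move=> n; rewrite lee_pdivlMl ?invr_gt0//; apply: weak_type_ineq => //.
    exact: F0.
(* Bad m: for every j some ball has S j-mass at least 1/(m+1) of its own *)
pose Bad m := \bigcap_j W j m.
have mBad m : measurable (Bad m) by apply: bigcapT_measurable.
have Bad0 m : mu (Bad m) = 0%E.
  apply/eqP; rewrite eq_le measure_ge0 andbT; apply/lee_addgt0Pr => e e0.
  rewrite add0e.
  have C0 : 0 <= overlap_bound R k by rewrite /overlap_bound exprn_ge0// addr_ge0// divr_ge0.
  have [|j Sj] := S0 (m.+1%:R^-1 * e / (overlap_bound R k + 1)).
    by rewrite divr_gt0 ?mulr_gt0// ltr_wpDl.
  apply: (@le_trans _ _ (mu (W j m))).
    by apply: le_measure; rewrite ?inE//; exact: bigcap_inf.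
  rewrite -(@lee_pmul2l _ (m.+1%:R^-1%:E)) ?lte_fin//.
  apply: (le_trans (muW j m)); apply: (@le_trans _ _
    ((overlap_bound R k)%:E * (m.+1%:R^-1 * e / (overlap_bound R k + 1))%:E)%E).
    by rewrite lee_wpmul2l ?lee_fin.
  rewrite -!EFinM lee_fin mulrA ler_pdivrMr ?ltr_wpDl// [leLHS]mulrC.
  by rewrite ler_wpM2l ?lerDl// mulr_ge0// ltW.
have : {ae mu, forall x, forall m, ~ Bad m x}.
  apply: ae_foralln => m; exists (Bad m); split; [exact: mBad|exact: Bad0|move=> x /=].
  by rewrite notK.
apply: filterS => x xBad eps eps0.
have [m [me _]] : exists m : nat, m.+1%:R^-1 < eps /\ True.
  exists (Num.truncn eps^-1); split => //.
  by rewrite invf_plt ?posrE// ?ltr0n// truncnS_gt.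
have /existsNP[j jW] : ~ forall j, W j m x by move=> h; apply: (xBad m) => j _; exact: h.
exists j.
have main i : (mu (S j `&` pball phi x (q i)) <
    m.+1%:R^-1%:E * mu (pball phi x (q i)))%E.
  rewrite ltNge; apply/negP => h; apply: jW; exists i.+1 => //.
  exists (q i) => //; apply/mapP; exists i => //.
  by rewrite mem_iota add0n ltnS leqnn.
have mono i r : q i < r -> (mu (pball phi x (q i)) <= mu (pball phi x r))%E.
  move=> qr; apply: le_measure; rewrite ?inE; [exact: measurable_pball..|].
  by apply: pball_subset; exact: ltW.
move=> r r0; split.
  have [i /andP[_ qr]] := qdense 0 r r0 r0.
  apply: lt_le_trans (mono _ _ qr).
  have := le_lt_trans (measure_ge0 _ _) (main i).
  by rewrite pmule_rgt0 ?lte_fin.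
apply: mu_pball_le => // t tr.
have [i /andP[tq qr]] := qdense _ _ tr r0.
apply: (@le_trans _ _ (mu (S j `&` pball phi x (q i)))).
  apply: le_measure; rewrite ?inE; [by apply: measurableI => //; exact: measurable_pball..|].
  by apply: setIS; apply: pball_subset; exact: ltW.
apply: (le_trans (ltW (main i))); apply: lee_pmul => //; rewrite ?lee_fin ?(ltW me)//.
exact: mono.
Qed.

End vanishing.

(** * Limits at zero and regularity of Borel measures *)

Section pr.
Context {R : realType} d {Y : measurableType d} (mu : probability Y R).
Implicit Types A B : set Y.

Definition pr A : R := fine (mu A).

Lemma prE A : measurable A -> mu A = (pr A)%:E.
Proof. by move=> mA; rewrite fineK// fin_num_measure. Qed.

Lemma pr_ge0 A : 0 <= pr A. Proof. by rewrite fine_ge0. Qed.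

Lemma pr_le A B : measurable A -> measurable B -> A `<=` B -> pr A <= pr B.
Proof.
by move=> mA mB AB; rewrite -lee_fin -!prE//; apply: le_measure; rewrite ?inE.
Qed.

Lemma pr_le1 A : measurable A -> pr A <= 1.
Proof. by move=> mA; rewrite -lee_fin -prE// probability_le1. Qed.

Lemma pr_gt0 A : (0 < mu A)%E -> measurable A -> 0 < pr A.
Proof. by move=> h mA; rewrite -lte_fin -prE. Qed.

Lemma prDI A B : measurable A -> measurable B ->
  pr A = pr (A `&` B) + pr (A `\` B).
Proof.
move=> mA mB; apply: EFin_inj; rewrite EFinD -!prE//.
- by rewrite addeC -measureDI.
- exact: measurableD.
- exact: measurableI.
Qed.

Lemma prU_le A B : measurable A -> measurable B ->
  pr (A `|` B) <= pr A + pr B.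
Proof.
move=> mA mB; rewrite -lee_fin EFinD -!prE//; last exact: measurableU.
exact: measureU2.
Qed.

End pr.

Definition lim0 (R : realType) (f : R -> R) (l : R) := forall e : R, 0 < e ->
  exists2 r0 : R, 0 < r0 & forall r, 0 < r -> r < r0 -> `|f r - l| <= e.

(** The only property of the space that the proof of outer regularity uses. *)
Definition open_Fsigma (T : topologicalType) := forall U : set T, open U ->
  exists F : nat -> set T, [/\ forall n, closed (F n),
    {homo F : n m / (n <= m)%N >-> n `<=` m} & U = \bigcup_n F n].

(** Points at distance at least 1/(n+1) from the complement form closed sets. *)
Lemma normed_open_Fsigma (R : realType) (V : normedModType R) : open_Fsigma V.
Proof.
move=> U oU; pose F n : set V := [set x | forall y, ~ U y -> n.+1%:R^-1 <= `|x - y|].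
exists F; split.
- move=> n; rewrite (_ : F n = \bigcap_(y in ~` U) [set x | n.+1%:R^-1 <= `|x - y|]).
    apply: closed_bigI => y _.
    have -> : [set x : V | n.+1%:R^-1 <= `|x - y|] =
        (fun x : V => `|x - y|) @^-1` [set z | n.+1%:R^-1 <= z].
      by [].
    apply: closed_comp; last exact: closed_ge.
    move=> x _; apply: (@continuous_comp _ _ _ (fun x : V => x - y) (fun x : V => `|x|)).
      by apply: cvgB => //; exact: cvg_cst.
    exact: norm_continuous.
  by apply/seteqP; split => x h y; exact: h.
- move=> n m nm x h y /h; apply: le_trans.
  by rewrite lef_pV2 ?posrE ?ltr0n// ler_nat.
- apply/seteqP; split => x; last first.
    move=> [n _ h]; apply: contrapT => nU; have := h _ nU.
    by rewrite subrr normr0 leNgt invr_gt0 ltr0n.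
  move=> Ux; have /nbhs_ballP[e /= e0 eU] : nbhs x U by exact: open_nbhs_nbhs.
  exists (Num.truncn e^-1) => // y nUy; rewrite leNgt; apply/negP => h.
  apply: nUy; apply: eU; rewrite -ball_normE /=; apply: lt_trans h _.
  by rewrite invf_plt ?posrE// ?ltr0n// truncnS_gt.
Qed.

Section regularity.
Context {R : realType} d {Y : measurableType d} {T : ptopologicalType}.
Variables (mu : probability Y R) (f : Y -> borel T).
Hypothesis mf : measurable_fun setT f.
Hypothesis oF : open_Fsigma T.

Let mpre (E : set (borel T)) : measurable E -> measurable (f @^-1` E).
Proof. by move=> mE; rewrite -[X in measurable X]setTI; exact: mf. Qed.

Let mopen (U : set T) : open U -> measurable (U : set (borel T)).
Proof. exact: sub_sigma_algebra. Qed.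

Let mclosed (U : set T) : closed U -> measurable (U : set (borel T)).
Proof.
move=> cU; rewrite -(setCK U); apply: measurableC; apply: mopen.
exact/closed_openC.
Qed.

Let reg (E : set T) := forall e : R, 0 < e -> exists F W : set T,
  [/\ closed F, open W, F `<=` E, E `<=` W & (mu (f @^-1` (W `\` F)) <= e%:E)%E].

Let regC E : reg E -> reg (~` E).
Proof.
move=> rE e e0; have [F [W [cF oO FE EO h]]] := rE e e0.
exists (~` W), (~` F); split.
- exact: open_closedC.
- exact: closed_openC.
- exact: subsetC.
- exact: subsetC.
- by rewrite (_ : ~` F `\` ~` W = W `\` F)// setDE setCK setIC.
Qed.

Let regU (E : nat -> set T) : (forall n, reg (E n)) -> reg (\bigcup_n E n).
Proof.
move=> rE e e0.
have e2 n : 0 < (e / 2) / (2 ^ n.+1)%:R.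
  by rewrite !divr_gt0// ltr0n expn_gt0.
have /choice[FW FOP] : forall n, exists FW : set T * set T,
    [/\ closed FW.1, open FW.2, FW.1 `<=` E n, E n `<=` FW.2 &
      (mu (f @^-1` (FW.2 `\` FW.1)) <= ((e / 2) / (2 ^ n.+1)%:R)%:E)%E].
  by move=> n; have [F [W h]] := rE n _ (e2 n); exists (F, W).
pose W := \bigcup_n (FW n).2.
pose F m := \bigcup_(n in `I_m) (FW n).1.
have oO : open W by apply: bigcup_open => n _; have [] := FOP n.
have cF m : closed (F m).
  apply: closed_bigcup; first exact: finite_II.
  by move=> n _; have [] := FOP n.
have mD m : measurable (f @^-1` (W `\` F m)).
  by apply: mpre; apply: measurableD; [exact: mopen|exact: mclosed].
have cvgm : mu (f @^-1` (W `\` F m)) @[m --> \oo] -->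
    mu (\bigcap_m f @^-1` (W `\` F m)).
  apply: (@nonincreasing_cvg_mu _ _ _ mu (fun m => f @^-1` (W `\` F m))) => //.
  - by rewrite -ge0_fin_numE// fin_num_measure.
  - by apply: bigcapT_measurable.
  - move=> n m nm; apply/subsetPset => y [/= Oy nF]; split => //.
    by move=> [i im h]; apply: nF; exists i => //; exact: leq_trans nm.
have lim_small : (mu (\bigcap_m f @^-1` (W `\` F m)) < e%:E)%E.
  apply: (@le_lt_trans _ _ (e / 2)%:E); last by rewrite lte_fin ltr_pdivrMr// mulr_natr mulr2n ltrDl.
  apply: (@le_trans _ _ (mu (\bigcup_n f @^-1` ((FW n).2 `\` (FW n).1)))).
    apply: le_measure; rewrite ?inE.
    - exact: bigcapT_measurable.
    - apply: bigcupT_measurable => n; apply: mpre.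
      by have [c o _ _ _] := FOP n; apply: measurableD; [exact: mopen|exact: mclosed].
    - move=> y h; have [/= [n _ On] _] := h 0%N I.
      exists n => //; split => //= Fn; have [_ /=] := h n.+1 I; apply.
      by exists n => /=.
  apply: (@le_trans _ _ (\sum_(n <oo) mu (f @^-1` ((FW n).2 `\` (FW n).1)))%E).
    apply: measure_sigma_subadditive => //.
    - move=> n; apply: mpre.
      by have [c o _ _ _] := FOP n; apply: measurableD; [exact: mopen|exact: mclosed].
    - apply: bigcupT_measurable => n; apply: mpre.
      by have [c o _ _ _] := FOP n; apply: measurableD; [exact: mopen|exact: mclosed].
  apply: le_trans (epsilon_trick0 xpredT _); last by rewrite divr_ge0// ltW.
  by apply: lee_nneseries => // n _; have [] := FOP n.
have : \forall m \near \oo, (mu (f @^-1` (W `\` F m)) < e%:E)%E.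
  apply: (cvgm [set z | (z < e%:E)%E]); apply: open_nbhs_nbhs.
  by split => //; exact: open_ereal_lt_ereal.
move=> [m _ /(_ m (leqnn m)) /= hm].
exists (F m), W; split => //.
- by move=> x [n _ h]; exists n => //; have [_ _ FE _ _] := FOP n; exact: FE.
- by apply: subset_bigcup => n _; have [] := FOP n.
- exact: ltW.
Qed.

(** The sets that can be squeezed between a closed and an open set of almost the
    same mass form a sigma-algebra, and open sets belong to it by the F-sigma
    property. *)
Lemma borel_outer_regular (E : set (borel T)) (e : R) : measurable E -> 0 < e ->
  exists W : set T, [/\ open W, E `<=` W & (mu (f @^-1` (W `\` E)) <= e%:E)%E].
Proof.
move=> mE e0.
have rE : reg E.
  have : <<s @open T >> `<=` reg.
    apply: smallest_sub.
      split.
      - move=> a a0; exists set0, set0; split => //; [exact: closed0|exact: open0|].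
        by rewrite setDv preimage_set0 measure0 lee_fin ltW.
      - by move=> A rA; rewrite setTD; exact: regC.
      - by move=> A rA; exact: regU.
    move=> U oU; have [F [cF ndF UF]] := oF oU.
    move=> a a0.
    have cvgm : mu (f @^-1` (U `\` F m)) @[m --> \oo] -->
        mu (\bigcap_m f @^-1` (U `\` F m)).
      apply: (@nonincreasing_cvg_mu _ _ _ mu (fun m => f @^-1` (U `\` F m))) => //.
      - by rewrite -ge0_fin_numE// fin_num_measure//; apply: mpre; apply: measurableD; [exact: mopen|exact: mclosed].
      - by move=> i; apply: mpre; apply: measurableD; [exact: mopen|exact: mclosed].
      - by apply: bigcapT_measurable => i; apply: mpre; apply: measurableD; [exact: mopen|exact: mclosed].
      - move=> n m nm; apply/subsetPset => y [/= Oy nFy]; split => //.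
        by move/(ndF _ _ nm).
    have z : (mu (\bigcap_m f @^-1` (U `\` F m)) < a%:E)%E.
      rewrite (_ : \bigcap_m _ = set0) ?measure0 ?lte_fin//.
      rewrite -subset0 => y h; have [/=] := h 0%N I.
      by rewrite UF => -[n _ Fn] _; have [_] := h n I.
    have : \forall m \near \oo, (mu (f @^-1` (U `\` F m)) < a%:E)%E.
      apply: (cvgm [set z | (z < a%:E)%E]); apply: open_nbhs_nbhs.
  by split => //; exact: open_ereal_lt_ereal.
    move=> [m _ /(_ m (leqnn m)) /= hm].
    exists (F m), U; split => //; last exact: ltW.
    by rewrite UF => x Fx; exists m.
  by apply.
have [F [W [cF oO FE EO h]]] := rE e e0.
exists W; split => //; apply: le_trans h; apply: le_measure; rewrite ?inE.
- by apply: mpre; apply: measurableD => //; exact: mopen.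
- by apply: mpre; apply: measurableD; [exact: mopen|exact: mclosed].
- by move=> y [/= Oy nE]; split => //= Fy; apply: nE; exact: FE.
Qed.

End regularity.

(** * Convergence of relative masses of balls *)

Lemma ae_and (R : realType) d (Y : measurableType d)
    (mu : {measure set Y -> \bar R}) (P Q : Y -> Prop) :
  {ae mu, forall x, P x} -> {ae mu, forall x, Q x} ->
  {ae mu, forall x, P x /\ Q x}.
Proof. by move=> hP hQ; exact: (filterI hP hQ). Qed.

Lemma ae_mp (R : realType) d (Y : measurableType d)
    (mu : {measure set Y -> \bar R}) (P Q : Y -> Prop) :
  (forall x, P x -> Q x) -> {ae mu, forall x, P x} -> {ae mu, forall x, Q x}.
Proof. by move=> PQ; apply: filterS. Qed.

Section hahn_sets.
Context {R : realType} d {Y : measurableType d} d' {Z : measurableType d'}.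
Variables (mu : probability Y R) (f : Y -> Z).
Hypothesis mf : measurable_fun setT f.

(** Hahn decomposition of the charge A |-> mu (E `&` f^-1 A) - a mu (f^-1 A). *)
Lemma hahn_sets (E : set Y) (a : R) : measurable E -> exists P : set Z,
  [/\ measurable P,
   forall A, measurable A -> A `<=` P ->
     a * pr mu (f @^-1` A) <= pr mu (E `&` f @^-1` A) &
   forall A, measurable A -> A `<=` ~` P ->
     pr mu (E `&` f @^-1` A) <= a * pr mu (f @^-1` A)].
Proof.
move=> mE.
pose c : {charge set Y -> \bar R} :=
  cadd (crestr0 (charge_of_finite_measure mu) mE)
       (cscale (- a) (charge_of_finite_measure mu)).
have mpre A : measurable A -> measurable (f @^-1` A).
  by move=> mA; rewrite -[X in measurable X]setTI; exact: mf.
pose c' A := c (f @^-1` A).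
pose I := isCharge.Build _ Z R c'.
have c'0 : c' set0 = 0%E by rewrite /c' preimage_set0 charge0.
have c'fin A : measurable A -> c' A \is a fin_num.
  by move=> mA; apply: fin_num_measure; exact: mpre.
have c'sig : semi_sigma_additive c'.
  move=> F mF tF mUF; rewrite /c' preimage_bigcup.
  apply: charge_semi_sigma_additive.
  - by move=> n; exact: mpre.
  - apply/trivIsetP => /= i j _ _ ij; rewrite -preimage_setI.
    by move/trivIsetP : tF => /(_ _ _ _ _ ij) ->//; rewrite preimage_set0.
  - by rewrite -preimage_bigcup; exact: mpre.
pose nu : {charge set Z -> \bar R} := HB.pack c' (isCharge.Build _ Z R c' c'0 c'fin c'sig).
have nuE A : measurable A -> nu A =
    (pr mu (E `&` f @^-1` A) - a * pr mu (f @^-1` A))%:E.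
  move=> mA; have mB := mpre A mA.
  transitivity ((if f @^-1` A \in measurable then mu (f @^-1` A `&` E) else 0) +
    (- a)%:E * mu (f @^-1` A))%E; first by [].
  rewrite ifT; last by rewrite inE.
  rewrite setIC EFinB EFinM -!prE//.
  - by rewrite EFinN mulNe.
  - exact: measurableI.
have [P [N [[mP posP] [mN negN] PN PN0]]] := Hahn_decomposition nu.
exists P; split => // A mA AP.
  by have := posP A mA AP; rewrite nuE// lee_fin subr_ge0.
have AN : A `<=` N.
  by move=> x Ax; have [//|//] : (P `|` N) x; [rewrite PN|move/(AP x Ax)].
by have := negN A mA AN; rewrite nuE// lee_fin subr_le0.
Qed.

End hahn_sets.

Lemma continuous_nsqB (R : realType) (k : nat) (z : 'rV[R]_k) :
  continuous (fun y : 'rV[R]_k => nsq (y - z)).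
Proof.
have ca : continuous (fun x : R * R => x.1 + x.2) by exact: add_continuous.
apply: (continuous_big ca) => i _ y.
apply: (@continuous_comp _ _ _ (fun y : 'rV[R]_k => (y - z) 0 i) (fun t : R => t ^+ 2)).
  rewrite (_ : (fun y : 'rV[R]_k => (y - z) 0 i) = (fun y : 'rV[R]_k => y 0 i - z 0 i)).
    exact: (cvgB (@coord_continuous R 1 k 0 i y) (cvg_cst (z 0 i))).
  by apply/funext => t; rewrite !mxE.
exact: exprn_continuous.
Qed.

Lemma norm_le_enorm (R : realType) (k : nat) (v : 'rV[R]_k) : `|v| <= enorm v.
Proof.
rewrite [leLHS]mx_normrE; apply: bigmax_le; first exact: enorm_ge0.
by move=> [i j] _ /=; rewrite (ord1 i); exact: coord_le_enorm.
Qed.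

Section differentiation.
Context {R : realType} d {Y : measurableType d}.
Variables (mu : probability Y R) (k : nat) (phi : Y -> borel 'rV[R]_k).
Hypothesis mphi' : measurable_fun setT phi.
Hypothesis mphi : forall c, measurable_fun setT (fun y => (phi y : 'rV[R]_k) 0 c).
Hypothesis bphi : exists M, forall y c, `|(phi y : 'rV[R]_k) 0 c| <= M.
Notation pball := (@pball R d Y k phi).

Lemma mpreimage (A : set (borel 'rV[R]_k)) : measurable A -> measurable (phi @^-1` A).
Proof. by move=> mA; rewrite -[X in measurable X]setTI; exact: mphi'. Qed.

Lemma eball_sub_open (U : set 'rV[R]_k) z : open U -> U z ->
  exists2 r0 : R, 0 < r0 & forall r : R, r < r0 -> eball z r `<=` U.
Proof.
move=> oU Uz; have /nbhs_ballP[e /= e0 eU] : nbhs z U by exact: open_nbhs_nbhs.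
exists e => // r re y /= zy; apply: eU; rewrite -ball_normE /= distrC.
by apply: le_lt_trans (norm_le_enorm _) _; exact: lt_trans zy re.
Qed.

Lemma measurable_eball (z : 'rV[R]_k) r : measurable (eball z r : set (borel 'rV[R]_k)).
Proof.
apply: sub_sigma_algebra.
have [r0|r0] := ltP 0 r; last first.
  rewrite (_ : eball z r = set0); first exact: open0.
  by rewrite -subset0 => y /= /lt_le_trans/(_ r0); rewrite ltNge enorm_ge0.
have -> : eball z r = (fun y => nsq (y - z)) @^-1` [set t | t < r ^+ 2].
  by apply/seteqP; split => y; rewrite /eball /= enorm_ltP.
apply: open_comp; last exact: open_lt.
move=> y _; exact: continuous_nsqB.
Qed.

(** Open sets U_j decreasing to A in measure exist by regularity; near a point of
    A the ball lies in U_j, so that its part outside A lies in U_j minus A, which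
    has small relative mass by [maximal_vanishing]. *)
Lemma density (A : set (borel 'rV[R]_k)) : measurable A ->
  {ae mu, forall x, A (phi x) -> forall eps : R, 0 < eps ->
    exists2 r0 : R, 0 < r0 & forall r : R, 0 < r -> r < r0 ->
      pr mu (pball x r `\` phi @^-1` A) <= eps * pr mu (pball x r)}.
Proof.
move=> mA.
have e0 (j : nat) : 0 < j.+1%:R^-1 :> R by rewrite invr_gt0 ltr0n.
have /choice[U UP] : forall j : nat, exists U : set 'rV[R]_k,
    [/\ open U, A `<=` U & (mu (phi @^-1` (U `\` A)) <= j.+1%:R^-1%:E)%E].
  move=> j; apply: borel_outer_regular => //.
  exact: (@normed_open_Fsigma R 'rV[R]_k).
have mS j : measurable (phi @^-1` (U j `\` A)).
  apply: mpreimage; apply: measurableD => //.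
  by apply: sub_sigma_algebra; have [] := UP j.
have S0 e : 0 < e -> exists j, (mu (phi @^-1` (U j `\` A)) <= e%:E)%E.
  move=> e_gt0; exists (Num.truncn e^-1).
  have [_ _ /le_trans] := UP (Num.truncn e^-1); apply.
  by rewrite lee_fin ltW// invf_plt ?posrE ?ltr0n// truncnS_gt.
have := maximal_vanishing mphi bphi mS S0.
apply: filterS => x H Ax eps eps0.
have [j Hj] := H _ eps0.
have [oU AU _] := UP j.
have [r0 r00 rU] := eball_sub_open oU (AU _ Ax).
exists r0 => // r r_gt0 rr0.
have [_] := Hj r r_gt0.
have mB : measurable (pball x r) by exact: measurable_pball.
rewrite !prE//; last by exact: measurableI.
rewrite -EFinM lee_fin; apply: le_trans; apply: pr_le.
- by apply: measurableD => //; exact: mpreimage.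
- exact: measurableI.
- by move=> y [By nA]; split => //; split => //; exact: rU By.
Qed.

Lemma pball_positive : {ae mu, forall x, forall r : R, 0 < r -> 0 < pr mu (pball x r)}.
Proof.
have := @maximal_vanishing R d Y mu k phi mphi bphi (fun=> set0) (fun=> measurable0).
have h e : 0 < e -> exists j : nat, (mu set0 <= e%:E)%E.
  by move=> e0; exists 0%N; rewrite measure0 lee_fin ltW.
move=> /(_ h); apply: filterS => x H r r0.
have [_ Hj] := H 1 ltr01; have [+ _] := Hj r r0.
by rewrite prE ?lte_fin//; exact: measurable_pball.
Qed.

Definition mass_ratio (E : set Y) (x : Y) (r : R) : R :=
  pr mu (E `&` pball x r) / pr mu (pball x r).

(** For rational a, a Hahn set P a of the charge mu_E - a mu separates the points
    where the limit is at least a from those where it is at most a: by density,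
    small balls lie almost entirely on one side.  The limit is the supremum of
    the a for which x belongs to P a. *)
Lemma ratio_cvg (E : set Y) : measurable E ->
  {ae mu, forall x, exists2 l : R, lim0 (mass_ratio E x) l & E x -> 0 < l}.
Proof.
move=> mE.
have /choice[P PP] : forall a : rat, exists P : set (borel 'rV[R]_k),
  [/\ measurable P,
   forall A, measurable A -> A `<=` P ->
     ratr a * pr mu (phi @^-1` A) <= pr mu (E `&` phi @^-1` A) &
   forall A, measurable A -> A `<=` ~` P ->
     pr mu (E `&` phi @^-1` A) <= ratr a * pr mu (phi @^-1` A)].
  by move=> a; exact: hahn_sets.
have mP a : measurable (P a) by have [] := PP a.
pose D (x : Y) (A : set 'rV[R]_k) := forall eps : R, 0 < eps ->
    exists2 r0 : R, 0 < r0 & forall r : R, 0 < r -> r < r0 ->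
      pr mu (pball x r `\` phi @^-1` A) <= eps * pr mu (pball x r).
pose dec n : rat := odflt 0%Q (unpickle n).
have ae1 : {ae mu, forall x, forall n, P (dec n) (phi x) -> D x (P (dec n))}.
  by apply: ae_foralln => n; exact: density.
have ae2 : {ae mu, forall x, forall n, (~` P (dec n)) (phi x) -> D x (~` P (dec n))}.
  by apply: ae_foralln => n; apply: density; exact: measurableC.
have ae3 : {ae mu, forall x, E x -> exists n : nat, P (n.+1%:R^-1) (phi x)}.
  pose Z := \bigcap_n ~` P (n.+1%:R^-1).
  have mZ : measurable Z by apply: bigcapT_measurable => n; exact: measurableC.
  exists (E `&` phi @^-1` Z); split.
  - by apply: measurableI => //; exact: mpreimage.
  - have mEZ : measurable (E `&` phi @^-1` Z) by apply: measurableI => //; exact: mpreimage.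
    rewrite prE//; congr (_%:E); apply/eqP; rewrite eq_le pr_ge0 andbT.
    apply/ler_addgt0Pr => e e0; rewrite add0r.
    pose n := Num.truncn e^-1.
    have [_ _ h] := PP n.+1%:R^-1.
    apply: (le_trans (h Z mZ _)); first by apply: bigcap_inf.
    rewrite fmorphV/= ratr_nat -[leRHS]mulr1 ler_pM ?pr_ge0//.
    + by rewrite ltW// invf_plt ?posrE ?ltr0n// truncnS_gt.
    + by apply: pr_le1; exact: mpreimage.
  - move=> x /= h; apply: contrapT => nZ; apply: h => Ex.
    apply: contrapT => nP; apply: nZ; split => // n _ Pn.
    by apply: nP; exists n.
apply: (ae_mp _ (ae_and (ae_and ae1 ae2) (ae_and ae3 pball_positive))).
move=> x [[h1 h2] [h3 pos]].
have mB r : measurable (pball x r) by exact: measurable_pball.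
have mEB r : measurable (E `&` pball x r) by exact: measurableI.
have r01 r : 0 < r -> 0 <= mass_ratio E x r <= 1.
  move=> r0; rewrite /mass_ratio divr_ge0 ?pr_ge0//= ler_pdivrMr ?pos// mul1r.
  by apply: pr_le.
have ball_pre r : pball x r = phi @^-1` (eball (phi x) r) by [].
have mPe a r : measurable (P a `&` eball (phi x) r).
  by apply: measurableI => //; exact: measurable_eball.
have lower a : P a (phi x) -> forall e, 0 < e -> exists2 r0 : R, 0 < r0 &
    forall r : R, 0 < r -> r < r0 -> ratr a - e <= mass_ratio E x r.
  move=> Pa e e0.
  have := h1 (pickle a); rewrite /dec pickleK /= => /(_ Pa).
  have e'0 : 0 < e / (`|ratr a| + 1) by rewrite divr_gt0// ltr_wpDl.
  move=> /(_ _ e'0)[r0 r00 H]; exists r0 => // r rgt0 rr0.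
  rewrite /mass_ratio ler_pdivlMr ?pos//.
  have [_ h _] := PP a.
  have := h _ (mPe a r) (@subIsetl _ _ _).
  have : pr mu (E `&` phi @^-1` (P a `&` eball (phi x) r)) <= pr mu (E `&` pball x r).
    apply: pr_le => //; last by move=> y [Ey [_ By]].
    by apply: measurableI => //; exact: mpreimage.
  have := H r rgt0 rr0.
  have := @prDI _ _ _ mu (pball x r) (phi @^-1` P a) (mB r) (mpreimage (mP a)).
  rewrite [pball x r `&` _](_ : _ = phi @^-1` (P a `&` eball (phi x) r)); last first.
    by rewrite setIC.
  set u := pr mu (_ @^-1` _); set v := pr mu (_ `\` _); set w := pr mu (pball x r).
  set t := pr mu (E `&` pball x r); set s := pr mu (E `&` _).
  move=> wE vle st us.
  have v0 : 0 <= v by exact: pr_ge0.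
  have w0 : 0 <= w by exact: pr_ge0.
  have av : ratr a * v <= e * w.
    apply: (@le_trans _ _ (`|ratr a| * (e / (`|ratr a| + 1) * w))).
      by apply: (@le_trans _ _ (`|ratr a| * v)); [rewrite ler_wpM2r// ler_norm|rewrite ler_wpM2l].
    rewrite mulrA ler_wpM2r// mulrCA -[leRHS]mulr1 ler_wpM2l ?(ltW e0)//.
    by rewrite ltW// ltr_pdivrMr ?ltr_wpDl// mul1r ltrDl.
  have aw : ratr a * w = ratr a * u + ratr a * v by rewrite wE mulrDr.
  by rewrite mulrBl; lra.
have upper a : ~ P a (phi x) -> 0 <= a -> forall e, 0 < e -> exists2 r0 : R, 0 < r0 &
    forall r : R, 0 < r -> r < r0 -> mass_ratio E x r <= ratr a + e.
  move=> Pa a0 e e0.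
  have := h2 (pickle a); rewrite /dec pickleK /= => /(_ Pa).
  move=> /(_ _ e0)[r0 r00 H]; exists r0 => // r rgt0 rr0.
  rewrite /mass_ratio ler_pdivrMr ?pos//.
  have [_ _ h] := PP a.
  have mC : measurable (~` P a `&` eball (phi x) r).
    by apply: measurableI; [exact: measurableC|exact: measurable_eball].
  have := h _ mC (@subIsetl _ _ _).
  have := H r rgt0 rr0.
  have mD : measurable (pball x r `\` phi @^-1` (~` P a)).
    by apply: measurableD => //; apply: mpreimage; exact: measurableC.
  have mEC : measurable (E `&` phi @^-1` (~` P a `&` eball (phi x) r)).
    by apply: measurableI => //; exact: mpreimage.
  have : pr mu (E `&` pball x r) <= pr mu (E `&` phi @^-1` (~` P a `&` eball (phi x) r))
      + pr mu (pball x r `\` phi @^-1` (~` P a)).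
    apply: le_trans (prU_le _ mEC mD); apply: pr_le => //.
      exact: measurableU.
    move=> y [Ey By]; have [Py|nPy] := pselect (P a (phi y)); [right|left] => //.
    by split => //; exact.
  have : pr mu (phi @^-1` (~` P a `&` eball (phi x) r)) <= pr mu (pball x r).
    by apply: pr_le => //; [exact: mpreimage|move=> y []].
  set u := pr mu (_ @^-1` _); set v := pr mu (_ `\` _); set w := pr mu (pball x r).
  set t := pr mu (E `&` pball x r); set s := pr mu (E `&` _).
  move=> uw tsv vew su.
  have : ratr a * u <= ratr a * w by rewrite ler_wpM2l ?ler0q.
  by rewrite mulrDl; lra.
(* the set of asymptotic lower bounds of the relative mass *)
pose S := [set b : R | forall e, 0 < e -> exists2 r0 : R, 0 < r0 &
    forall r : R, 0 < r -> r < r0 -> b - e <= mass_ratio E x r].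
have S0 : S 0.
  move=> e e0; exists 1 => // r r0 _; rewrite sub0r.
  by have /andP[h _] := r01 _ r0; rewrite (le_trans _ h)// oppr_le0 ltW.
have ubS : ubound S 1.
  move=> b Sb; apply/ler_addgt0Pr => e e0; have [r0 r00 H] := Sb e e0.
  have := H (r0 / 2) (divr_gt0 r00 (ltr0n _ 2)) _.
  rewrite ltr_pdivrMr// mulr_natr mulr2n ltrDl r00 => /(_ isT).
  have /andP[_ h] := r01 _ (divr_gt0 r00 (ltr0n _ 2)).
  by move=> h'; rewrite -lerBlDr (le_trans h' h).
have supS : has_sup S by split; [exists 0|exists 1].
exists (sup S); last first.
  move=> /h3[n Pn]; apply: (@lt_le_trans _ _ n.+1%:R^-1); first by rewrite invr_gt0 ltr0n.
  apply: ub_le_sup; first by exists 1.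
  by move=> e e0; have := lower _ Pn e e0; rewrite fmorphV /= ratr_nat.
move=> e e0.
have e2 : 0 < e / 2 by rewrite divr_gt0.
have [b Sb bS] := sup_adherent e2 supS.
have [r1 r10 H1] := Sb _ e2.
have sup0 : 0 <= sup S by apply: ub_le_sup => //; exists 1.
have [|a] := @rat_in_itvoo _ (sup S) (sup S + e / 2).
  by rewrite ltrDl.
rewrite in_itv /= => /andP[Sa ae].
have nP : ~ P a (phi x).
  move=> /lower h; have : ratr a <= sup S by apply: ub_le_sup => //; exists 1.
  by rewrite leNgt Sa.
have a0 : 0 <= a by rewrite -(@ler0q R) (le_trans sup0)// ltW.
have [r2 r20 H2] := upper a nP a0 _ e2.
exists (Num.min r1 r2); first by rewrite lt_min r10.
move=> r r0; rewrite lt_min => /andP[rr1 rr2].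
have := H1 r r0 rr1; have := H2 r r0 rr2 => u l.
rewrite ler_norml; apply/andP; split; lra.
Qed.

End differentiation.

(** * A tree of cylinders on the compact space *)

Section subtype_space.
Context {R : realType} {N : nat} {X : set 'rV[R]_N} {X0 : X !=set0}.
Notation XT := (psubspace X0).
Lemma psub_in (x : X) : X (set_val x).
Proof. exact: (set_mem (valP x)). Qed.
Lemma psub_openP (B : set XT) : open B -> exists2 U : set 'rV[R]_N, open U & set_val @^-1` U = B.
Proof. by move=> [U oU UB]; exists U. Qed.
Lemma psub_open (U : set 'rV[R]_N) : open U -> open ((set_val @^-1` U : set X) : set XT).
Proof. by move=> oU; exists U. Qed.
(** The topology of the subspace is metrizable by the norm of the ambient space. *)
Lemma psub_nbhs (p : XT) (B : set XT) : nbhs p B -> exists2 r : R, 0 < r & forall z : XT, `|set_val z - set_val p : 'rV[R]_N| < r -> B z.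
Proof.
rewrite nbhsE => -[C [oC Cp] CB]. have [U oU UC] := psub_openP oC.
have : nbhs (set_val p) U. apply: open_nbhs_nbhs. split => //. by move: Cp; rewrite -UC.
move=> /nbhs_ballP[e /= e0 eU]; exists e => // z zp; apply: CB; rewrite -UC /=; apply: eU; rewrite -ball_normE /= distrC //.
Qed.
Lemma psub_compact : compact X -> compact [set: XT].
Proof.
move=> cX F FF _.
have := cX (fmap (fun x : XT => set_val x : 'rV[R]_N) F) _ _.
case.
  have FT : F (set_val @^-1` X).
    by apply: (@filterS _ F _ setT); [move=> x _; exact: (psub_in x)|exact: filterT].
  exact: FT.
move=> p [Xp cp]; exists (SigSub (mem_set Xp)); split => // A B FA /psub_nbhs[r r0 rB].
have FA' : F (set_val @^-1` [set set_val x | x in A]).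
  by apply: (@filterS _ F _ A) => // x Ax; exists x.
have [_ [[x Ax <-]]] := cp _ _ FA' (nbhsx_ballx p r r0).
by rewrite -ball_normE /= distrC => h; exists x; split => //; exact: rB.
Qed.

Lemma set_val_continuous : continuous (fun x : XT => set_val x : 'rV[R]_N).
Proof. exact: initial_continuous. Qed.

(** A code n for a coordinate and a rational cuts the space by a half space; the
    codes that decode to nothing do not cut. *)
Definition bit (n : nat) : set XT :=
  if unpickle n is Some (i, q) then [set x : XT | (set_val x : 'rV[R]_N) 0 (i : 'I_N) < ratr (q : rat)]
  else setT.

(** The head of w is the newest bit, so that lengthening a word at its head
    refines the cylinder. *)
Fixpoint cyl (w : seq bool) : set XT :=
  if w is c :: w' then cyl w' `&` (if c then bit (size w') else ~` bit (size w'))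
  else setT.

Lemma cyl_agree w (x y : XT) n : cyl w x -> cyl w y -> (n < size w)%N ->
  bit n x -> bit n y.
Proof.
elim: w => //= c w ih [cx bx] [cy yb]; rewrite ltnS leq_eqVlt => /predU1P[->|nw].
  by case: c bx yb.
exact: ih.
Qed.

(** Finitely many rational cuts separate coordinates that are e apart, because the
    space is bounded. *)
Lemma coord_lt_mesh (cX : compact X) (e : R) : 0 < e -> exists M : nat,
  forall w, size w = M -> forall x y : XT, cyl w x -> cyl w y ->
    `|set_val x - set_val y : 'rV[R]_N| <= e.
Proof.
move=> e0; have [B0 [_ XB0]] := compact_bounded cX.
pose B := (Num.truncn (`|B0| + 1)).+1.
have XB (x : XT) i : `|(set_val x : 'rV[R]_N) 0 i| <= B%:R.
  apply: (@le_trans _ _ (`|B0| + 1)); last by rewrite ltW// truncnS_gt.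
  apply: le_trans (XB0 (`|B0| + 1) _ _ (psub_in x)); last first.
    by rewrite (le_lt_trans (ler_norm _))// ltrDl.
  by rewrite [leRHS]mx_normrE; exact: (le_bigmax _ _ (0, i)).
pose m := Num.truncn e^-1.
have me : m.+1%:R^-1 <= e.
  by rewrite ltW// invf_plt ?posrE ?ltr0n// truncnS_gt.
have m0 : 0 < m.+1%:R :> R by rewrite ltr0n.
pose K := (2 * B * m.+1)%N.
pose q (j : nat) : rat := j%:R / m.+1%:R - B%:R.
pose M := (\max_(p : 'I_N * 'I_K.+2) pickle (p.1, q p.2)).+1.
exists M => w wM.
have key (x y : XT) i : cyl w x -> cyl w y ->
    (set_val y : 'rV[R]_N) 0 i <= (set_val x : 'rV[R]_N) 0 i + e.
  move=> cx cy; rewrite leNgt; apply/negP => xy.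
  set u := (set_val x : 'rV[R]_N) 0 i in xy; set v := (set_val y : 'rV[R]_N) 0 i in xy.
  have uB : 0 <= (u + B%:R) * m.+1%:R.
    by rewrite mulr_ge0// -lerBlDr sub0r; have := XB x i; rewrite ler_norml => /andP[].
  pose j := (Num.truncn ((u + B%:R) * m.+1%:R)).+1.
  have jK : (j < K.+2)%N.
    rewrite /j !ltnS; have : (Num.truncn ((u + B%:R) * m.+1%:R))%:R <= K%:R :> R.
      have /andP[h _] := truncn_itv uB; apply: (le_trans h).
      rewrite /K !natrM ler_wpM2r// mulr_natl mulr2n lerD2r.
      by have := XB x i; rewrite ler_norml => /andP[].
    by rewrite ler_nat.
  have qE : ratr (q j) = j%:R / m.+1%:R - B%:R :> R.
    by rewrite /q rmorphB /= fmorph_div /= !ratr_nat.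
  have uq : u < ratr (q j).
    rewrite qE ltrBrDr ltr_pdivlMr//.
    by have /andP[_] := truncn_itv uB.
  have qv : ratr (q j) <= v.
    apply: (@le_trans _ _ (u + e)); last exact: ltW.
    rewrite qE lerBlDr ler_pdivrMr// /j -natr1.
    have /andP[h _] := truncn_itv uB.
    have em : 1 <= e * m.+1%:R by rewrite -ler_pdivrMr// mul1r.
    by lra.
  have nM : (pickle (i, q j) < size w)%N.
    rewrite wM /M ltnS.
    exact: (leq_bigmax (i, Ordinal jK)).
  have := cyl_agree cx cy nM; rewrite /bit pickleK /=.
  by move=> /(_ uq); rewrite ltNge qv.
move=> x y cx cy; rewrite [leLHS]mx_normrE; apply: bigmax_le; first exact: ltW.
move=> [a i] _ /=; rewrite (ord1 a) !mxE ler_norml; apply/andP.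
by have := key x y i cx cy; have := key y x i cy cx; split; lra.
Qed.

(** Uniform continuity on a compact space. *)
Lemma uniform_mesh (cX : compact X) (f : XT -> R) (e : R) : continuous f -> 0 < e ->
  exists M : nat, forall w, size w = M -> forall x y : XT, cyl w x -> cyl w y ->
    `|f x - f y| <= e.
Proof.
move=> cf e0; apply: contrapT => /forallNP nM.
have bad n : exists p : XT * XT, `|set_val p.1 - set_val p.2 : 'rV[R]_N| <= n.+1%:R^-1 /\
    e < `|f p.1 - f p.2|.
  have [|M hM] := @coord_lt_mesh cX n.+1%:R^-1; first by rewrite invr_gt0 ltr0n.
  have /existsNP[w /not_implyP[wM /existsNP[x /existsNP[y h]]]] := nM M.
  move: h => /not_implyP[cx /not_implyP[cy /negP]]; rewrite -ltNge => h.
  by exists (x, y); split => //; exact: (hM w).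
have [p pP] := choice bad.
have [c [_ cc]] : [set: XT] `&` cluster (fmap (fun n => (p n).1) \oo) !=set0.
  by apply: (psub_compact cX); exact: filterT.
have e2 : 0 < e / 2 by rewrite divr_gt0.
have /psub_nbhs[r r0 rB] : nbhs c [set z | `|f c - f z| < e / 2].
  have /cvgrPdist_lt := cf c; exact.
have r2 : 0 < r / 2 by rewrite divr_gt0.
pose n0 := Num.truncn (r / 2)^-1.
have FA : fmap (fun n => (p n).1) \oo [set (p n).1 | n in [set n | (n0 <= n)%N]].
  by exists n0 => // n /= nn; exists n.
have nB : nbhs c [set z : XT | `|set_val z - set_val c : 'rV[R]_N| < r / 2].
  have : open (((fun x : XT => set_val x : 'rV[R]_N) @^-1` ball (set_val c) (r / 2)) : set XT).
    by apply: psub_open; exact: ball_open.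
  move=> oB; have -> : [set z : XT | `|set_val z - set_val c : 'rV[R]_N| < r / 2] =
      (fun x : XT => set_val x : 'rV[R]_N) @^-1` ball (set_val c) (r / 2).
    by apply/seteqP; split => z; rewrite /= -ball_normE /= distrC.
  by apply: open_nbhs_nbhs; split => //=; exact: ballxx.
have [_ [[n /= nn <-] hn]] := cc _ _ FA nB.
have [pn1 pn2] := pP n.
have h1 : `|f c - f (p n).1| < e / 2.
  by apply: rB; apply: lt_trans hn _; rewrite ltr_pdivrMr// mulr_natr mulr2n ltrDl.
have h2 : `|f c - f (p n).2| < e / 2.
  apply: rB; have -> : set_val (p n).2 - set_val c =
    (set_val (p n).1 - set_val c) - (set_val (p n).1 - set_val (p n).2) :> 'rV[R]_N.
    by rewrite opprB [RHS]addrC subrKA.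
  apply: (le_lt_trans (ler_normB _ _)); rewrite (splitr r) ltr_leD//.
  apply: (le_trans pn1); rewrite invf_ple ?posrE ?ltr0n//.
  by rewrite ltW// (lt_le_trans (truncnS_gt _))// ler_nat ltnS.
have : `|f (p n).1 - f (p n).2| < e.
  have -> : f (p n).1 - f (p n).2 = (f c - f (p n).2) - (f c - f (p n).1).
    by rewrite opprB [RHS]addrC subrKA.
  by rewrite (le_lt_trans (ler_normB _ _))// (splitr e) ltrD.
by rewrite ltNge (ltW pn2).
Qed.

Lemma measurable_bit n : measurable (bit n : set (borel XT)).
Proof.
rewrite /bit; case: unpickle => [[i q]|]; last exact: measurableT.
apply: sub_sigma_algebra.
apply: (@psub_open ((fun v : 'rV[R]_N => v 0 i) @^-1` [set t | t < ratr q])).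
apply: open_comp; last exact: open_lt.
by move=> v _; exact: (@coord_continuous R 1 N 0 i v).
Qed.

Lemma measurable_cyl w : measurable (cyl w : set (borel XT)).
Proof.
elim: w => [|c w ih] /=; first exact: measurableT.
apply: measurableI => //; case: c; first exact: measurable_bit.
by apply: measurableC; exact: measurable_bit.
Qed.

Lemma cyl_split w : cyl w = cyl (true :: w) `|` cyl (false :: w).
Proof. by rewrite /= -setIUr setUCr setIT. Qed.

Lemma cyl_disj w : cyl (true :: w) `&` cyl (false :: w) = set0.
Proof. by rewrite /= setIACA setICr setI0. Qed.

End subtype_space.

(** * Integration along the tree *)

(** The Riemann sum over the words of length size w + n below w, weighted by q. *)
Fixpoint tree_sum (R : realType) (y q : seq bool -> R) (n : nat) (w : seq bool) : R :=
  if n is n'.+1 then tree_sum y q n' (true :: w) + tree_sum y q n' (false :: w)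
  else y w * q w.

Lemma tree_sum_lim0 (R : realType) (y : seq bool -> R) (q : R -> seq bool -> R)
    (p : seq bool -> R) n w : (forall w, lim0 (fun r => q r w) (p w)) ->
  lim0 (fun r => tree_sum y (q r) n w) (tree_sum y p n w).
Proof.
move=> qp; elim: n w => [|n ih] w e e0 /=.
  have [|r0 r00 H] := qp w (e / (`|y w| + 1)).
    by rewrite divr_gt0// ltr_wpDl.
  exists r0 => // r rgt0 rr0; rewrite -mulrBr normrM.
  apply: (@le_trans _ _ (`|y w| * (e / (`|y w| + 1)))).
    by rewrite ler_wpM2l// H.
  rewrite mulrCA -[leRHS]mulr1 ler_wpM2l ?(ltW e0)//.
  by rewrite ltW// ltr_pdivrMr ?ltr_wpDl// mul1r ltrDl.
have e2 : 0 < e / 2 by rewrite divr_gt0.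
have [r1 r10 H1] := ih (true :: w) _ e2.
have [r2 r20 H2] := ih (false :: w) _ e2.
exists (Num.min r1 r2); first by rewrite lt_min r10.
move=> r rgt0; rewrite lt_min => /andP[rr1 rr2].
have -> : forall a b c d : R, a + b - (c + d) = (a - c) + (b - d) by move=> *; ring.
by rewrite (le_trans (ler_normD _ _))// (splitr e) lerD// ?H1// H2.
Qed.

Section tree_integral.
Context {R : realType} d {Y : measurableType d} (m : {measure set Y -> \bar R}).
Variables (A : seq bool -> set Y) (g : Y -> R) (y : seq bool -> R) (M : nat) (e : R).
Hypothesis mA : forall w, measurable (A w).
Hypothesis Asplit : forall w, A w = A (true :: w) `|` A (false :: w).
Hypothesis Adisj : forall w, A (true :: w) `&` A (false :: w) = set0.
Hypothesis finm : forall w, (m (A w) < +oo)%E.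
Hypothesis mg : measurable_fun setT g.
Hypothesis bg : exists B, forall x, `|g x| <= B.
Hypothesis gy : forall w x, size w = M -> A w x -> `|g x - y w| <= e.

Lemma bounded_integrable w (h : Y -> R) : measurable_fun setT h ->
  (exists B, forall x, `|h x| <= B) -> m.-integrable (A w) (EFin \o h).
Proof.
move=> mh bh; apply: measurable_bounded_integrable => //.
  exact: measurable_funS mh.
have [B gB] := bh; exists B; split; first exact: num_real.
by move=> t Bt x _; rewrite /= (le_trans (gB x))// ltW.
Qed.

(** A Riemann sum over a partition on which g oscillates by at most e. *)
Lemma tree_integral n w : (size w + n = M)%N ->
  `|(\int[m]_(x in A w) g x)%R - tree_sum y (fun w => fine (m (A w))) n w|
    <= e * fine (m (A w)).
Proof.
elim: n w => [|n ih] w wM /=.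
  rewrite addn0 in wM.
  have ic c : m.-integrable (A w) (EFin \o (fun=> c : R)).
    by apply: bounded_integrable => //; exists `|c|.
  rewrite -(Rintegral_cst m (mA w)) -RintegralB//; last exact: bounded_integrable.
  rewrite -(Rintegral_cst m (mA w)).
  have igy : m.-integrable (A w) (EFin \o (fun x => g x - y w)).
    apply: bounded_integrable; first exact: measurable_funB.
    have [B gB] := bg; exists (B + `|y w|) => x.
    by rewrite (le_trans (ler_normB _ _))// lerD2r.
  apply: (le_trans (le_normr_Rintegral _ _)) => //.
  apply: le_Rintegral => //.
  - by have := integrable_norm igy.
  - by move=> x Ax; exact: gy.
have st : (size (true :: w) + n = M)%N by rewrite /= addSnnS.
have sf : (size (false :: w) + n = M)%N by rewrite /= addSnnS.
have -> : fine (m (A w)) = fine (m (A (true :: w))) + fine (m (A (false :: w))).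
  rewrite -fineD ?ge0_fin_numE// (Asplit w) measureU//.
have -> : (\int[m]_(x in A w) g x)%R = (\int[m]_(x in A (true :: w)) g x)%R +
    (\int[m]_(x in A (false :: w)) g x)%R.
  rewrite {1}Asplit Rintegral_setU//.
    by rewrite -Asplit; exact: bounded_integrable.
  by apply/disj_setPS => x; rewrite Adisj.
have -> : forall a b c d : R, a + b - (c + d) = (a - c) + (b - d) by move=> *; ring.
by rewrite (le_trans (ler_normD _ _))// mulrDr lerD// ih.
Qed.

End tree_integral.

(** * A measure with prescribed cylinder masses *)

Lemma continuous_dist (R : realType) (T : topologicalType) (V : normedModType R)
    (g : T -> V) (v : V) : continuous g -> continuous (fun x => `|g x - v|).
Proof.
move=> cg x; apply: (@continuous_comp _ _ _ (fun x => g x - v) (fun z : V => `|z|)).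
  exact: (cvgB (cg x) (cvg_cst v)).
exact: norm_continuous.
Qed.

Lemma closure_osc (R : realType) (T : topologicalType) (V : normedModType R)
    (g : T -> V) (A : set T) (e : R) : continuous g ->
  (forall x y, A x -> A y -> `|g x - g y| <= e) ->
  forall x y, closure A x -> closure A y -> `|g x - g y| <= e.
Proof.
move=> cg Ae.
have cl v : closed [set x | `|g x - v| <= e].
  apply: (@closed_comp _ _ (fun x => `|g x - v|) [set t | t <= e]); last exact: closed_le.
  by move=> x _; exact: continuous_dist.
have clS v : (forall x, A x -> `|g x - v| <= e) -> forall x, closure A x -> `|g x - v| <= e.
  move=> Av; have : closure A `<=` [set x | `|g x - v| <= e].
    by rewrite [X in _ `<=` X]((closure_id _).1 (cl v)); apply: closure_subset.
  by apply.
move=> x y cx cy; apply: (clS _ _ _ cx) => a Aa; rewrite distrC.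
by apply: (clS _ _ _ cy) => b Ab; rewrite distrC; exact: Ae.
Qed.

Section tree_measure.
Context {R : realType} {N : nat} {X : set 'rV[R]_N} {X0 : X !=set0}.
Notation XT := (psubspace X0).
Hypothesis cX : compact X.
Variable p : seq bool -> R.
Hypothesis p0 : forall w, 0 <= p w.
Hypothesis p1 : p [::] = 1.
Hypothesis pS : forall w, p w = p (true :: w) + p (false :: w).
Hypothesis pN0 : forall w, 0 < p w -> cyl (X0 := X0) w !=set0.

(** The left end of the subinterval of [0, 1[ that is allotted to the word w when
    an interval of length p w is split between its two continuations. *)
Fixpoint slot_left (w : seq bool) : R :=
  if w is c :: w' then if c then slot_left w' else slot_left w' + p (true :: w') else 0.

Definition slot w : set R := `[slot_left w, slot_left w + p w[.

Lemma slotE w t : slot w t <-> slot_left w <= t < slot_left w + p w.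
Proof. by rewrite /slot /= in_itv. Qed.

Lemma slot_nil : slot [::] = `[0, 1[%classic.
Proof. by rewrite /slot /= add0r p1. Qed.

Lemma slot_split w : slot w = slot (true :: w) `|` slot (false :: w).
Proof.
apply/seteqP; split => t; rewrite /setU /= !slotE /=.
  move=> /andP[h1 h2]; case: (ltP t (slot_left w + p (true :: w))) => h.
    by left; rewrite h1.
  by right; rewrite /= -addrA -pS.
have := pS w; have := p0 (true :: w); have := p0 (false :: w) => f0 t0 pw.
by move=> [] /andP[h1 h2]; apply/andP; split; lra.
Qed.

Lemma slot_disj w : slot (true :: w) `&` slot (false :: w) = set0.
Proof.
rewrite -subset0 => t [] /slotE /= /andP[h1 h2] /slotE /= /andP[h3 h4].
by move: h2; rewrite ltNge h3.
Qed.

Lemma slot_sub w : slot w `<=` `[0, 1[%classic.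
Proof.
elim: w => [|c w ih]; first by rewrite slot_nil.
apply: subset_trans ih; rewrite [X in _ `<=` X]slot_split.
by case: c; [exact: subsetUl|exact: subsetUr].
Qed.

Lemma slot_pos w t : slot w t -> 0 < p w.
Proof. by move=> /slotE/andP[h1 h2]; lra. Qed.

(** The word of length n whose interval contains t. *)
Fixpoint word (n : nat) (t : R) : seq bool :=
  if n is n'.+1 then let w := word n' t in (t < slot_left w + p (true :: w)) :: w
  else [::].

Lemma size_word n t : size (word n t) = n.
Proof. by elim: n => //= n ->. Qed.

Lemma slot_word n t : `[0, 1[%classic t -> slot (word n t) t.
Proof.
move=> t01; elim: n => [|n]; first by rewrite slot_nil.
rewrite slot_split => -[] /slotE /= /andP[h1 h2].
  by rewrite h2; apply/slotE; rewrite /= h1.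
by rewrite ltNge h1 /=; apply/slotE; rewrite /= h1.
Qed.

Lemma word_uniq w t : slot w t -> w = word (size w) t.
Proof.
elim: w => //= c w ih swt.
have sw : slot w t by rewrite slot_split; case: c swt; [left|right].
rewrite -(ih sw); congr (_ :: _); move/slotE : swt => /=.
by case: c => /andP[h1 h2]; [rewrite h2|rewrite ltNge h1].
Qed.

Lemma cyl_word_sub n m t : (n <= m)%N -> cyl (X0 := X0) (word m t) `<=` cyl (word n t).
Proof.
elim: m => [|m ih]; first by rewrite leqn0 => /eqP ->.
rewrite leq_eqVlt ltnS => /predU1P[->//|/ih h].
by apply: subset_trans h => x [].
Qed.

(** The closures of the cylinders along the branch selected by t are nested and
    nonempty, since an interval of positive length stands for a cylinder of
    positive weight. *)
Lemma limit_point t : exists c : XT, `[0, 1[%classic t ->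
  forall w, slot w t -> closure (cyl w) c.
Proof.
have [t01|nt] := pselect (`[0, 1[%classic t); last by exists point.
have /choice[x xP] : forall n, exists x : XT, cyl (word n t) x.
  by move=> n; have [x] := pN0 (slot_pos (slot_word n t01)); exists x.
have [c [_ cc]] : [set: XT] `&` cluster (fmap x \oo) !=set0.
  by apply: (psub_compact cX); exact: filterT.
exists c => _ w /word_uniq -> B nB.
have FA : fmap x \oo (cyl (word (size w) t)).
  by exists (size w) => // n /= wn; exact: (cyl_word_sub wn).
exact: cc FA nB.
Qed.

(** A point of the closures of all cylinders along the branch of t.  It may
    lie outside the cylinders, but a continuous function oscillates on a closure
    no more than on the set, by [closure_osc]. *)
Definition climb (t : R) : XT := projT1 (cid (limit_point t)).

Lemma climbP w t : slot w t -> closure (cyl w) (climb t).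
Proof.
by move=> swt; apply: (projT2 (cid (limit_point t))) => //; exact: slot_sub swt.
Qed.

Definition climb0 (t : R) : borel XT := if t \in `[0, 1[%R then climb t else point.

Lemma climb0E t : `[0, 1[%classic t -> climb0 t = climb t.
Proof. by rewrite /climb0 /= => ->. Qed.

(** An open set contains the closure of a small cylinder about each limit point in
    it, so that its preimage is a countable union of intervals. *)
Lemma measurable_climb0 : measurable_fun setT climb0.
Proof.
apply: (@measurability _ _ _ _ setT climb0 (@open XT)) => //.
move=> _ [U oU <-]; rewrite setTI.
have -> : climb0 @^-1` U =
    (\bigcup_(w in [set w | closure (cyl w) `<=` (U : set XT)]) slot w)
    `|` (~` `[0, 1[%classic `&` [set t : R | U (point : XT)]).
  apply/seteqP; split => t.
    have [t01|nt] := pselect (`[0, 1[%classic t); last first.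
      by rewrite /climb0 /= ifN; [right|exact/negP].
    rewrite /= climb0E// => Uc; left.
    have /psub_nbhs[r r0 rU] : nbhs (climb t) U by exact: open_nbhs_nbhs.
    have r2 : 0 < r / 2 by rewrite divr_gt0.
    have [M HM] := coord_lt_mesh (X0 := X0) cX r2.
    exists (word M t); last exact: slot_word.
    move=> z cz; apply: rU.
    have := closure_osc (@set_val_continuous R N X X0) (HM _ (size_word M t)) cz
      (climbP (slot_word M t01)).
    by move=> /le_lt_trans; apply; rewrite ltr_pdivrMr// mulr_natr mulr2n ltrDl.
  move=> [[w wU swt]|[nt Up]]; rewrite /=.
    by rewrite climb0E; [apply: wU; exact: climbP|exact: slot_sub swt].
  by rewrite /climb0 ifN//; exact/negP.
apply: measurableU.
  rewrite bigcup_mkcond; apply: countable_bigcupT_measurable; first exact: countableP.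
  by move=> w; case: ifP => // _; exact: measurable_itv.
apply: measurableI; first by apply: measurableC; exact: measurable_itv.
have [Up|nUp] := pselect (U (point : XT)).
  by rewrite (_ : [set _ | _] = setT)//; apply/seteqP; split.
by rewrite (_ : [set _ | _] = set0)//; apply/seteqP; split.
Qed.

(** The value of f at an arbitrary point of the cylinder; an empty
    cylinder has weight 0, so that the default value of [get] is multiplied by 0. *)
Definition word_val (f : XT -> R) (w : seq bool) : R := f (get (cyl w)).

Lemma psub_continuous_bounded (f : XT -> R) : continuous f ->
  exists B, forall x, `|f x| <= B.
Proof.
move=> cf; have cT := psub_compact cX (X0 := X0).
have /compact_bounded[B [_ fB]] := continuous_compact (continuous_subspaceT cf) cT.
by exists (B + 1) => x; apply: (fB (B + 1)); [rewrite ltrDl|exists x].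
Qed.

Lemma continuous_borel_measurable (T : ptopologicalType) (f : T -> R) : continuous f ->
  measurable_fun setT (f : borel T -> R).
Proof.
move=> cf; apply: (measurability _ (RGenOInfty.measurableE R)).
move=> _ [_ [a ->] <-]; rewrite setTI; apply: sub_sigma_algebra.
by apply: open_comp => //; exact: interval_open.
Qed.

(** The image of Lebesgue measure on [0, 1[ under climb.  A cylinder need not have
    mass p w, as mass may sit on its boundary, but integrals of continuous
    functions are those which the weights prescribe. *)
Lemma tree_measure : exists m : {measure set (borel XT) -> \bar R},
  forall (f : XT -> R) (M : nat) (e : R), continuous f ->
  (forall w, size w = M -> forall x y, cyl w x -> cyl w y -> `|f x - f y| <= e) ->
  exists2 I : R, (\int[m]_x (f x)%:E = I%:E)%E &
    `|I - tree_sum (word_val f) p M [::]| <= e.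
Proof.
pose leb : {measure set (measurableTypeR R) -> \bar R} := @lebesgue_measure R.
pose I01 : set R := `[0, 1[%classic.
have leb01 : leb I01 = 1%E.
  by have := lebesgue_measure_itv (`[0, 1[ : interval R); rewrite /= lte01 oppr0 adde0.
have mI : measurable (I01 : set (measurableTypeR R)) by exact: measurable_itv.
have lI : (leb I01 < +oo)%E by rewrite leb01 ltry.
pose lam : {finite_measure set (measurableTypeR R) -> \bar R} := mfrestr mI lI.
exists (measure_function_pushforward__canonical__measure_function_Measure lam measurable_climb0).
move=> f M e cf fM.
have mc := measurable_climb0.
have mf := continuous_borel_measurable cf.
have mfc : measurable_fun setT (f \o climb0) by exact: measurableT_comp.
have [B fB] := psub_continuous_bounded cf.
have lamT : lam setT = 1%E.
  by rewrite /lam /= /mfrestr /mrestr setTI leb01.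
have lam_slot w : lam (slot w) = (p w)%:E.
  rewrite /lam /= /mfrestr /mrestr setIidl; last exact: slot_sub.
  have /= := lebesgue_measure_itv (`[slot_left w, slot_left w + p w[ : interval R).
  move=> ->; rewrite lte_fin ltrDl; case: ltP => [_|pw].
    by rewrite -EFinB addrC addKr.
  by congr (_%:E); apply/eqP; rewrite eq_le pw p0.
have finlam w : (lam (slot w) < +oo)%E by rewrite lam_slot ltry.
have mslot w : measurable (slot w) by exact: measurable_itv.
have ifc : lam.-integrable setT (EFin \o (f \o climb0)).
  have lamoo : (lam setT < +oo)%E by rewrite lamT ltry.
  apply: (measurable_bounded_integrable measurableT lamoo mfc).
  exists B; split; first exact: num_real.
  by move=> t Bt x _; rewrite /= (le_trans (fB _))// ltW.
exists (\int[lam]_(t in setT) (f \o climb0) t)%R.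
  rewrite integral_pushforward//=.
  - by rewrite /Rintegral fineK//; exact: integrable_fin_num.
  - exact/measurable_EFinP.
have gy w t : size w = M -> slot w t -> `|(f \o climb0) t - word_val f w| <= e.
  move=> wM swt; rewrite /= climb0E; last exact: slot_sub swt.
  apply: (closure_osc cf (fM w wM)); first exact: climbP.
  by apply: subset_closure; apply: getPex; exact: pN0 (slot_pos swt).
have le1 : e * fine (lam (slot [::])) <= e by rewrite lam_slot p1 mulr1.
have key := le_trans (@tree_integral R _ _ lam slot (f \o climb0) (word_val f) M e mslot
  slot_split slot_disj finlam mfc (ex_intro _ B (fun t => fB (climb0 t))) gy M [::]
  (add0n _)) le1.
have pE : (fun w => fine (lam (slot w))) = p by apply/funext => w; rewrite lam_slot.
rewrite pE in key.
suff -> : (\int[lam]_(t in setT) (f \o climb0) t)%R =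
    (\int[lam]_(x in slot [::]) (f \o climb0) x)%R by [].
rewrite /Rintegral [in LHS](@negligible_integral _ _ _ lam setT (~` slot [::]))//.
- by rewrite setTD setCK.
- by apply: measurableC; exact: mslot.
- rewrite /lam /= /mfrestr /mrestr slot_nil setICl; exact: measure0.
Qed.

End tree_measure.

(** * Existence of the conditional measures *)

Section lim0.
Variable R : realType.
Implicit Types (f g : R -> R) (l m : R).

Lemma lim0_unique f l m : lim0 f l -> lim0 f m -> l = m.
Proof.
move=> fl fm; apply/eqP; rewrite -subr_eq0 -normr_le0; apply/ler_addgt0Pr => e e0.
rewrite add0r; have e2 : 0 < e / 2 by rewrite divr_gt0.
have [r r0 H] := fl _ e2; have [s s0 H'] := fm _ e2.
pose t := Num.min r s / 2.
have t0 : 0 < t by rewrite divr_gt0// lt_min r0.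
have tm : t < Num.min r s by rewrite ltr_pdivrMr// mulr_natr mulr2n ltrDl lt_min r0.
move: tm; rewrite lt_min => /andP[tr ts].
have -> : l - m = (f t - m) - (f t - l) by rewrite opprB [RHS]addrC subrKA.
by rewrite (le_trans (ler_normB _ _))// (splitr e) lerD// ?H// H'.
Qed.

Lemma lim0D f g l m : lim0 f l -> lim0 g m -> lim0 (fun r => f r + g r) (l + m).
Proof.
move=> fl fm e e0; have e2 : 0 < e / 2 by rewrite divr_gt0.
have [r r0 H] := fl _ e2; have [s s0 H'] := fm _ e2.
exists (Num.min r s); first by rewrite lt_min r0.
move=> t t0; rewrite lt_min => /andP[tr ts].
rewrite opprD addrACA (le_trans (ler_normD _ _))// (splitr e) lerD// ?H// H'//.
Qed.

Lemma lim0_eq f g l : (forall r, 0 < r -> f r = g r) -> lim0 f l -> lim0 g l.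
Proof.
by move=> fg fl e e0; have [r r0 H] := fl _ e0; exists r => // t t0 tr; rewrite -fg// H.
Qed.

Lemma lim0_ge0 f l : (forall r, 0 < r -> 0 <= f r) -> lim0 f l -> 0 <= l.
Proof.
move=> f0 fl; apply/ler_addgt0Pr => e e0; have [r r0 H] := fl _ e0.
have r2 : 0 < r / 2 by rewrite divr_gt0.
have := H _ r2; rewrite ltr_pdivrMr// mulr_natr mulr2n ltrDl => /(_ r0).
by rewrite ler_norml => /andP[_ h]; have := f0 _ r2; lra.
Qed.

Lemma lim0_cst l : lim0 (fun=> l) l.
Proof. by move=> e e0; exists 1 => // r _ _; rewrite subrr normr0 ltW. Qed.

Lemma lim0_at_right f l : lim0 f l -> f r @[r --> 0^'+] --> l.
Proof.
move=> fl; apply/cvgrPdist_le => e e0; have [r r0 H] := fl _ e0.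
near=> t; rewrite distrC; apply: H.
  by near: t; exact: nbhs_right_gt.
by near: t; exact: nbhs_right_lt.
Unshelve. all: by end_near. Qed.

End lim0.

Lemma tree_sumZ (R : realType) (y q : seq bool -> R) c n w :
  tree_sum y (fun w => q w * c) n w = tree_sum y q n w * c.
Proof. by elim: n w => [|n ih] w /=; [rewrite mulrA|rewrite !ih mulrDl]. Qed.

Lemma continuous_measurable_borel (T1 T2 : ptopologicalType) (f : T1 -> T2) :
  continuous f -> measurable_fun setT (f : borel T1 -> borel T2).
Proof.
move=> cf; apply: (@measurability _ _ _ _ setT (f : borel T1 -> borel T2) (@open T2)) => //.
move=> _ [U oU <-]; rewrite setTI; apply: sub_sigma_algebra.
by apply: open_comp.
Qed.

Section cond_exists.
Context {R : realType} {N : nat} {X : set 'rV[R]_N} {X0 : X !=set0}.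
Notation XT := (psubspace X0).
Hypothesis cX : compact X.
Variables (mu : probability (borel XT) R) (k : nat) (phi : XT -> 'rV[R]_k).
Hypothesis cphi : continuous phi.

Lemma phi_measurable : measurable_fun setT (phi : borel XT -> borel 'rV[R]_k).
Proof. exact: continuous_measurable_borel. Qed.

Lemma phi_coord_continuous c : continuous (fun y : XT => phi y 0 c).
Proof.
move=> y; apply: (@continuous_comp _ _ _ phi (fun v : 'rV[R]_k => v 0 c)).
  exact: cphi.
exact: (@coord_continuous R 1 k 0 c).
Qed.

Lemma phi_coord_measurable c : measurable_fun setT (fun y : borel XT => phi y 0 c).
Proof. by apply: continuous_borel_measurable; exact: phi_coord_continuous. Qed.

Lemma phi_bounded : exists M, forall (y : borel XT) c, `|phi y 0 c| <= M.
Proof.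
have /choice[B BP] : forall c, exists B, forall x, `|phi x 0 c| <= B.
  by move=> c; exact: (psub_continuous_bounded cX (@phi_coord_continuous c)).
exists (\sum_c `|B c|) => y c; rewrite (bigD1 c)//=.
apply: (@le_trans _ _ (`|B c|)); first by rewrite (le_trans (BP c y))// ler_norm.
by rewrite lerDl sumr_ge0.
Qed.

Notation pball := (@pball R _ (borel XT) k phi).
Notation mratio := (@mass_ratio R _ (borel XT) mu k phi).

Lemma mpball x r : measurable (pball x r).
Proof. by apply: measurable_pball; exact: phi_coord_measurable. Qed.

Lemma avg_EFin (f : XT -> R) x r : continuous f ->
  ((fine (mu (phi @^-1` eball (phi x) r)))^-1%:E *
        \int[mu]_(x in phi @^-1` eball (phi x) r) (f x)%:E)%E =
  ((\int[mu]_(x in pball x r) f x)%R / pr mu (pball x r))%:E.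
Proof.
move=> cf; rewrite mulrC EFinM /Rintegral fineK//.
apply: integrable_fin_num; first exact: mpball.
have [B fB] := psub_continuous_bounded cX cf.
apply: measurable_bounded_integrable; first exact: mpball.
- by rewrite (le_lt_trans (probability_le1 _ _)) ?ltry//; exact: mpball.
- by apply: measurable_funS (continuous_borel_measurable cf).
- exists B; split; first exact: num_real.
  by move=> t Bt y _; rewrite /= (le_trans (fB y))// ltW.
Qed.

(** By [ratio_cvg] the relative masses of the countably many cylinders converge to
    weights p, to which [tree_measure] associates a measure.  Along the tree,
    averages of continuous functions over small balls approach the integrals
    against that measure. *)
Lemma cond_exists : {ae mu, forall x, exists nu, is_cond_measure mu phi (phi x) nu}.
Proof.
pose dec n : seq bool := odflt [::] (unpickle n).
have ae1 : {ae mu, forall x, forall n, exists l, lim0 (mratio (cyl (dec n)) x) l}.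
  apply: ae_foralln => n.
  apply: ae_mp (ratio_cvg mu phi_measurable phi_coord_measurable phi_bounded
     (measurable_cyl (dec n))).
  by move=> x [l hl _]; exists l.
have ae2 := pball_positive mu phi_coord_measurable phi_bounded.
apply: ae_mp (ae_and ae1 ae2) => x [h pos].
have /choice[p pP] : forall w : seq bool, exists l, lim0 (mratio (cyl w) x) l.
  by move=> w; have := h (pickle w); rewrite /dec pickleK.
have rr w r : 0 <= mratio (cyl w) x r by rewrite divr_ge0 ?pr_ge0.
have p0 w : 0 <= p w by apply: (lim0_ge0 _ (pP w)) => r _; exact: rr.
have p1 : p [::] = 1.
  apply: (lim0_unique (pP [::])); apply: lim0_eq (lim0_cst 1) => r r0.
  by rewrite /mass_ratio /= setTI divff// gt_eqF// pos.
have mcb w r : measurable ((cyl w : set (borel XT)) `&` pball x r).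
  by apply: measurableI; [exact: measurable_cyl|exact: mpball].
have prS w r : pr mu (cyl w `&` pball x r) =
    pr mu (cyl (true :: w) `&` pball x r) + pr mu (cyl (false :: w) `&` pball x r).
  rewrite (@prDI _ _ _ mu (cyl w `&` pball x r) (cyl (true :: w)))//; last exact: measurable_cyl.
  congr (pr mu _ + pr mu _); apply/seteqP; rewrite /setI /setD /setC /mkset; split => y /=; tauto.
have pS w : p w = p (true :: w) + p (false :: w).
  apply: (lim0_unique (pP w)).
  apply: lim0_eq (lim0D (pP (true :: w)) (pP (false :: w))) => r r0.
  by rewrite /mass_ratio (prS w) mulrDl.
have pN0 w : 0 < p w -> cyl (X0 := X0) w !=set0.
  move=> pw; apply/set0P/eqP => c0; suff pw0 : p w = 0 by rewrite pw0 ltxx in pw.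
  apply: (lim0_unique (pP w)); apply: lim0_eq (lim0_cst 0) => r r0.
  by rewrite /mass_ratio c0 set0I /pr measure0 mul0r.
have [m mP] := tree_measure cX p0 p1 pS pN0.
exists m => f cf.
have [I II] : exists I : R, (\int[m]_x (f x)%:E = I%:E)%E.
  have [M HM] := uniform_mesh (X0 := X0) cX cf ltr01.
  by have [I II _] := mP f M 1 cf HM; exists I.
rewrite II; under eq_fun do rewrite (avg_EFin _ _ cf).
apply: cvg_EFin; first by near=> r.
apply: (@lim0_at_right R (fun r => (\int[mu]_(x in pball x r) f x)%R / pr mu (pball x r))).
move=> e e0; have e3 : 0 < e / 3 by rewrite divr_gt0.
have [M HM] := uniform_mesh (X0 := X0) cX cf e3.
have [I' II' HI] := mP f M _ cf HM.
have {II'}EI : I' = I by apply: EFin_inj; rewrite -II -II'.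
rewrite {}EI in HI.
have [r0 r00 Hr] := @tree_sum_lim0 R (word_val f) (fun r w => mratio (cyl w) x r) p M [::] pP _ e3.
exists r0 => // r rgt0 rr0; have := Hr r rgt0 rr0.
have [B fB] := psub_continuous_bounded cX cf.
pose A w : set (borel XT) := cyl w `&` pball x r.
have split' w : A w = A (true :: w) `|` A (false :: w).
  by rewrite /A -setIUl -cyl_split.
have disj' w : A (true :: w) `&` A (false :: w) = set0.
  by rewrite /A setIACA cyl_disj set0I.
have mA w : measurable (A w) by exact: mcb.
have fin' w : (mu (A w) < +oo)%E.
  by rewrite (le_lt_trans (probability_le1 _ _)) ?ltry.
have osc w y : size w = M -> A w y -> `|f y - word_val f w| <= e / 3.
  by move=> wM [cy _]; apply: (HM w wM) => //; apply: getPex; exists y.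
have := @tree_integral R _ (borel XT) mu A f (word_val f) M (e / 3) mA split' disj' fin'
  (continuous_borel_measurable cf) (ex_intro _ B fB) osc M [::] (add0n _).
rewrite /A /= setTI.
have pw := pos r rgt0; rewrite -/(pr mu (pball x r)).
set J := (\int[mu]_(x0 in pball x r) f x0)%R; set w := pr mu (pball x r).
have -> : tree_sum (word_val f) (fun w : seq bool => fine (mu (cyl w `&` pball x r))) M [::] =
   tree_sum (word_val f) (fun w => mratio (cyl w) x r) M [::] * w.
  rewrite -tree_sumZ; congr (tree_sum _ _ _ _); apply/funext => v.
  by rewrite /mass_ratio -mulrA mulVf ?mulr1// gt_eqF.
set S := tree_sum _ _ M [::]; set S' := tree_sum _ _ M [::] in HI *.
move=> h1 h2.
have h3 : `|J / w - S| <= e / 3.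
  have w0 : 0 < w by exact: pw.
  have -> : J / w - S = (J - S * w) / w by rewrite mulrBl mulfK ?gt_eqF.
  by rewrite normrM normfV (gtr0_norm w0) ler_pdivrMr.
have -> : J / w - I = (J / w - S) + ((S - S') - (I - S')) by ring.
rewrite (le_trans (ler_normD _ _))//.
have -> : e = e / 3 + (e / 3 + e / 3) by field.
by rewrite lerD// (le_trans (ler_normB _ _))// lerD.
Unshelve. all: by end_near. Qed.

End cond_exists.

(** * Conditional measures of Borel sets *)

Section open_approx.
Context {R : realType} {V : normedModType R} (U : set V).
Hypothesis oU : open U.

Let dset (x : V) : set R := [set `|x - y| | y in ~` U] `|` [set 1].
(** The distance to the complement of U, capped at 1 to keep it finite when the
    complement is empty. *)
Definition codist x := inf (dset x).

Let dset_lb x : lbound (dset x) 0.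
Proof. by move=> t [[y _ <-]|->]. Qed.

Lemma codist_ge0 x : 0 <= codist x.
Proof. by apply: lb_le_inf; [exists 1; right|exact: dset_lb]. Qed.

Lemma codist_le x t : dset x t -> codist x <= t.
Proof. by move=> h; apply: ge_inf => //; exists 0; exact: dset_lb. Qed.

Lemma codist_gt0 x : U x -> 0 < codist x.
Proof.
move=> Ux; have /nbhs_ballP[e /= e0 eU] : nbhs x U by exact: open_nbhs_nbhs.
apply: (@lt_le_trans _ _ (Num.min e 1)); first by rewrite lt_min e0 ltr01.
apply: lb_le_inf; first by exists 1; right.
move=> t [[y nUy <-]|->]; last by rewrite ge_min lexx orbT.
rewrite ge_min; apply/orP; left; rewrite leNgt; apply/negP => h; apply: nUy.
by apply: eU; rewrite -ball_normE.
Qed.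

Lemma codist_eq0 x : ~ U x -> codist x = 0.
Proof.
move=> nU; apply/eqP; rewrite eq_le codist_ge0 andbT; apply: codist_le.
by left; exists x => //; rewrite subrr normr0.
Qed.

Lemma codist_lip x z : codist x <= `|x - z| + codist z.
Proof.
rewrite -lerBlDl; apply: lb_le_inf; first by exists 1; right.
move=> t [[y nU <-]|->]; rewrite lerBlDl.
  apply: (@le_trans _ _ `|x - y|); first by apply: codist_le; left; exists y.
  by rewrite (_ : x - y = (x - z) + (z - y)) ?ler_normD // subrKA.
apply: (@le_trans _ _ 1); first by apply: codist_le; right.
by rewrite lerDr.
Qed.

Lemma codist_continuous : continuous codist.
Proof.
move=> x; apply/cvgrPdist_le => e e0; apply/nbhs_ballP; exists e => // z.
rewrite -ball_normE /= => xz.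
rewrite ler_norml; have := codist_lip x z; have := codist_lip z x.
by rewrite (distrC z x) => h1 h2; apply/andP; split; lra.
Qed.

(** The functions min(1, (n+1) codist) increase to the indicator of U. *)
Lemma open_approx : exists (F : nat -> set V) (f : nat -> V -> R),
  [/\ forall n, closed (F n), {homo F : n m / (n <= m)%N >-> n `<=` m},
     U = \bigcup_n F n, forall n, continuous (f n) &
     forall n x, [/\ 0 <= f n x, f n x <= 1, F n x -> f n x = 1 & ~ U x -> f n x = 0]].
Proof.
exists (fun n => [set x | n.+1%:R^-1 <= codist x]).
exists (fun n x => Num.min 1 (n.+1%:R * codist x)); split.
- move=> n; apply: (@closed_comp _ _ codist [set t | n.+1%:R^-1 <= t]); last exact: closed_ge.
  by move=> x _; exact: codist_continuous.
- move=> n m nm x /=; apply: le_trans.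
  by rewrite lef_pV2 ?posrE ?ltr0n// ler_nat.
- apply/seteqP; split => x.
    move=> /codist_gt0 h; exists (Num.truncn (codist x)^-1) => //=.
    by rewrite ltW// invf_plt ?posrE ?ltr0n// truncnS_gt.
  move=> [n _ /= h]; apply: contrapT => /codist_eq0 z.
  by move: h; rewrite z leNgt invr_gt0 ltr0n.
- move=> n x; apply: (@continuous_comp _ _ _ codist (fun t => Num.min 1 (n.+1%:R * t))).
    exact: codist_continuous.
  have c1 : continuous (fun t : R => n.+1%:R * t) by exact: mulrl_continuous.
  have c2 : continuous (cst 1 : R -> R) by move=> ?; exact: cvg_cst.
  exact: (continuous_min (c2 _) (c1 _)).
- move=> n x; have n0 : 0 < n.+1%:R :> R by rewrite ltr0n.
  split.
  + by rewrite le_min ler01 mulr_ge0 ?codist_ge0// ltW.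
  + by rewrite ge_min lexx.
  + by move=> /= h; apply/min_idPl; rewrite -ler_pdivrMl// mulr1.
  + move=> /codist_eq0 ->; rewrite mulr0; apply/min_idPr; exact: ler01.
Qed.

End open_approx.

Definition inv_succ (R : realType) (n : nat) : R := n.+1%:R^-1.

Lemma inv_succ_gt0 (R : realType) n : 0 < inv_succ R n.
Proof. by rewrite /inv_succ invr_gt0 ltr0n. Qed.

Lemma inv_succ_small (R : realType) (e : R) : 0 < e -> exists n0, forall n, (n0 <= n)%N -> inv_succ R n < e.
Proof.
move=> e0; exists (Num.truncn e^-1) => n nn.
rewrite /inv_succ invf_plt ?posrE ?ltr0n//.
by rewrite (lt_le_trans (truncnS_gt _))// ler_nat ltnS.
Qed.

Lemma inv_succ_cvg (R : realType) : inv_succ R n @[n --> \oo] --> 0^'+.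
Proof.
move=> A /nbhs_ballP[e /= e0 eA]; have [n0 H] := inv_succ_small e0.
exists n0 => // n /= nn; apply: eA; last exact: inv_succ_gt0.
by rewrite -ball_normE /= sub0r normrN gtr0_norm ?inv_succ_gt0// H.
Qed.

Lemma ereal_cvg_le (R : realType) (u : nat -> \bar R) (L a : \bar R) :
  u n @[n --> \oo] --> L -> (forall n0, exists2 n, (n0 <= n)%N & (u n <= a)%E) ->
  (L <= a)%E.
Proof.
move=> uL fr; rewrite leNgt; apply/negP => aL.
have : nbhs L [set z | (a < z)%E].
  by apply: open_nbhs_nbhs; split => //; exact: open_ereal_gt_ereal.
move=> /uL[n0 _ H]; have [n nn un] := fr n0.
by have := H n nn; rewrite /= ltNge un.
Qed.

Section cond_props.
Context {R : realType} {N : nat} {X : set 'rV[R]_N} {X0 : X !=set0}.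
Notation XT := (psubspace X0).
Hypothesis cX : compact X.
Variables (mu : probability (borel XT) R) (k : nat) (phi : XT -> 'rV[R]_k).
Hypothesis cphi : continuous phi.
Notation pball := (@pball R _ (borel XT) k phi).
Notation mratio := (@mass_ratio R _ (borel XT) mu k phi).

Lemma psub_open_approx (U : set XT) : open U ->
  exists (F : nat -> set XT) (f : nat -> XT -> R),
  [/\ forall n, closed (F n), {homo F : n m / (n <= m)%N >-> n `<=` m},
     U = \bigcup_n F n, forall n, continuous (f n) &
     forall n x, [/\ 0 <= f n x, f n x <= 1, F n x -> f n x = 1 & ~ U x -> f n x = 0]].
Proof.
move=> /psub_openP[W oW <-]; have [F [f [cF ndF WF cf H]]] := open_approx oW.
have cs := @set_val_continuous R N X X0.
exists (fun n => (fun x : XT => set_val x : 'rV[R]_N) @^-1` F n).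
exists (fun n => f n \o (fun x : XT => set_val x : 'rV[R]_N)); split.
- by move=> n; apply: closed_comp => // x _; exact: cs.
- by move=> n m nm x; exact: ndF.
- by apply/seteqP; rewrite WF; split => x [n _ h]; exists n.
- by move=> n x; apply: continuous_comp; [exact: cs|exact: cf].
- by move=> n x; exact: H.
Qed.

Lemma psub_open_Fsigma : open_Fsigma XT.
Proof.
by move=> U /psub_open_approx[F [f [cF ndF UF _ _]]]; exists F.
Qed.

Lemma mopen (U : set XT) : open U -> measurable (U : set (borel XT)).
Proof. exact: sub_sigma_algebra. Qed.

Lemma mclosed (U : set XT) : closed U -> measurable (U : set (borel XT)).
Proof.
move=> cU; rewrite -(setCK U); apply: measurableC; apply: mopen.
exact/closed_openC.
Qed.

Section at_point.
Variables (x : XT) (nu : {measure set (borel XT) -> \bar R}).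
Hypothesis nuP : is_cond_measure mu phi (phi x) nu.

(** Half of the portmanteau theorem, tested on continuous functions below the
    indicator of V. *)
Lemma cond_open_le (V : set XT) (a : R) : open V ->
  (forall n0, exists2 n, (n0 <= n)%N & mratio V x (inv_succ R n) <= a) ->
  (nu (V : set (borel XT)) <= a%:E)%E.
Proof.
move=> oV fr; have [F [f [cF ndF VF cf H]]] := psub_open_approx oV.
rewrite VF; apply: measure_bigcup_le => //.
  by move=> n; apply: mclosed; exact: cF.
move=> i; have mFi : measurable (F i : set (borel XT)) by apply: mclosed; exact: cF.
have mf := continuous_borel_measurable (cf i).
apply: (@le_trans _ _ (\int[nu]_y (f i y)%:E)%E).
  rewrite -(setIT (F i)) -integral_indic//; apply: ge0_le_integral => //.
  - by apply/measurable_EFinP; exact: measurable_indic.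
  - exact/measurable_EFinP.
  - move=> y _; rewrite lee_fin indicE; have [f0 f1 fF _] := H i y.
    by case: (boolP (y \in F i)) => //; rewrite inE => /fF ->.
have hc : ((fine (mu (phi @^-1` eball (phi x) (inv_succ R n))))^-1%:E *
    \int[mu]_(y in phi @^-1` eball (phi x) (inv_succ R n)) (f i y)%:E)%E @[n --> \oo] -->
    (\int[nu]_y (f i y)%:E)%E.
  exact: (cvg_comp _ _ (@inv_succ_cvg R) (nuP (cf i))).
apply: (ereal_cvg_le hc) => n0; have [n nn hn] := fr n0; exists n => //=.
rewrite (avg_EFin cX mu cphi _ _ (cf i)) lee_fin; apply: le_trans hn.
rewrite /mass_ratio ler_wpM2r// ?invr_ge0 ?pr_ge0// /Rintegral /pr.
have mB : measurable (pball x (inv_succ R n)) by exact: (mpball cphi).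
have mV : measurable (V : set (borel XT)) by exact: mopen.
apply: fine_le.
- rewrite ge0_fin_numE; last by apply: integral_ge0 => y _; rewrite lee_fin; have [] := H i y.
  apply: (@le_lt_trans _ _ (\int[mu]_(y in pball x (inv_succ R n)) (cst 1%E y))%E).
    apply: ge0_le_integral => //.
    + by move=> y _; rewrite lee_fin; have [] := H i y.
    + by apply/measurable_EFinP; exact: measurable_funS mf.
    + by move=> y _; rewrite lee_fin; have [] := H i y.
  by rewrite integral_cst// mul1e (le_lt_trans (probability_le1 _ _)) ?ltry.
- by rewrite fin_num_measure//; exact: measurableI.
- rewrite -integral_indic//; apply: ge0_le_integral => //.
  + by move=> y _; rewrite lee_fin; have [] := H i y.
  + by apply/measurable_EFinP; exact: measurable_funS mf.
  + by apply/measurable_EFinP; exact: measurable_indic.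
  + move=> y _; rewrite lee_fin indicE; have [f0 f1 _ fV] := H i y.
    by case: (boolP (y \in V)) => //; rewrite notin_setE => /fV ->.
Qed.

(** The set where phi is farther than 1/(i+1) from phi x is open and is disjoint
    from the balls of small radius about phi x. *)
Lemma cond_fiber : nu ([set y | phi y != phi x] : set (borel XT)) = 0%E.
Proof.
pose V (i : nat) : set XT := [set y | i.+1%:R^-1 < `|phi y - phi x|].
have oV i : open (V i).
  apply: (@open_comp _ _ (fun y : XT => `|phi y - phi x|) [set t | i.+1%:R^-1 < t]); last exact: open_gt.
  by move=> y _; exact: (@continuous_dist R XT 'rV[R]_k phi).
have V0 i : (nu (V i : set (borel XT)) <= 0)%E.
  apply: (@cond_open_le (V i) 0) => // n0.
  have [n1 H1] := inv_succ_small (inv_succ_gt0 R i); exists (maxn n0 n1); first exact: leq_maxl.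
  rewrite /mass_ratio (_ : V i `&` _ = set0) ?/pr ?measure0 ?mul0r//.
  rewrite -subset0 => y [/= h1 h2].
  have := H1 _ (leq_maxr n0 n1); rewrite ltNge; apply/negP; rewrite negbK.
  by rewrite ltW// (lt_le_trans h1)// (le_trans (norm_le_enorm _))// ltW.
apply/eqP; rewrite eq_le measure_ge0 andbT.
have -> : [set y | phi y != phi x] = \bigcup_i V i.
  apply/seteqP; split => y /=.
    rewrite -subr_eq0 -normr_gt0 => h; exists (Num.truncn (`|phi y - phi x|)^-1) => //; rewrite /V /=.
    by rewrite invf_plt ?posrE ?ltr0n// truncnS_gt.
  move=> [i _ h]; rewrite -subr_eq0 -normr_gt0; apply: lt_trans h.
  by rewrite invr_gt0 ltr0n.
apply: measure_bigcup_le => //.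
- by move=> n; apply: mopen; exact: oV.
- move=> n m nm y /=; apply: le_lt_trans.
  by rewrite lef_pV2 ?posrE ?ltr0n// ler_nat.
Qed.

Lemma cond_mass1 : (forall r, 0 < r -> 0 < pr mu (pball x r)) -> nu setT = 1%E.
Proof.
move=> pos; have c1 : continuous (cst 1 : XT -> R) by exact: cst_continuous.
have -> : nu setT = (\int[nu]_y (cst 1 y : R)%:E)%E.
  by rewrite -(mul1e (nu setT)) -(integral_cst nu (@measurableT _ (borel XT)) 1%E).
have hc := nuP c1.
apply: (cvg_unique _ hc) => //.
apply: (@cvg_near_cst _ _ _ _ _ _) .
near=> r; rewrite (avg_EFin cX mu cphi _ _ c1) Rintegral_cst; last exact: (mpball cphi).
by rewrite mul1r divff// gt_eqF// pos.
Unshelve. all: by end_near. Qed.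

End at_point.

(** For an open W containing H and close to H in measure, W `&` U is open and its
    relative mass exceeds that of H `&` U by the relative mass of W minus H, which
    is small by [maximal_vanishing].  The point of the statement is that H is only
    Borel. *)
Lemma cond_upper (H : set (borel XT)) : measurable H ->
  {ae mu, forall x, forall nu, is_cond_measure mu phi (phi x) nu ->
    forall (U : set XT) (a : R), open U ->
    (forall n0, exists2 n, (n0 <= n)%N & mratio (H `&` U) x (inv_succ R n) <= a) ->
    (nu (H `&` U) <= a%:E)%E}.
Proof.
move=> mH.
have e0 (j : nat) : 0 < j.+1%:R^-1 :> R by rewrite invr_gt0 ltr0n.
have /choice[W WP] : forall j : nat, exists W : set XT,
    [/\ open W, H `<=` W & (mu (W `\` H) <= j.+1%:R^-1%:E)%E].
  move=> j; have := @borel_outer_regular R _ (borel XT) XT mu (fun y => y) _ psub_open_Fsigma H _ mH (e0 j).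
  by apply; exact: measurable_id.
have mW j : measurable (W j : set (borel XT)) by apply: mopen; have [] := WP j.
have mS j : measurable (W j `\` H : set (borel XT)) by exact: measurableD.
have S0 (e : R) : 0 < e -> exists j, (mu (W j `\` H) <= e%:E)%E.
  move=> e_gt0; exists (Num.truncn e^-1).
  have [_ _ /le_trans] := WP (Num.truncn e^-1); apply.
  by rewrite lee_fin ltW// invf_plt ?posrE ?ltr0n// truncnS_gt.
have := maximal_vanishing (phi_coord_measurable cphi) (phi_bounded cX cphi) mS S0.
apply: ae_mp => x Hx nu nuP U a oU fr.
apply/lee_addgt0Pr => e egt0; rewrite -EFinD.
have [j Hj] := Hx e egt0.
have [oW HW _] := WP j.
apply: (@le_trans _ _ (nu (W j `&` U))).
  apply: le_measure; rewrite ?inE.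
  - by apply: measurableI => //; exact: mopen.
  - by apply: measurableI => //; exact: mopen.
  - exact: setSI.
apply: (cond_open_le nuP); first exact: openI.
move=> n0; have [n nn hn] := fr n0; exists n => //.
have [] := Hj _ (inv_succ_gt0 R n); set B := pball x (inv_succ R n).
have mB : measurable B by exact: (mpball cphi).
move=> B0 SB; have prB : 0 < pr mu B by exact: pr_gt0.
move: SB; rewrite !prE//; last by exact: measurableI.
rewrite -EFinM lee_fin => SB.
move: hn; rewrite /mass_ratio -/B !ler_pdivrMr// => hn.
have mU := mopen oU.
rewrite mulrDl; apply: (@le_trans _ _ (pr mu ((H `&` U) `&` B) + pr mu ((W j `\` H) `&` B))).
  have m1 : measurable ((H `&` U) `&` B) by apply: measurableI => //; exact: measurableI.
  have m2 : measurable (((W j `\` H) : set (borel XT)) `&` B) by exact: measurableI.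
  apply: le_trans (prU_le _ m1 m2); apply: pr_le.
  - by apply: measurableI => //; exact: measurableI.
  - exact: measurableU.
  - move=> y [[Wy Uy] By]; have [Hy|nHy] := pselect (H y); [by left|by right].
by rewrite lerD.
Qed.

Lemma cond_null (Z : set (borel XT)) : measurable Z -> mu Z = 0%E ->
  {ae mu, forall x, forall nu, is_cond_measure mu phi (phi x) nu -> nu Z = 0%E}.
Proof.
move=> mZ Z0; apply: ae_mp (cond_upper mZ) => x H nu /H h.
apply/eqP; rewrite eq_le measure_ge0 andbT.
have := h setT 0 openT; rewrite setIT; apply => n0; exists n0 => //.
rewrite /mass_ratio (_ : pr mu _ = 0) ?mul0r//.
apply/eqP; rewrite eq_le pr_ge0 andbT -lee_fin -prE; last by apply: measurableI => //; exact: (mpball cphi).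
apply: (@le_trans _ _ (mu Z)); last by rewrite Z0.
have mZB r : measurable (Z `&` pball x r) by apply: measurableI => //; exact: (mpball cphi).
by apply: le_measure; rewrite ?inE.
Qed.

(** The complement of A has limiting relative mass below 1 at almost every point
    of A, by [ratio_cvg], and [cond_upper] applies to it. *)
Lemma cond_positive (A : set (borel XT)) : measurable A ->
  {ae mu, forall x, A x -> forall nu, is_cond_measure mu phi (phi x) nu ->
    (0 < nu A)%E}.
Proof.
move=> mA; have mC := measurableC mA.
have h1 := cond_upper mC.
have h2 := ratio_cvg mu (phi_measurable cphi) (phi_coord_measurable cphi) (phi_bounded cX cphi) mA.
have h3 := pball_positive mu (phi_coord_measurable cphi) (phi_bounded cX cphi).
apply: ae_mp (ae_and (ae_and h1 h2) h3) => x [[H [l lP lA]] pos] Ax nu nuP.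
have l0 := lA Ax; have l2 : 0 < l / 2 by rewrite divr_gt0.
have [r0 r00 Hr] := lP _ l2.
have nuT := cond_mass1 nuP pos.
have hC : (nu (~` A) <= (1 - l / 2)%:E)%E.
  have := H nu nuP setT (1 - l / 2) openT; rewrite setIT; apply => n0.
  have [n1 H1] := inv_succ_small r00; exists (maxn n0 n1); first exact: leq_maxl.
  have := Hr _ (inv_succ_gt0 R _) (H1 _ (leq_maxr n0 n1)).
  have p0 := pos _ (inv_succ_gt0 R (maxn n0 n1)).
  rewrite ler_norml => /andP[+ _]; rewrite /mass_ratio.
  set B := pball x _; have mB : measurable B by exact: (mpball cphi).
  have -> : pr mu (~` A `&` B) = pr mu B - pr mu (A `&` B).
    have := prDI mu mB mA; rewrite (setIC B A) setDE (setIC B (~` A)) => ->.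
    by rewrite addrAC subrr add0r.
  by rewrite mulrBl divff ?gt_eqF//; lra.
rewrite lt_neqAle measure_ge0 andbT; apply/eqP => nu0.
have : (nu setT <= nu A + nu (~` A))%E.
  by rewrite -(setUv A) measureU2.
rewrite nuT -nu0 add0e => /le_trans/(_ hC); rewrite lee_fin; lra.
Qed.

End cond_props.

(** * Sets of vanishing Hausdorff measure *)

Section dimension.
Context {R : realType} {N : nat}.
Implicit Types (E U : set 'rV[R]_N) (s t : R).

Lemma diam_pow_ge0 s U : (0 <= diam_pow s U)%E.
Proof. by rewrite /diam_pow; case: pselect => /= ?; [exact: lexx|exact: poweR_ge0]. Qed.

Lemma diam_pow_set0 s : diam_pow s (set0 : set 'rV[R]_N) = 0%E.
Proof. by rewrite /diam_pow; case: pselect. Qed.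

Lemma ediam_set0 : ediam (set0 : set 'rV[R]_N) = -oo%E.
Proof.
rewrite /ediam (_ : [set _ | _ in _] = set0) ?ereal_sup0//.
by rewrite -subset0 => x [p [[]]].
Qed.

Lemma ediam_ge0 U : U !=set0 -> (0 <= ediam U)%E.
Proof.
move=> [u Uu]; apply: ereal_sup_ubound; exists (u, u) => //=.
rewrite subrr; congr (_%:E); rewrite /enorm big1 ?sqrtr0// => i _.
by rewrite mxE expr0n.
Qed.

Lemma ediam_ub U u v : U u -> U v -> ((enorm (u - v))%:E <= ediam U)%E.
Proof. by move=> Uu Uv; apply: ereal_sup_ubound; exists (u, v). Qed.

Lemma ediam_fin U d : U !=set0 -> (ediam U <= d%:E)%E ->
  ediam U = (fine (ediam U))%:E.
Proof.
move=> /ediam_ge0 h0 hd; rewrite fineK// ge0_fin_numE//.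
by rewrite (le_lt_trans hd) ?ltry.
Qed.

Lemma diam_powE s U : U !=set0 -> diam_pow s U = poweR (ediam U) s.
Proof. by move=> /set0P/eqP U0; rewrite /diam_pow; case: pselect. Qed.

Lemma diam_pow_le s U d : 0 <= s -> 0 <= d -> (ediam U <= d%:E)%E ->
  (diam_pow s U <= (d `^ s)%:E)%E.
Proof.
move=> s0 d0 Ud; have [->|/set0P U0] := eqVneq U set0.
  by rewrite diam_pow_set0 lee_fin powR_ge0.
have dU := ediam_ge0 U0; rewrite diam_powE// (ediam_fin U0 Ud) poweR_EFin lee_fin.
apply: ge0_ler_powR => //; rewrite ?nnegrE ?fine_ge0//.
by rewrite -lee_fin -(ediam_fin U0 Ud).
Qed.

(** A cover witnessing that the s-dimensional premeasure of E at scale delta is at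
    most eps. *)
Definition small_cover s (delta eps : R) E := exists F : nat -> set 'rV[R]_N,
  [/\ forall i, (ediam (F i) <= delta%:E)%E, E `<=` \bigcup_i F i &
     (\sum_(0 <= i <oo) diam_pow s (F i) <= eps%:E)%E].

(** Equivalent to the vanishing of the s-dimensional Hausdorff measure by
    [HnullP], and free of infima. *)
Definition Hnull s E := forall delta eps : R, 0 < delta -> 0 < eps -> small_cover s delta eps E.

Lemma HnullP s E : hausdorff_measure s E = 0%E <-> Hnull s E.
Proof.
have pre0 d : (0 <= hausdorff_pre s d E)%E.
  apply: le_ereal_inf_tmp => _ [F _ <-]; apply: nneseries_ge0 => i _ _.
  exact: diam_pow_ge0.
split.
  move=> H0 d e d0 e0.
  have : (hausdorff_pre s d E <= 0)%E.
    by rewrite -H0; apply: ereal_sup_ubound; exists d.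
  have e0' : (0 < e%:E)%E by rewrite lte_fin.
  move=> /le_lt_trans/(_ e0')/ereal_inf_lt[_ [F [Fd EF] <-] h].
  by exists F; split => //; exact: ltW.
move=> HE; apply/eqP; rewrite eq_le; apply/andP; split.
  apply: ge_ereal_sup => _ [d /= d0 <-].
  apply/lee_addgt0Pr => e e0; rewrite add0e.
  have [F [Fd EF h]] := HE d e d0 e0.
  by apply: le_trans h; apply: ereal_inf_lbound; exists F.
apply: le_trans (pre0 1) _; apply: ereal_sup_ubound; exists 1 => //=.
Qed.

Lemma HnullS s E E' : E' `<=` E -> Hnull s E -> Hnull s E'.
Proof.
move=> EE h d e d0 e0; have [F [Fd EF Fe]] := h d e d0 e0.
by exists F; split => //; exact: subset_trans EF.
Qed.

(** Sets of diameter at most 1 have a smaller t-th power of the diameter. *)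
Lemma Hnull_mono s t E : 0 <= s -> s <= t -> Hnull s E -> Hnull t E.
Proof.
move=> s0 st h d e d0 e0.
have d1 : 0 < Num.min d 1 by rewrite lt_min d0 ltr01.
have [F [Fd EF Fe]] := h _ e d1 e0; exists F; split => //.
  by move=> i; apply: (le_trans (Fd i)); rewrite lee_fin ge_min lexx.
apply: le_trans Fe; apply: lee_nneseries => [i _ _|i _]; first exact: diam_pow_ge0.
have [->|/set0P U0] := eqVneq (F i) set0; first by rewrite !diam_pow_set0.
rewrite !diam_powE// (ediam_fin U0 (Fd i)) !poweR_EFin lee_fin.
have D0 : 0 <= fine (ediam (F i)) by rewrite fine_ge0// ediam_ge0.
have D1 : fine (ediam (F i)) <= 1.
  rewrite -lee_fin -(ediam_fin U0 (Fd i)) (le_trans (Fd i))// lee_fin.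
  by rewrite ge_min lexx orbT.
move: D0; rewrite le_eqVlt => /predU1P[<-|D0]; last first.
  by apply: ger_powR => //; rewrite D0.
have [t0|t0] := eqVneq t 0; last by rewrite powR0// powR_ge0.
by have -> : s = t by apply/eqP; rewrite eq_le st t0 s0.
Qed.

Lemma small_cover_bigcup s delta (eps : nat -> R) (e : R) (E : nat -> set 'rV[R]_N) :
  (forall n, small_cover s delta (eps n) (E n)) ->
  (\sum_(0 <= n <oo) (eps n)%:E <= e%:E)%E -> small_cover s delta e (\bigcup_n E n).
Proof.
move=> /choice[F FP] he.
have /ppcard_eqP[f] : ([set: nat] #= [set: nat * nat])%card.
  by rewrite card_eq_sym; exact: card_nat2.
pose g (p : nat * nat) := diam_pow s (F p.1 p.2).
exists (fun j => F (f j).1 (f j).2); split.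
- by move=> i; have [h _ _] := FP (f i).1.
- move=> x [n _ Ex]; have [_ EF _] := FP n; have [i _ Fi] := EF x Ex.
  have [j _ fj] : (f @` [set: nat]) (n, i) by apply: 'surj_f.
  by exists j => //; rewrite fj.
- apply: le_trans he; rewrite (@nneseries_esumT _ (fun j => g (f j))); last first.
    by move=> j; exact: diam_pow_ge0.
  rewrite -(reindex_esum [set: nat] [set: nat * nat] f g)//.
  rewrite (_ : [set: nat * nat] = [set: nat] `*`` (fun=> [set: nat])); last first.
    by apply/seteqP; split.
  rewrite -(@esum_esum _ _ _ setT (fun=> setT) (fun n i => diam_pow s (F n i))); last first.
    by move=> *; exact: diam_pow_ge0.
  rewrite -nneseries_esumT; last by move=> n; apply: esum_ge0 => *; exact: diam_pow_ge0.
  apply: lee_nneseries => [n _ _|n _]; first by apply: esum_ge0 => *; exact: diam_pow_ge0.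
  rewrite -nneseries_esumT; last by move=> *; exact: diam_pow_ge0.
  by have [_ _ h] := FP n.
Qed.

Lemma Hnull_bigcup s (E : nat -> set 'rV[R]_N) : (forall n, Hnull s (E n)) ->
  Hnull s (\bigcup_n E n).
Proof.
move=> h d e d0 e0.
apply: (@small_cover_bigcup s d (fun n => e / (2 ^ n.+1)%:R)).
  by move=> n; apply: h => //; rewrite divr_gt0// ltr0n expn_gt0.
by apply: epsilon_trick0; exact: ltW.
Qed.

Lemma Hnull_setU s E E' : Hnull s E -> Hnull s E' -> Hnull s (E `|` E').
Proof.
move=> h h'; rewrite -bigcup2E; apply: Hnull_bigcup => -[//|[//|n]] /=.
by apply: HnullS h.
Qed.

Lemma small_cover_seq s delta d (l : seq (set 'rV[R]_N)) : 0 <= s -> 0 <= d -> d <= delta ->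
  (forall U, U \in l -> (ediam U <= d%:E)%E) ->
  small_cover s delta ((size l)%:R * d `^ s) (\bigcup_(i in `I_(size l)) nth set0 l i).
Proof.
move=> s0 d0 dd lU; exists (fun i => nth set0 l i).
have nd i : (ediam (nth set0 l i) <= d%:E)%E.
  have [il|il] := ltnP i (size l); first by apply: lU; exact: mem_nth.
  by rewrite nth_default// ediam_set0 leNye.
split.
- by move=> i; apply: (le_trans (nd i)); rewrite lee_fin.
- by move=> x [i _ h]; exists i.
- rewrite (@nneseries_split _ _ 0 (size l)); last by move=> *; exact: diam_pow_ge0.
  rewrite [X in (_ + X)%E]eseries0 ?adde0; last first.
    move=> i; rewrite add0n => il _; rewrite nth_default//; exact: diam_pow_set0.
  rewrite add0n; apply: (@le_trans _ _ (\sum_(0 <= i < size l) (d `^ s)%:E)%E).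
    by apply: lee_sum => i _; apply: diam_pow_le.
  by rewrite sumEFin big_const_nat subn0 iter_addr_0 mulr_natl.
Qed.

Lemma dimH_lt E t : (dimH E < t%:E)%E -> exists s, [/\ 0 <= s, s < t & Hnull s E].
Proof.
move=> /ereal_inf_lt[_ [s [s0 /HnullP hs] <-]]; rewrite lte_fin => st.
by exists s.
Qed.

Lemma dimH_le E s : 0 <= s -> Hnull s E -> (dimH E <= s%:E)%E.
Proof.
by move=> s0 hs; apply: ereal_inf_lbound; exists s => //; split=> //; apply/HnullP.
Qed.

Lemma dimH_ge0 E : (0 <= dimH E)%E.
Proof. by apply: le_ereal_inf_tmp => _ [s [s0 _] <-]; rewrite lee_fin. Qed.

Lemma enorm_le_norm (v : 'rV[R]_N) : enorm v <= N.+1%:R * `|v|.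
Proof.
have [e0|e0] := eqVneq (enorm v) 0; first by rewrite e0 mulr_ge0.
have ep : 0 < enorm v by rewrite lt_neqAle eq_sym e0 enorm_ge0.
have [c] := enorm_coord_ge ep (lexx _).
rewrite ler_pdivrMr ?ltr0n// mulrC => /le_trans; apply.
by rewrite ler_wpM2l// [leRHS]mx_normrE; exact: (le_bigmax _ _ (0, c)).
Qed.

Lemma ediam_ball (u : 'rV[R]_N) r U : 0 <= r ->
  U `<=` [set v | `|v - u| <= r] -> (ediam U <= (N.+1%:R * (2 * r))%:E)%E.
Proof.
move=> r0 Ur; apply: ge_ereal_sup => _ [[v w] [/= /Ur vr /Ur wr] <-].
rewrite lee_fin (le_trans (enorm_le_norm _))// ler_wpM2l//.
rewrite (_ : v - w = (v - u) - (w - u)); last by rewrite opprB subrKA.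
by rewrite (le_trans (ler_normB _ _))// mulr_natl mulr2n lerD.
Qed.

End dimension.

(** * Frostman bounds *)

Lemma geo_sum_le (R : realType) (th : R) n : 0 <= th -> th < 1 ->
  \sum_(0 <= i < n) th ^+ i <= (1 - th)^-1.
Proof.
move=> t0 t1; have p1 : 0 < 1 - th by rewrite subr_gt0.
rewrite -[leRHS]mul1r ler_pdivlMr// big_mkord mulrC.
have -> : (1 - th) * (\sum_(i < n) th ^+ i) = 1 - th ^+ n.
  by rewrite -[1 in RHS](expr1n _ n) subrXX; congr (_ * _);
    apply: eq_bigr => i _; rewrite expr1n mul1r.
by rewrite gerBl exprn_ge0.
Qed.

Lemma nneseries_le_cst (R : realType) (a : nat -> R) (c : R) : (forall n, 0 <= a n) ->
  (forall k, \sum_(0 <= i < k) a i <= c) -> (\sum_(0 <= i <oo) (a i)%:E <= c%:E)%E.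
Proof.
move=> a0 h; apply: lime_le.
  by apply: is_cvg_nneseries => n _ _; rewrite lee_fin.
by apply: nearW => k; rewrite sumEFin lee_fin.
Qed.

Lemma geo_series_le (R : realType) (K th : R) : 0 <= K -> 0 <= th -> th < 1 ->
  (\sum_(0 <= i <oo) (K * th ^+ i)%:E <= (K / (1 - th))%:E)%E.
Proof.
move=> K0 t0 t1; apply: nneseries_le_cst => [n|k]; first by rewrite mulr_ge0 ?exprn_ge0.
by rewrite -mulr_sumr ler_wpM2l// geo_sum_le.
Qed.

Lemma expr_small (R : realType) (th e : R) : 0 <= th -> th < 1 -> 0 < e ->
  exists n0, forall n, (n0 <= n)%N -> th ^+ n <= e.
Proof.
move=> t0 t1 e0.
have h : th ^+ n @[n --> \oo] --> 0 by apply: cvg_expr; rewrite ger0_norm.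
have /cvgrPdist_le/(_ e e0)[n0 _ H] := h.
exists n0 => n nn; have := H n nn; rewrite /= sub0r normrN.
by apply: le_trans; exact: ler_norm.
Qed.

Section frostman.
Context {R : realType} {N : nat} d {Y : measurableType d} (mu : probability Y R).
Variable pi : Y -> borel 'rV[R]_N.
Hypothesis mpi : measurable_fun setT pi.
Implicit Types (E : set (borel 'rV[R]_N)) (A : set Y).

Definition near_pi (u : 'rV[R]_N) (r : R) : set Y :=
  [set y | `|u - (pi y : 'rV[R]_N)| < r].

Lemma pi_pre E : measurable E -> measurable (pi @^-1` E).
Proof. by move=> mE; rewrite -[X in measurable X]setTI; exact: mpi. Qed.

Lemma measurable_near_pi u r : measurable (near_pi u r).
Proof.
rewrite (_ : near_pi u r = pi @^-1` (ball u r)); last first.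
  by apply/seteqP; split => y; rewrite /= -ball_normE.
by apply: pi_pre; apply: sub_sigma_algebra; exact: ball_open.
Qed.

Lemma norm_lt_coord (v : 'rV[R]_N) r : 0 < r -> `|v| < r <-> forall c, `|v 0 c| < r.
Proof.
move=> r0; split => [h c|h].
  by apply: le_lt_trans h; rewrite [leRHS]mx_normrE; exact: (le_bigmax _ _ (0, c)).
rewrite [ltLHS]mx_normrE; apply: bigmax_lt => // -[a c] _ /=.
by rewrite (ord1 a).
Qed.

Lemma measurable_near_pi2 r (A : set Y) : measurable A ->
  measurable [set p : borel 'rV[R]_N * Y | A p.2 /\ near_pi p.1 r p.2].
Proof.
move=> mA; rewrite (_ : [set p | _] = (snd @^-1` A) `&`
    [set p : borel 'rV[R]_N * Y | near_pi p.1 r p.2]); last by [].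
apply: measurableI; first by rewrite -[X in measurable X]setTI; apply: measurable_snd.
have [r0|r0] := ltP 0 r; last first.
  rewrite (_ : [set p | _] = set0)//; rewrite -subset0 => p /= h.
  by have := lt_le_trans h r0; rewrite ltNge normr_ge0.
rewrite (_ : [set p | _] = \bigcap_(c in [set: 'I_N])
   [set p : borel 'rV[R]_N * Y | `|(p.1 : 'rV[R]_N) 0 c - (pi p.2 : 'rV[R]_N) 0 c| < r]); last first.
  apply/seteqP; split => p /=.
    by move=> /(norm_lt_coord _ r0) h c _; have := h c; rewrite /= !mxE.
  by move=> h; apply/(norm_lt_coord _ r0) => c; rewrite !mxE; exact: h.
apply: fin_bigcap_measurable => [|c _]; first exact: finite_finset.
pose f (p : borel 'rV[R]_N * Y) := `|(p.1 : 'rV[R]_N) 0 c - (pi p.2 : 'rV[R]_N) 0 c|.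
have cc : measurable_fun setT (fun u : borel 'rV[R]_N => (u : 'rV[R]_N) 0 c).
  by apply: continuous_borel_measurable; exact: (@coord_continuous R 1 N 0 c).
have mf : measurable_fun setT f.
  apply: measurableT_comp => //; apply: measurable_funB.
    exact: (measurableT_comp cc measurable_fst).
  exact: (measurableT_comp cc (measurableT_comp mpi measurable_snd)).
rewrite (_ : [set p | _] = (fun p => f p < cst r p) @^-1` [set true]) //.
by rewrite -[X in measurable X]setTI; apply: measurable_fun_ltr.
Qed.

Lemma measurable_mu_near r (A : set Y) : measurable A ->
  measurable_fun setT (fun u : borel 'rV[R]_N => mu (A `&` near_pi u r)).
Proof.
move=> mA; rewrite (_ : (fun u => _) = mu \o xsection
    [set p : borel 'rV[R]_N * Y | A p.2 /\ near_pi p.1 r p.2]).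
  by apply: measurable_fun_xsection; exact: measurable_near_pi2.
apply/funext => u /=; congr (mu _).
by apply/seteqP; split => y; rewrite /xsection /= inE.
Qed.

Definition rho (n : nat) : R := 2^-1 ^+ n.

Lemma rho_gt0 n : 0 < rho n. Proof. by rewrite exprn_gt0. Qed.

Lemma rho_powR n s : rho n `^ s = (2^-1 `^ s) ^+ n.
Proof.
by rewrite /rho -powR_mulrn// -!powRrM mulrC powRrM powR_mulrn// powR_ge0.
Qed.

(** Disjoint balls of mass more than c are at most 1/c in number; doubling the
    radii of a maximal family covers the centres. *)
Lemma heavy_cover (A : set Y) r c : measurable A -> 0 < c ->
  exists l : seq 'rV[R]_N, (size l)%:R * c <= 1 /\
    forall u, (c < pr mu (A `&` near_pi u r)) -> exists2 v, v \in l & `|u - v| <= 2 * r.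
Proof.
move=> mA c0; pose Z := [set u : 'rV[R]_N | c < pr mu (A `&` near_pi u r)].
pose sep (u v : 'rV[R]_N) := 2 * r < `|u - v|.
have mB u : measurable (A `&` near_pi u r).
  by apply: measurableI => //; exact: measurable_near_pi.
have bound (t : seq 'rV[R]_N) : (forall u, u \in t -> Z u) -> pairwise sep t ->
    (size t)%:R * c <= pr mu (\big[setU/set0]_(u <- t) (A `&` near_pi u r)).
  elim: t => [_ _|u t ih tZ /= /andP[/allP us pt]]; first by rewrite mul0r pr_ge0.
  have mU : measurable (\big[setU/set0]_(v <- t) (A `&` near_pi v r)).
    by apply: bigsetU_measurable.
  rewrite big_cons (@prDI _ _ _ mu _ (A `&` near_pi u r))//; last exact: measurableU.
  have -> : (A `&` near_pi u r `|` \big[setU/set0]_(j <- t) (A `&` near_pi j r)) `&`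
      (A `&` near_pi u r) = A `&` near_pi u r by rewrite setUK.
  have -> : (A `&` near_pi u r `|` \big[setU/set0]_(j <- t) (A `&` near_pi j r)) `\`
      (A `&` near_pi u r) = \big[setU/set0]_(j <- t) (A `&` near_pi j r).
    rewrite setDUl setDv set0U; apply: setDidl.
    rewrite -subset0 => y []; rewrite -bigcup_seq => -[v vt [_ vy]] [_ uy].
    have := us v vt; rewrite /sep ltNge; apply/negP; rewrite negbK.
    rewrite (_ : u - v = (u - pi y) - (v - pi y)); last by rewrite opprB subrKA.
    by rewrite (le_trans (ler_normB _ _))// mulr_natl mulr2n lerD// ltW.
  rewrite /= -natr1 mulrDl mul1r addrC lerD//.
    by apply: ltW; apply: tZ; rewrite inE eqxx.
  by apply: ih => // v vt; apply: tZ; rewrite inE vt orbT.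
have bound1 t : (forall u, u \in t -> Z u) -> pairwise sep t -> (size t)%:R * c <= 1.
  move=> tZ tp; apply: (le_trans (bound t tZ tp)); apply: pr_le1.
  exact: bigsetU_measurable.
have [|l [lZ lp lc]] := @maximal_separated _ Z sep (Num.truncn c^-1).
  move=> t tZ tp; rewrite truncn_ge_nat ?invr_ge0 ?(ltW c0)//.
  by rewrite -[leRHS]mul1r ler_pdivlMr// bound1.
exists l; split; first exact: bound1.
by move=> u /lc[v vl]; rewrite /sep -leNgt => h; exists v.
Qed.

Section frostman_points.
Variables (A0 : set (borel 'rV[R]_N)) (s s' : R).
Hypothesis mA0 : measurable A0.
Hypothesis s'0 : 0 < s'.
Hypothesis ss' : s' < s.
Hypothesis HA : forall E, measurable E -> Hnull s E -> mu (pi @^-1` (E `&` A0)) = 0%E.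

Let A := pi @^-1` A0.
Let sig : R := 2^-1 `^ s'.
Let sig0 : 0 < sig. Proof. by rewrite powR_gt0// invr_gt0. Qed.
Let mA : measurable A. Proof. exact: pi_pre. Qed.
Let Lam n : set (borel 'rV[R]_N) := [set u | sig ^+ n < pr mu (A `&` near_pi u (rho n))].

Let mLam n : measurable (Lam n).
Proof.
rewrite (_ : Lam n = setT `&` [set u | (cst (sig ^+ n)%:E u < mu (A `&` near_pi u (rho n)))%E]).
  by apply: measurable_lte => //; exact: measurable_mu_near.
rewrite setTI; apply/seteqP; split => u /=; rewrite prE ?lte_fin//;
  by apply: measurableI => //; exact: measurable_near_pi.
Qed.

Let theta := 2^-1 `^ s / sig.
Let theta0 : 0 <= theta. Proof. by rewrite divr_ge0 ?powR_ge0. Qed.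
Let theta1 : theta < 1.
Proof.
have l2 : ln (2^-1 : R) < 0 by rewrite lnV ?posrE// oppr_lt0 ln_gt0// ltr1n.
rewrite /theta ltr_pdivrMr// mul1r /sig /powR.
have -> : (2^-1 : R) == 0 = false by rewrite invr_eq0 pnatr_eq0.
by rewrite ltr_expR ltr_nM2r.
Qed.

Let K : R := (N.+1%:R * (2 * 2)) `^ s.

Let cov_Lam n delta : N.+1%:R * (2 * (2 * rho n)) <= delta ->
  small_cover s delta (K * theta ^+ n) (Lam n).
Proof.
move=> hd; have cn : 0 < sig ^+ n by rewrite exprn_gt0.
have s0 : 0 <= s by rewrite ltW// (lt_trans s'0).
have [l [sl lc]] := heavy_cover (rho n) mA cn.
pose L := [seq [set v : 'rV[R]_N | `|v - u| <= 2 * rho n] | u <- l].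
have r0 : 0 <= 2 * rho n by rewrite mulr_ge0// ltW// rho_gt0.
have D0 : 0 <= N.+1%:R * (2 * (2 * rho n)) by rewrite mulr_ge0// mulr_ge0.
have LD U : U \in L -> (ediam U <= (N.+1%:R * (2 * (2 * rho n)))%:E)%E.
  by move=> /mapP[u ul ->]; apply: (@ediam_ball _ _ u).
have [F [Fd LF Fe]] := small_cover_seq s0 D0 hd LD.
exists F; split => //.
  apply: subset_trans LF => u /lc[v vl uv].
  exists (index v l); first by rewrite /= size_map index_mem.
  by rewrite (nth_map 0) ?index_mem//= nth_index.
apply: (le_trans Fe); rewrite lee_fin size_map.
rewrite (_ : N.+1%:R * _ = N.+1%:R * (2 * 2) * rho n); last by ring.
rewrite (powRM _ _ (ltW (rho_gt0 n))); last by rewrite !mulr_ge0.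
rewrite rho_powR mulrCA /K ler_wpM2l ?powR_ge0// /theta expr_div_n mulrC ler_wpM2l//.
by rewrite -[leRHS]mul1r ler_pdivlMr.
Qed.

Let LamInf : set (borel 'rV[R]_N) := \bigcap_n0 \bigcup_n Lam (n0 + n)%N.

Let Hnull_LamInf : Hnull s LamInf.
Proof.
move=> delta e d0 e0.
have K0 : 0 <= K by exact: powR_ge0.
have t1 : 0 < 1 - theta by rewrite subr_gt0.
have half1 : (2^-1 : R) < 1 by rewrite invf_lt1// ltr1n.
have half0 : 0 <= (2^-1 : R) by rewrite invr_ge0.
have e'0 : 0 < e * (1 - theta) / (K + 1) by rewrite divr_gt0 ?mulr_gt0// ltr_wpDl.
have [n1 H1] := expr_small theta0 theta1 e'0.
have d'0 : 0 < delta / (N.+1%:R * (2 * 2)) by rewrite divr_gt0// mulr_gt0// ltr0n.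
have [n2 H2] := expr_small half0 half1 d'0.
pose n0 := maxn n1 n2.
suff : small_cover s delta e (\bigcup_n Lam (n0 + n)%N).
  by move=> [F [Fd LF Fe]]; exists F; split => //; apply: subset_trans LF => u; apply.
apply: (@small_cover_bigcup _ _ s delta (fun n => (K * theta ^+ n0) * theta ^+ n)).
  move=> n; rewrite -mulrA -exprD; apply: cov_Lam.
  have := H2 (n0 + n)%N (leq_trans (leq_maxr n1 n2) (leq_addr _ _)).
  by rewrite ler_pdivlMr ?mulr_gt0 ?ltr0n// -/(rho _) => h; lra.
apply: (le_trans (geo_series_le _ theta0 theta1)).
  by rewrite mulr_ge0// exprn_ge0.
rewrite lee_fin ler_pdivrMr//.
apply: (@le_trans _ _ (K * (e * (1 - theta) / (K + 1)))).
  by rewrite ler_wpM2l// H1// leq_maxl.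
rewrite mulrCA -[leRHS]mulr1 ler_wpM2l ?mulr_ge0 ?(ltW e0) ?(ltW t1)//.
by rewrite ler_pdivrMr ?ltr_wpDl// mul1r lerDl.
Qed.

(** The points that lie in a ball of radius 2^-n and mass more than 2^(-n s') for
    infinitely many n form a set of vanishing s-dimensional measure, because at
    most 2^(n s') balls of radius 2^(1-n) cover those of generation n and s' < s. *)
Lemma frostman : {ae mu, forall y, A y -> exists C : nat,
  forall n, pr mu (A `&` near_pi (pi y) (rho n)) <= C%:R * sig ^+ n}.
Proof.
have mLI : measurable LamInf.
  by apply: bigcapT_measurable => n; apply: bigcupT_measurable.
have null := HA mLI Hnull_LamInf.
exists (pi @^-1` (LamInf `&` A0)); split => //.
  by apply: pi_pre; exact: measurableI.
move=> y /= h; apply: contrapT => nL; apply: h => Ay.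
have /existsNP[n0 /not_implyP[_ hn]] : ~ LamInf (pi y) by move=> h; apply: nL; split.
have c1 n : 1 <= (sig ^+ n0)^-1 * sig ^+ n \/ (n0 <= n)%N.
  have [nn|nn] := leqP n0 n; [by right|left].
  rewrite mulrC ler_pdivlMr ?exprn_gt0// mul1r; apply: ler_wiXn2l => //.
  - exact: ltW.
  - have h1 : 0 < (2^-1 : R) <= 1 by rewrite invr_gt0 ltr0n /= invf_le1// ler1n.
    by have := ger_powR h1 (ltW s'0); rewrite powRr0.
  - exact: ltnW.
exists (Num.truncn (sig ^+ n0)^-1).+1 => n.
have mB : measurable (A `&` near_pi (pi y) (rho n)).
  by apply: measurableI => //; exact: measurable_near_pi.
have big : (sig ^+ n0)^-1 * sig ^+ n <= (Num.truncn (sig ^+ n0)^-1).+1%:R * sig ^+ n.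
  by rewrite ler_wpM2r ?exprn_ge0 ?(ltW sig0)// ltW// truncnS_gt.
have [c|nn] := c1 n.
  by apply: le_trans big; apply: le_trans c; exact: pr_le1.
have : ~ Lam n (pi y) by move=> L; apply: hn; exists (n - n0)%N => //; rewrite subnKC.
rewrite /Lam /= => /negP; rewrite -leNgt => /le_trans; apply.
rewrite -[leLHS]mul1r ler_wpM2r ?exprn_ge0 ?(ltW sig0)//.
by rewrite ler1n.
Qed.

End frostman_points.

(** Remove a set of vanishing s-dimensional measure whose mass is the supremum
    over all such sets. *)
Lemma exhaustion s :
  (forall E, measurable E -> Hnull s E -> mu (pi @^-1` (~` E)) <> 0%E) ->
  exists A0 : set (borel 'rV[R]_N), [/\ measurable A0, (0 < mu (pi @^-1` A0))%E &
    forall E, measurable E -> Hnull s E -> mu (pi @^-1` (E `&` A0)) = 0%E].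
Proof.
move=> h; pose S := [set x : R | exists E, [/\ measurable E, Hnull s E & x = pr mu (pi @^-1` E)]].
have S0 : S !=set0.
  exists (pr mu (pi @^-1` set0)), set0; split => // d' e d0 e0.
  exists (fun=> set0); split => //.
  - by move=> i; rewrite ediam_set0 leNye.
  - by rewrite eseries0 ?lee_fin ?ltW// => i _ _; exact: diam_pow_set0.
have ubS : has_ubound S by exists 1 => _ [E [mE _ ->]]; apply: pr_le1; exact: pi_pre.
have supS : has_sup S by split.
have /choice[E EP] : forall n : nat, exists E, [/\ measurable E, Hnull s E &
    sup S - n.+1%:R^-1 < pr mu (pi @^-1` E)].
  move=> n; have n0 : 0 < n.+1%:R^-1 :> R by rewrite invr_gt0 ltr0n.
  by have [_ [E [mE hE ->]] hS] := sup_adherent n0 supS; exists E.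
(* a countable union attains the supremum *)
pose E1 := \bigcup_n E n.
have mE1 : measurable E1 by apply: bigcupT_measurable => n; have [] := EP n.
have hE1 : Hnull s E1 by apply: Hnull_bigcup => n; have [] := EP n.
have supE1 : sup S <= pr mu (pi @^-1` E1).
  apply/ler_addgt0Pr => e e0.
  have [_ _ hn] := EP (Num.truncn e^-1).
  have ne : (Num.truncn e^-1).+1%:R^-1 < e.
    by rewrite invf_plt ?posrE ?ltr0n// truncnS_gt.
  have : pr mu (pi @^-1` E (Num.truncn e^-1)) <= pr mu (pi @^-1` E1).
    apply: pr_le; [by apply: pi_pre; have [] := EP (Num.truncn e^-1)|exact: pi_pre|].
    by move=> y /= Ey; exists (Num.truncn e^-1).
  move=> h1; rewrite -lerBlDr; apply: le_trans h1; apply: ltW.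
  by apply: le_lt_trans hn; rewrite lerD2l lerN2 ltW.
exists (~` E1); split; first exact: measurableC.
  by rewrite lt0e measure_ge0 andbT; apply/eqP; exact: h.
move=> F mF hF; have mFE : measurable (F `|` E1) by exact: measurableU.
have mm : measurable (pi @^-1` (F `&` ~` E1)).
  by apply: pi_pre; apply: measurableI => //; exact: measurableC.
have : pr mu (pi @^-1` (F `|` E1)) <= sup S.
  by apply: ub_le_sup => //; exists (F `|` E1); split => //; exact: Hnull_setU.
rewrite (prDI mu (pi_pre mFE) (pi_pre mE1)).
have -> : pi @^-1` (F `|` E1) `&` pi @^-1` E1 = pi @^-1` E1.
  by rewrite preimage_setU setUC setUK.
have -> : pi @^-1` (F `|` E1) `\` pi @^-1` E1 = pi @^-1` (F `&` ~` E1).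
  by rewrite preimage_setU setDUl setDv setU0.
move=> hh; rewrite prE//; congr (_%:E); apply/eqP; rewrite eq_le pr_ge0 andbT.
by lra.
Qed.

End frostman.
Arguments rho R n : clear implicits.

(** * The mass distribution principle *)

Lemma negligible_small (R : realType) d (Y : measurableType d)
    (nu : {measure set Y -> \bar R}) (S : set Y) :
  (forall e : R, 0 < e -> exists W, [/\ measurable W, S `<=` W & (nu W <= e%:E)%E]) ->
  nu.-negligible S.
Proof.
move=> h; have e0 (j : nat) : 0 < j.+1%:R^-1 :> R by rewrite invr_gt0 ltr0n.
have /choice[W WP] : forall j : nat, exists W, [/\ measurable W, S `<=` W &
  (nu W <= j.+1%:R^-1%:E)%E] by move=> j; exact: h.
exists (\bigcap_j W j); split.
- by apply: bigcapT_measurable => j; have [] := WP j.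
- apply/eqP; rewrite eq_le measure_ge0 andbT; apply/lee_addgt0Pr => e egt0.
  rewrite add0e; have [mW _ hW] := WP (Num.truncn e^-1).
  apply: (@le_trans _ _ (nu (W (Num.truncn e^-1)))).
    apply: le_measure; rewrite ?inE//; last exact: bigcap_inf.
    by apply: bigcapT_measurable => j; have [] := WP j.
  apply: (le_trans hW); rewrite lee_fin ltW// invf_plt ?posrE ?ltr0n//.
  exact: truncnS_gt.
- by move=> y Sy j _; have [_ SW _] := WP j; exact: SW.
Qed.

Section mass_distribution.
Context {R : realType} {N : nat} d {Y : measurableType d}.
Variables (nu : {measure set Y -> \bar R}) (pi : Y -> borel 'rV[R]_N).
Hypothesis mpi : measurable_fun setT pi.

(** A set of diameter D that meets the good points lies in a ball of radius about
    D, hence carries mass at most C D^t up to a constant; covers of E with small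
    sums of D^t then bound the mass. *)
Lemma mass_distribution (H : set Y) (t : R) (E : set 'rV[R]_N) (C : nat) :
  measurable H -> 0 < t -> Hnull t E ->
  nu.-negligible (H `&` pi @^-1` E `&` [set y | forall l,
    (nu (H `&` near_pi pi (pi y) (rho R l)) <= (C%:R * (2^-1 `^ t) ^+ l)%:E)%E]).
Proof.
move=> mH t0 hE; set G := [set y | forall l, _].
pose tau : R := 2^-1 `^ t.
have half1 : (2^-1 : R) < 1 by rewrite invf_lt1// ltr1n.
have half0 : 0 <= (2^-1 : R) by rewrite invr_ge0.
have tau0 : 0 < tau by rewrite powR_gt0// invr_gt0.
have tau1 : tau < 1.
  have l2 : ln (2^-1 : R) < 0 by rewrite lnV ?posrE// oppr_lt0 ln_gt0// ltr1n.
  rewrite /tau /powR; have -> : (2^-1 : R) == 0 = false by rewrite invr_eq0 pnatr_eq0.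
  by rewrite -[ltRHS]expR0 ltr_expR pmulr_rlt0.
apply: negligible_small => e e0.
have Ct : 0 <= C%:R / tau by rewrite divr_ge0// ltW.
have e'0 : 0 < e / (C%:R / tau + 1) by rewrite divr_gt0// ltr_wpDl.
have [F [Fd EF Fe]] := hE 2^-1 _ (ltac:(by rewrite invr_gt0)) e'0.
have step i : exists V : set Y, [/\ measurable V, H `&` pi @^-1` (F i) `&` G `<=` V &
    (nu V <= (C%:R / tau)%:E * diam_pow t (F i))%E].
  have [[y [[Hy Fy] Gy]]|n0] := pselect (H `&` pi @^-1` (F i) `&` G !=set0); last first.
    exists set0; split => //; first by move=> z Sz; apply: n0; exists z.
    by rewrite measure0 mule_ge0// ?lee_fin// diam_pow_ge0.
  have F0 : F i !=set0 by exists (pi y).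
  have FE := ediam_fin F0 (Fd i).
  set dd := fine (ediam (F i)) in FE.
  have dd0 : 0 <= dd by rewrite -lee_fin -FE ediam_ge0.
  have dd2 : dd <= 2^-1 by rewrite -lee_fin -FE.
  (* a ball about a good point of F i replaces F i, which need not be Borel *)
  pose V := H `&` [set z | `|(pi y : 'rV[R]_N) - (pi z : 'rV[R]_N)| <= dd].
  have mV : measurable V.
    apply: measurableI => //.
    rewrite (_ : [set z | _] = ~` (pi @^-1` [set v : 'rV[R]_N | dd < `|v - (pi y : 'rV[R]_N)|])); last first.
      apply/seteqP; split => z /=; rewrite distrC => h; first by apply/negP; rewrite -leNgt.
      by rewrite leNgt; apply/negP.
    apply: measurableC; apply: pi_pre => //; apply: sub_sigma_algebra.
    apply: (@open_comp _ _ (fun v : 'rV[R]_N => `|v - (pi y : 'rV[R]_N)|) [set x | dd < x]); last exact: open_gt.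
    by move=> v _; apply: (@continuous_dist R 'rV[R]_N 'rV[R]_N id) => ?; exact: cvg_id.
  have nuV l : dd < rho R l -> (nu V <= (C%:R * tau ^+ l)%:E)%E.
    move=> ddl; apply: le_trans (Gy l); apply: le_measure; rewrite ?inE//.
      by apply: measurableI => //; exact: measurable_near_pi.
    by move=> z [Hz /= h]; split => //; exact: le_lt_trans ddl.
  exists V; split => //.
    move=> z [[Hz Fz] _]; split => //=.
    rewrite -lee_fin -FE; apply: le_trans (ediam_ub Fy Fz); rewrite lee_fin.
    exact: norm_le_enorm.
  rewrite diam_powE// FE poweR_EFin -EFinM.
  move: dd0; rewrite le_eqVlt => /predU1P[dd0|dd0].
    (* a single point: the bounds at all scales force mass 0 *)
    rewrite -dd0 powR0 ?gt_eqF// mulr0.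
    apply/lee_addgt0Pr => a a0; rewrite add0e.
    have a'0 : 0 < a / (C%:R + 1) by rewrite divr_gt0// ltr_wpDl.
    have [l0 Hl] := expr_small (ltW tau0) tau1 a'0.
    apply: (le_trans (nuV l0 _)); first by rewrite -dd0 rho_gt0.
    rewrite lee_fin; apply: (@le_trans _ _ (C%:R * (a / (C%:R + 1)))).
      by rewrite ler_wpM2l// Hl.
    rewrite mulrCA -[leRHS]mulr1 ler_wpM2l ?(ltW a0)//.
    by rewrite ler_pdivrMr ?ltr_wpDl// mul1r lerDl.
  have ex : exists l, rho R l.+1 <= dd.
    have [l0 Hl] := expr_small half0 half1 dd0.
    by exists l0; apply: Hl.
  pose P l := rho R l.+1 <= dd.
  have exP : exists l, P l by [].
  case: (ex_minnP exP) => l Pl lmin.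
  have ddl : dd < rho R l.
    case: l Pl lmin => [_ _|l _ lmin].
      by rewrite /rho expr0 (le_lt_trans dd2).
    rewrite ltNge; apply/negP => h; have := lmin l h; by rewrite ltnn.
  apply: (le_trans (nuV l ddl)); rewrite lee_fin -mulrA ler_wpM2l//.
  rewrite ler_pdivlMl// -exprS -rho_powR.
  by apply: ge0_ler_powR => //; rewrite ?nnegrE ltW// rho_gt0.
have /choice[V VP] := step.
exists (\bigcup_i V i); split.
- by apply: bigcupT_measurable => i; have [] := VP i.
- move=> y [[Hy Ey] Gy]; have [i _ Fi] := EF _ Ey.
  by exists i => //; have [_ h _] := VP i; apply: h.
- apply: (@le_trans _ _ (\sum_(i <oo) nu (V i))%E).
    apply: measure_sigma_subadditive => //.
      by move=> i; have [] := VP i.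
    by apply: bigcupT_measurable => i; have [] := VP i.
  apply: (@le_trans _ _ (\sum_(i <oo) (C%:R / tau)%:E * diam_pow t (F i))%E).
    by apply: lee_nneseries => // i _; have [] := VP i.
  rewrite nneseriesZl; last by move=> *; exact: diam_pow_ge0.
  apply: (@le_trans _ _ ((C%:R / tau)%:E * (e / (C%:R / tau + 1))%:E)%E).
    by rewrite lee_wpmul2l// lee_fin.
  rewrite -EFinM lee_fin mulrCA -[leRHS]mulr1 ler_wpM2l ?(ltW e0)//.
  by rewrite ler_pdivrMr ?ltr_wpDl// mul1r lerDl.
Qed.

End mass_distribution.

(** A cube of side 2M is covered by about rho^-N balls of radius rho, and
    rho^-N rho^(N+1) tends to 0. *)
Lemma Hnull_bounded (R : realType) (N : nat) (K : set 'rV[R]_N) (M : R) : 0 <= M ->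
  (forall v, K v -> forall c, `|v 0 c| <= M) -> Hnull N.+1%:R K.
Proof.
move=> M0 KM delta e d0 e0.
have half1 : (2^-1 : R) < 1 by rewrite invf_lt1// ltr1n.
have half0 : 0 <= (2^-1 : R) by rewrite invr_ge0.
pose B : R := (2 * M + 1) ^+ N * (N.+1%:R * 2) ^+ N.+1.
have B0 : 0 <= B by rewrite mulr_ge0 ?exprn_ge0 ?addr_ge0 ?mulr_ge0.
have e'0 : 0 < e / (B + 1) by rewrite divr_gt0// ltr_wpDl.
have d'0 : 0 < delta / (N.+1%:R * 2) by rewrite divr_gt0// mulr_gt0// ltr0n.
have [n1 H1] := expr_small half0 half1 e'0.
have [n2 H2] := expr_small half0 half1 d'0.
pose n := maxn n1 n2.
have r0 : 0 < rho R n by exact: rho_gt0.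
have r1 : rho R n <= 1 by rewrite /rho exprn_ile1// ltW.
pose sep (u v : 'rV[R]_N) := [exists c, rho R n <= `|u 0 c - v 0 c|].
pose sz := (2 * M / rho R n + 1) ^+ N.
have szb l : (forall x, x \in l -> K x) -> pairwise sep l -> (size l)%:R <= sz.
  move=> lK lp.
  by apply: (@separated_size_le R 'rV[R]_N N (fun v c => v 0 c)) => // x /lK; exact: KM.
have [|l [lK lp lc]] := @maximal_separated _ K sep (Num.truncn sz).
  move=> l lK lp; have h := szb l lK lp.
  by rewrite truncn_ge_nat// (le_trans _ h).
pose L := [seq [set v : 'rV[R]_N | `|v - u| <= rho R n] | u <- l].
have D0 : 0 <= N.+1%:R * (2 * rho R n) by rewrite mulr_ge0// mulr_ge0// ltW.
have Dd : N.+1%:R * (2 * rho R n) <= delta.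
  have := H2 n (leq_maxr n1 n2); rewrite -/(rho R n) ler_pdivlMr ?mulr_gt0 ?ltr0n//.
  by rewrite mulrA mulrC.
have LD U : U \in L -> (ediam U <= (N.+1%:R * (2 * rho R n))%:E)%E.
  by move=> /mapP[u ul ->]; apply: (@ediam_ball _ _ u) => //; exact: ltW.
have [F [Fd LF Fe]] := small_cover_seq (ler0n R N.+1) D0 Dd LD.
exists F; split => //.
  apply: subset_trans LF => u /lc[v vl].
  rewrite negb_exists => /forallP uv.
  exists (index v l); first by rewrite /= size_map index_mem.
  rewrite (nth_map 0) ?index_mem//= nth_index//.
  rewrite [leLHS]mx_normrE; apply: bigmax_le; first exact: ltW.
  by move=> [a c] _ /=; rewrite (ord1 a) !mxE ltW// ltNge; exact: uv.
apply: (le_trans Fe); rewrite lee_fin size_map powR_mulrn//.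
apply: (@le_trans _ _ (((2 * M + 1) / rho R n) ^+ N * (N.+1%:R * (2 * rho R n)) ^+ N.+1)).
  rewrite ler_wpM2r ?exprn_ge0//; apply: (le_trans (szb l lK lp)).
  rewrite /sz lerXn2r ?nnegrE ?addr_ge0 ?divr_ge0 ?mulr_ge0 ?(ltW r0)//.
    by rewrite addr_ge0 ?mulr_ge0.
  have -> : (2 * M + 1) / rho R n = 2 * M / rho R n + (rho R n)^-1 by field; rewrite gt_eqF.
  by rewrite lerD2l invf_ge1.
have -> : ((2 * M + 1) / rho R n) ^+ N * (N.+1%:R * (2 * rho R n)) ^+ N.+1 = B * rho R n.
  rewrite /B mulrA [(_ * rho R n) ^+ N.+1]exprMn [rho R n ^+ N.+1]exprS expr_div_n.
  by field; rewrite expf_neq0// gt_eqF.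
apply: (@le_trans _ _ (B * (e / (B + 1)))).
  by rewrite ler_wpM2l// H1// leq_maxl.
rewrite mulrCA -[leRHS]mulr1 ler_wpM2l ?(ltW e0)//.
by rewrite ler_pdivrMr ?ltr_wpDl// mul1r lerDl.
Qed.

(** * Joint measurability and translations *)

(** The Borel sets of a product with a nonseparable factor V are not generated by
    rectangles in general.  A countable base of the other factor is enough: over
    each basic set B i one takes the union of all admissible open sets of V. *)
Lemma measurable_rect (V : ptopologicalType) d (Y : measurableType d) (I : countType)
  (B : I -> set Y) (W : set (borel V * Y)) :
  (forall i, measurable (B i)) ->
  (forall p, W p -> exists (U : set V) i, [/\ open U, U p.1, B i p.2 & U `*` B i `<=` W]) ->
  measurable W.
Proof.
move=> mB WP.
pose G i : set V := \bigcup_(U in [set U : set V | open U /\ U `*` B i `<=` W]) U.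
have -> : W = \bigcup_i ((G i : set (borel V)) `*` B i).
  apply/seteqP; split => [p /WP[U [i [oU Up Bp UW]]]|[v y] [i _ [/= [U [_ UW] Uv] By]]].
    by exists i => //; split => //=; exists U.
  exact: UW.
apply: countable_bigcupT_measurable => [|i]; first exact: countableP.
apply: measurableX => //; apply: sub_sigma_algebra.
by apply: bigcup_open => U [].
Qed.

Lemma rat_rV_dense (R : realType) (N : nat) (v : 'rV[R]_N) (e : R) : 0 < e ->
  exists c : 'rV[rat]_N, `|v - map_mx ratr c| < e.
Proof.
move=> e0.
have /choice[c cP] : forall i, exists q : rat, `|v 0 i - ratr q| < e.
  move=> i; have /rat_in_itvoo[q] : v 0 i - e < v 0 i + e by rewrite ltrBlDr -addrA ltrDl addr_gt0.
  rewrite in_itv /= => /andP[h1 h2]; exists q.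
  by rewrite ltr_distlC h1 h2.
exists (\row_i c i); rewrite norm_lt_coord// => i.
by rewrite !mxE; exact: cP.
Qed.

Section measurable_maps.
Context {R : realType}.

Lemma measurable_shift (V : normedModType R) (g : V) :
  measurable_fun setT (fun p : borel V * R => (p.1 : V) + p.2 *: g : borel V).
Proof.
apply: (@measurability _ _ _ (borel V) setT (fun p : borel V * R => (p.1 : V) + p.2 *: g : borel V) (@open V)) => //.
move=> _ [Q oQ <-]; rewrite setTI.
pose B (i : rat * nat) : set R := ball (ratr i.1 : R) (inv_succ R i.2).
apply: (@measurable_rect V _ R _ B) => [i|[v a] /= Ova].
  by apply: measurable_ball.
have [r r0 rO] : exists2 r : R, 0 < r & forall z : V, `|z - (v + a *: g)| < r -> Q z.
  have /nbhs_ballP[r /= r0 rO] := open_nbhs_nbhs (conj oQ Ova).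
  by exists r => // z h; apply: rO; rewrite -ball_normE /= distrC.
have r'0 : 0 < r / 2 by rewrite divr_gt0.
have r''0 : 0 < r / 4 / (`|g| + 1) by rewrite !divr_gt0// ltr_wpDl.
have [n Hn] := inv_succ_small r''0.
have /rat_in_itvoo[q] : a - inv_succ R n < a + inv_succ R n.
  by rewrite ltrBlDr -addrA ltrDl addr_gt0// inv_succ_gt0.
rewrite in_itv /= => /andP[h1 h2].
exists (ball v (r / 2)), (q, n); split => //=; first exact: ball_open.
- exact: ballxx.
- by rewrite /B /= -ball_normE /= ltr_distlC; apply/andP; split; lra.
move=> [w b] [/= vw Bb]; apply: rO.
have ab : `|b - a| < r / 2 / (`|g| + 1).
  have d1 : `|b - ratr q| < r / 4 / (`|g| + 1).
    by move: Bb; rewrite /B /= -ball_normE /= distrC => h; exact: lt_trans (Hn n _).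
  have d2 : `|ratr q - a| < r / 4 / (`|g| + 1).
    apply: (@lt_trans _ _ (inv_succ R n)); last exact: Hn.
    by rewrite ltr_distlC; apply/andP; split; lra.
  have -> : r / 2 / (`|g| + 1) = r / 4 / (`|g| + 1) + r / 4 / (`|g| + 1) by field; rewrite gt_eqF// ltr_wpDl.
  rewrite -(subrKA (ratr q)); exact: (le_lt_trans (ler_normD _ _) (ltrD d1 d2)).
have -> : w + b *: g - (v + a *: g) = (w - v) + (b - a) *: g.
  by rewrite scalerBl opprD addrACA.
have -> : r = r / 2 + r / 2 by field.
apply: (le_lt_trans (ler_normD _ _)); apply: ltr_leD.
  by move: vw; rewrite -ball_normE /= distrC.
rewrite normrZ; apply: (@le_trans _ _ (r / 2 / (`|g| + 1) * (`|g| + 1))).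
  by apply: ler_pM => //; [exact: ltW|rewrite lerDl].
by rewrite divfK// gt_eqF// ltr_wpDl.
Qed.

(** Both measures agree on bounded intervals. *)
Lemma lebesgue_measure_translate (c : R) (A : set R) : measurable A ->
  pushforward lebesgue_measure (fun x : R => x + c : measurableTypeR R) A = lebesgue_measure A.
Proof.
have mc : measurable_fun [set: measurableTypeR R] (fun x : R => x + c : measurableTypeR R).
  by apply: measurable_funD.
move=> mA.
pose m := measure_function_pushforward__canonical__measure_function_Measure lebesgue_measure mc.
apply/esym; apply: (@lebesgue_measure_unique R m) => //= _ [[a b]] _ <-.
rewrite /m /= /pushforward.
rewrite (_ : _ @^-1` _ = `]a - c, b - c]%classic); last first.
  by apply/seteqP; split => x /=; rewrite !in_itv /= ltrBlDr lerBrDr.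
rewrite !lebesgue_measure_itv/= !lte_fin ltrD2r.
by case: ifP => // _; rewrite -!EFinB opprB addrA subrK.
Qed.

Lemma integral_translate (c : R) (f : R -> \bar R) : measurable_fun setT f ->
  (forall x, (0 <= f x)%E) ->
  (\int[@lebesgue_measure R]_x f ((x : R) + c)%R = \int[@lebesgue_measure R]_x f x)%E.
Proof.
move=> mf f0.
have mc : measurable_fun [set: measurableTypeR R] (fun x : R => x + c : measurableTypeR R).
  by apply: measurable_funD.
pose m := measure_function_pushforward__canonical__measure_function_Measure lebesgue_measure mc.
transitivity (\int[m]_x f x)%E.
  by rewrite [RHS](@ge0_integral_pushforward _ _ _ _ _ _ mc).
apply: eq_measure_integral => A mA _; exact: lebesgue_measure_translate.
Qed.

End measurable_maps.

Section eval.
Context {R : realType} {N : nat} {X : set 'rV[R]_N} (X0 : X !=set0) (cX : compact X).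
Notation XT := (psubspace X0).

Lemma lip_sup_le (h : Lip cX) (x : X) : `|h x| <= `|h|.
Proof.
have [M hM] := lip_bounded h.
apply: (@le_trans _ _ (sup [set `|h x| | x in [set: X]])).
  by apply: ub_le_sup; [exists M => _ [y _ <-] | exists x].
by rewrite [leRHS]/(lip_norm h) lerDl; have [] := lip_constP h.
Qed.

Lemma lip_continuous (h : Lip cX) : continuous (h : XT -> R).
Proof.
move=> x; have FF : Filter (nbhs (x : XT)) by exact: nbhs_filter.
apply/cvgrPdist_lt => e e0.
have [L0 hL] := lip_constP h.
have r0 : 0 < e / (N.+1%:R * lip_const h + 1).
  by rewrite divr_gt0// ltr_wpDl// mulr_ge0.
have o : open ((set_val @^-1` ball (set_val x : 'rV[R]_N) (e / (N.+1%:R * lip_const h + 1)) : set X) : set XT).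
  by apply: psub_open; exact: ball_open.
have nx : nbhs x ((set_val @^-1` ball (set_val x : 'rV[R]_N) (e / (N.+1%:R * lip_const h + 1)) : set X) : set XT).
  by apply: open_nbhs_nbhs; split => //; exact: ballxx.
apply: filterS nx.
move=> y; rewrite /= -ball_normE /= => xy.
apply: (le_lt_trans (hL x y)).
apply: (@le_lt_trans _ _ (lip_const h * (N.+1%:R * `|set_val x - set_val y|))).
  by rewrite ler_wpM2l// enorm_le_norm.
rewrite mulrA [_ * N.+1%:R]mulrC.
move: xy; rewrite ltr_pdivlMr ?ltr_wpDl ?mulr_ge0// => xy.
apply: (le_lt_trans _ xy).
by rewrite mulrDr mulr1 [leLHS]mulrC lerDl.
Qed.

Lemma measurable_eval :
  measurable_fun setT (fun p : borel (Lip cX) * borel XT => (p.1 : Lip cX) (p.2 : XT)).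
Proof.
have oP (Q : set R) (p : borel (Lip cX) * borel XT) : open Q -> Q ((p.1 : Lip cX) (p.2 : XT)) ->
   exists2 r : R, 0 < r & forall z, `|z - (p.1 : Lip cX) (p.2 : XT)| < r -> Q z.
  move=> oQ Op; have /nbhs_ballP[r /= r0 rO] := open_nbhs_nbhs (conj oQ Op).
  by exists r => // z h; apply: rO; rewrite -ball_normE /= distrC.
apply: (measurability _ (RGenOInfty.measurableE R)).
move=> _ [_ [a ->] <-]; rewrite setTI.
have oQ : open (`]a, +oo[%classic : set R) by exact: interval_open.
move: (`]a, +oo[%classic) oQ => Q oQ.
pose B (i : 'rV[rat]_N * nat) : set (borel XT) :=
   [set x : XT | `|map_mx ratr i.1 - set_val x : 'rV[R]_N| < inv_succ R i.2].
apply: (@measurable_rect _ _ (borel XT) _ B) => [i|p Op].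
  apply: sub_sigma_algebra.
  have -> : B i = (set_val @^-1` ball (map_mx ratr i.1 : 'rV[R]_N) (inv_succ R i.2) : set X).
    by rewrite /B -ball_normE.
  by apply: psub_open; exact: ball_open.
have [r r0 rO] := oP _ _ oQ Op.
have r'0 : 0 < r / 2 by rewrite divr_gt0.
have [s s0 sO] : exists2 s : R, 0 < s & forall z : XT, `|set_val z - set_val (p.2 : XT) : 'rV[R]_N| < s ->
    `|(p.1 : Lip cX) z - (p.1 : Lip cX) (p.2 : XT)| < r / 2.
  have FF : Filter (nbhs (p.2 : XT)) by exact: nbhs_filter.
  have h : nbhs (p.2 : XT) [set z : XT | `|(p.1 : Lip cX) z - (p.1 : Lip cX) (p.2 : XT)| < r / 2].
    have /cvgrPdist_lt/(_ _ r'0) := @lip_continuous p.1 p.2.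
    by apply: filterS => z; rewrite distrC.
  by have [s s0 sP] := psub_nbhs h; exists s.
have [n Hn] : exists n, inv_succ R n < s / 2.
  have [n Hn] := @inv_succ_small R (s / 2) ltac:(by rewrite divr_gt0).
  by exists n; exact: Hn.
have [c cP] := @rat_rV_dense R N (set_val (p.2 : XT)) _ (inv_succ_gt0 R n).
exists (ball (p.1 : Lip cX) (r / 2)), (c, n); split => //=; first exact: ball_open.
- exact: ballxx.
- by rewrite /B /= distrC.
move=> [w b] [/= vw Bb]; apply: rO => /=.
rewrite -(subrKA ((p.1 : Lip cX) (b : XT))).
apply: (le_lt_trans (ler_normD _ _)).
have -> : r = r / 2 + r / 2 by field.
apply: ltrD.
  have -> : (w : Lip cX) b - (p.1 : Lip cX) (b : XT) = (w - p.1 : Lip cX) b by [].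
  apply: (le_lt_trans (lip_sup_le _ _)).
  by move: vw; rewrite -ball_normE /= distrC.
apply: sO; rewrite -(subrKA (map_mx ratr c)).
apply: (le_lt_trans (ler_normD _ _)); have -> : s = s / 2 + s / 2 by field.
apply: ltrD; first by apply: lt_trans Hn; rewrite distrC.
by apply: lt_trans Hn; rewrite distrC.
Qed.

End eval.

(** * Iterated integrals over finitely many perturbations *)

Section iterated.
Context {R : realType} {V : normedModType R}.
Local Open Scope ereal_scope.
Notation leb := (@lebesgue_measure R).

(** The integral of F over e + a_1 g_1 + ... + a_n g_n with respect to the product
    of the weights w(a_i) da_i, written as an iterated integral to allow
    induction on the list of directions. *)
Fixpoint iterint (S : Type) (g : S -> V) (w : R -> R) (s : seq S) (F : V -> \bar R) (e : V) :
    \bar R :=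
  if s is x :: s' then \int[leb]_a ((w a)%:E * iterint g w s' F (e + a *: g x)%R) else F e.

Section basic.
Variables (S : Type) (g : S -> V) (w : R -> R).
Hypotheses (mw : measurable_fun setT w) (w0 : forall a, (0 <= w a)%R).
Implicit Types (s : seq S).

Lemma iterint_ge0 s F e : (forall v, 0 <= F v) -> 0 <= iterint g w s F e.
Proof.
move=> F0; elim: s e => [|x s ih] e //=.
by apply: integral_ge0 => a _; rewrite mule_ge0 ?lee_fin.
Qed.

Section param.
Context d (Z : measurableType d).

Lemma measurable_step x (G : borel V * Z -> \bar R) : measurable_fun setT G ->
  measurable_fun setT (fun p : (borel V * Z) * R => (w p.2)%:E * G (p.1.1 + p.2 *: g x : V, p.1.2)%R).
Proof.
move=> mG; apply: emeasurable_funM; first by apply/measurable_EFinP; exact: measurableT_comp.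
have k : measurable_fun setT (fun p : (borel V * Z) * R => p.1.2).
  exact: (measurableT_comp measurable_snd measurable_fst).
have h : measurable_fun setT (fun p : (borel V * Z) * R => (p.1.1, p.2)).
  apply/measurable_fun_pairP; split; last exact: measurable_snd.
  exact: (measurableT_comp measurable_fst measurable_fst).
have h' := measurableT_comp (measurable_shift (g x)) h.
apply: (measurableT_comp mG); apply/measurable_fun_pairP; split => //=.
Qed.

Lemma measurable_iterint2 s (F : borel V * Z -> \bar R) : measurable_fun setT F ->
  (forall p, 0 <= F p) ->
  measurable_fun setT (fun p : borel V * Z => iterint g w s (fun e => F (e, p.2)) p.1).
Proof.
move=> mF F0; elim: s => [|x s ih] /=.
  by apply: (eq_measurable_fun F) => // -[].
have := @measurable_fun_fubini_tonelli_F _ _ _ _ R leb _ (measurable_step x ih).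
apply => p; rewrite mule_ge0 ?lee_fin//; exact: iterint_ge0.
Qed.

(** A parameter z can be integrated before or after the perturbations. *)
Lemma iterint_tonelli (m : {sigma_finite_measure set Z -> \bar R}) s (F : borel V * Z -> \bar R) e :
  measurable_fun setT F -> (forall p, 0 <= F p) ->
  iterint g w s (fun e => \int[m]_z F (e, z)) e = \int[m]_z iterint g w s (fun e => F (e, z)) e.
Proof.
move=> mF F0; elim: s e => [|x s ih] e //=.
under eq_integral do rewrite ih.
have mI := measurable_step x (measurable_iterint2 s mF F0).
have mJ : measurable_fun setT (fun p : R * Z =>
    (w p.1)%:E * iterint g w s (fun e => F (e, p.2)) (e + p.1 *: g x)%R).
  have k : measurable_fun setT (fun p : R * Z => (e : borel V, p.2)).
    by apply/measurable_fun_pairP; split; [exact: measurable_cst|exact: measurable_snd].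
  have h : measurable_fun setT (fun p : R * Z => ((e : borel V, p.2), p.1)).
    by apply/measurable_fun_pairP; split; [exact: k|exact: measurable_fst].
  exact: (measurableT_comp mI h).
rewrite -(@fubini_tonelli _ _ _ _ R leb m _ mJ)/=; last first.
  by move=> p; rewrite mule_ge0 ?lee_fin//; exact: iterint_ge0.
apply: eq_integral => a _.
rewrite ge0_integralZl//.
- have h : measurable_fun setT (fun z : Z => ((e + a *: g x)%R : borel V, z)).
    by apply/measurable_fun_pairP; split; [exact: measurable_cst|exact: measurable_id].
  exact: (measurableT_comp (measurable_iterint2 s mF F0) h).
- by move=> z _; exact: iterint_ge0.
- by rewrite lee_fin.
Qed.

End param.

Lemma measurable_iterint s F : measurable_fun setT (F : borel V -> \bar R) -> (forall v, 0 <= F v) ->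
  measurable_fun setT (iterint g w s F : borel V -> \bar R).
Proof.
move=> mF F0.
have mF' : measurable_fun setT (fun p : borel V * R => F p.1).
  exact: measurableT_comp.
have h := measurable_iterint2 s mF' (fun p => F0 p.1).
have k : measurable_fun setT (fun v : borel V => (v, 0%R : R)).
  by apply/measurable_fun_pairP; split; [exact: measurable_id|exact: measurable_cst].
exact: (measurableT_comp h k).
Qed.

Lemma measurable_iterint_step s x F e : measurable_fun setT (F : borel V -> \bar R) ->
  (forall v, 0 <= F v) ->
  measurable_fun setT (fun a : R => iterint g w s F (e + a *: g x)%R).
Proof.
move=> mF F0.
have h := measurable_iterint s mF F0.
have k : measurable_fun setT (fun a : R => (e : borel V, a)).
  by apply/measurable_fun_pairP; split; [exact: measurable_cst|exact: measurable_id].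
exact: (measurableT_comp h (measurableT_comp (measurable_shift (g x)) k)).
Qed.

Lemma measurable_iterint_wstep s x F e : measurable_fun setT (F : borel V -> \bar R) ->
  (forall v, 0 <= F v) ->
  measurable_fun setT (fun a : R => (w a)%:E * iterint g w s F (e + a *: g x)%R).
Proof. by move=> mF F0; apply: emeasurable_funM; [exact/measurable_EFinP|exact: measurable_iterint_step]. Qed.

Lemma iterint_le s F G e : measurable_fun setT (F : borel V -> \bar R) ->
  measurable_fun setT (G : borel V -> \bar R) ->
  (forall v, 0 <= F v) -> (forall v, F v <= G v) ->
  iterint g w s F e <= iterint g w s G e.
Proof.
move=> mF mG F0 FG; elim: s e => [|x s ih] e //=.
have G0 v : 0 <= G v by exact: le_trans (FG v).
apply: ge0_le_integral => //.
- by move=> a _; rewrite mule_ge0 ?lee_fin//; exact: iterint_ge0.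
- exact: measurable_iterint_wstep.
- exact: measurable_iterint_wstep.
- by move=> a _; rewrite lee_wpmul2l ?lee_fin.
Qed.

Lemma iterint_translate s F v e :
  iterint g w s (fun u => F (v + u)%R) e = iterint g w s F (v + e)%R.
Proof.
elim: s e => [|x s ih] e //=.
by apply: eq_integral => a _; rewrite ih addrA.
Qed.

Lemma iterint0 s e : iterint g w s (fun=> 0) e = 0.
Proof.
elim: s e => [|x s ih] e //=.
by rewrite integral0_eq// => a _; rewrite ih mule0.
Qed.

Lemma iterintZ s F e (c : \bar R) : measurable_fun setT (F : borel V -> \bar R) ->
  (forall v, 0 <= F v) -> 0 <= c ->
  iterint g w s (fun u => c * F u) e = c * iterint g w s F e.
Proof.
move=> mF F0 c0; elim: s e => [|x s ih] e //=.
under eq_integral do rewrite ih muleCA.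
rewrite ge0_integralZl//; first exact: measurable_iterint_wstep.
by move=> a _; rewrite mule_ge0 ?lee_fin//; exact: iterint_ge0.
Qed.

Lemma limn_einf_ge0 (u : nat -> \bar R) : (forall n, 0 <= u n) -> 0 <= limn_einf u.
Proof.
move=> u0; rewrite limn_einf_lim; apply: lime_ge; first exact: is_cvg_einfs.
by apply: nearW => n; apply: le_ereal_inf_tmp => _ [m _ <-].
Qed.

Lemma limn_einfZ_ge (u : nat -> \bar R) (c : R) : (0 <= c)%R ->
  c%:E * limn_einf u <= limn_einf (fun n => c%:E * u n).
Proof.
move=> c0; rewrite !limn_einf_lim -limeMl//; last exact: is_cvg_einfs.
apply: lee_lim; [by apply: is_cvgeMl => //; exact: is_cvg_einfs|exact: is_cvg_einfs|].
apply: nearW => n; apply: le_ereal_inf_tmp => _ [m nm <-].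
by rewrite lee_wpmul2l ?lee_fin//; apply: ereal_inf_lbound; exists m.
Qed.

Lemma measurable_fun_limn_einf d (T : measurableType d) (F : nat -> T -> \bar R) :
  (forall n, measurable_fun setT (F n)) ->
  measurable_fun setT (fun u : T => limn_einf (F ^~ u)).
Proof.
move=> mF; apply: measurableT_comp => //; apply: measurable_fun_limn_esup => n.
exact: measurableT_comp.
Qed.

Lemma iterint_fatou s (F : nat -> V -> \bar R) e :
  (forall n, measurable_fun setT (F n : borel V -> \bar R)) ->
  (forall n v, 0 <= F n v) ->
  iterint g w s (fun u => limn_einf (F ^~ u)) e <= limn_einf (fun n => iterint g w s (F n) e).
Proof.
move=> mF F0; elim: s e => [|x s ih] e //=.
have mL : measurable_fun setT (fun u : borel V => limn_einf (F ^~ u)).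
  exact: measurable_fun_limn_einf.
have L0 v : 0 <= limn_einf (F ^~ v) by exact: limn_einf_ge0.
apply: le_trans (fatou _ _ _ _) => //; last 2 first.
- by move=> n; apply: measurable_iterint_wstep.
- by move=> n a _; rewrite mule_ge0 ?lee_fin//; exact: iterint_ge0.
apply: ge0_le_integral => //.
- by move=> a _; rewrite mule_ge0 ?lee_fin//; exact: iterint_ge0.
- exact: measurable_iterint_wstep.
- apply: measurable_fun_limn_einf => n; exact: measurable_iterint_wstep.
move=> a _; apply: le_trans (limn_einfZ_ge _ (w0 a)).
by rewrite lee_wpmul2l ?lee_fin.
Qed.

Lemma iterint_nneseries s (F : nat -> V -> \bar R) e :
  (forall n, measurable_fun setT (F n : borel V -> \bar R)) ->
  (forall n v, 0 <= F n v) ->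
  iterint g w s (fun u => \sum_(n <oo) F n u) e = \sum_(n <oo) iterint g w s (F n) e.
Proof.
move=> mF F0; elim: s e => [|x s ih] e //=.
rewrite -integral_nneseries//; last 2 first.
- by move=> n; apply: measurable_iterint_wstep.
- by move=> n a _; rewrite mule_ge0 ?lee_fin//; exact: iterint_ge0.
apply: eq_integral => a _; rewrite ih nneseriesZl// => n _; exact: iterint_ge0.
Qed.

End basic.
End iterated.

(** * Changing and shrinking the perturbations *)

Section weights.
Context {R : realType} {V : normedModType R}.
Local Open Scope ereal_scope.
Notation leb := (@lebesgue_measure R).

Definition window (r : R) (a : R) : R := \1_(`[(- r)%R, r]%classic : set R) a.
Definition window01 (a : R) : R := \1_(`[0%R, 1%R]%classic : set R) a.

Lemma measurable_window r : measurable_fun setT (window r).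
Proof. exact: measurable_indic. Qed.

Lemma measurable_window01 : measurable_fun setT window01.
Proof. exact: measurable_indic. Qed.

Lemma window_ge0 r a : (0 <= window r a)%R. Proof. by rewrite /window indicE ler0n. Qed.
Lemma window01_ge0 a : (0 <= window01 a)%R. Proof. by rewrite /window01 indicE ler0n. Qed.
Hint Resolve measurable_window measurable_window01 window_ge0 window01_ge0 : core.

Lemma window_shift r r' c a : (`|c| <= r' - r)%R -> (window r a <= window r' (a - c))%R.
Proof.
move=> cr; rewrite /window !indicE ler_nat.
case: (boolP (a \in _)) => //; rewrite inE /= in_itv /= => /andP[h1 h2].
rewrite mem_set//= in_itv /=; move: cr; rewrite ler_norml => /andP[h3 h4].
by apply/andP; split; lra.
Qed.

Lemma integral_window r : (0 <= r)%R -> \int[leb]_a (window r a)%:E = (2 * r)%:E.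
Proof.
move=> r0; rewrite integral_indic//= setIT.
have /= -> := lebesgue_measure_itv (`[(- r)%R, r] : interval R).
rewrite lte_fin; case: ltP => h; first by rewrite -EFinB; congr (_%:E); ring.
by congr (_%:E); lra.
Qed.

Lemma integral_window01 : \int[leb]_a (window01 a)%:E = 1.
Proof.
rewrite integral_indic//= setIT.
have /= -> := lebesgue_measure_itv (`[0%R, 1%R] : interval R).
by rewrite lte_fin ltr01 -EFinB subr0.
Qed.

Lemma iterint_cst (S : Type) (g : S -> V) r s (c : R) e : (0 <= r)%R -> (0 <= c)%R ->
  iterint g (window r) s (fun=> c%:E) e = (c * (2 * r) ^+ size s)%:E.
Proof.
move=> r0 c0; elim: s e => [|x s ih] e /=; first by rewrite expr0 mulr1.
under eq_integral do rewrite ih.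
rewrite ge0_integralZr//; last 3 first.
- by apply/measurable_EFinP; first [exact: measurable_window|exact: measurable_window01].
- by move=> a _; rewrite lee_fin.
- by rewrite lee_fin mulr_ge0// exprn_ge0// mulr_ge0.
- by rewrite integral_window// -EFinM exprS; congr (_%:E); ring.
Qed.

(** In the coordinates a_i a translation by c_i moves the box of half-side r into
    the box of half-side r', and Lebesgue measure is translation invariant. *)
Lemma iterint_shift (S : Type) (g : S -> V) r r' s c (F : V -> \bar R) v :
  measurable_fun setT (F : borel V -> \bar R) -> (forall u, 0 <= F u) ->
  (forall x, (`|c x| <= r' - r)%R) ->
  iterint g (window r) s F v <= iterint g (window r') s F (v + \sum_(x <- s) c x *: g x)%R.
Proof.
move=> mF F0 cr; elim: s v => [|x s ih] v /=; first by rewrite big_nil addr0.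
(* the integrand of the larger integral, to be evaluated at a - c x *)
pose f (a : R) := (window r' a)%:E * iterint g (window r') s F
  (v + \sum_(y <- (x :: s)) c y *: g y + a *: g x)%R.
have mf : measurable_fun setT f by apply: measurable_iterint_wstep.
have f0 a : 0 <= f a by rewrite mule_ge0 ?lee_fin//; exact: iterint_ge0.
rewrite -[leRHS]/(\int[leb]_a f a) -(integral_translate (- c x)%R)//.
apply: ge0_le_integral => //.
- by move=> a _; rewrite mule_ge0 ?lee_fin//; exact: iterint_ge0.
- exact: measurable_iterint_wstep.
- have m1 : measurable_fun setT (fun a : R => a - c x)%R by exact: measurable_funB.
  exact: (measurableT_comp mf m1).
move=> a _; apply: lee_pmul.
- by rewrite lee_fin.
- exact: iterint_ge0.
- by rewrite lee_fin; exact: window_shift.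
- apply: (le_trans (ih _)); rewrite big_cons.
  suff -> : (v + a *: g x + \sum_(j <- s) c j *: g j =
     v + (c x *: g x + \sum_(j <- s) c j *: g j) + (a - c x) *: g x)%R by [].
  rewrite scalerBl -!addrA; congr (_ + _)%R.
  by rewrite [RHS]addrC -addrA subrK addrC.
Qed.

(** Averaging [iterint_shift] over the multiples of g2 y by numbers in [0, 1]. *)
Lemma iterint_average1 (S S2 : Type) (g : S -> V) (g2 : S2 -> V) r r' s c y
    (F : V -> \bar R) v :
  measurable_fun setT (F : borel V -> \bar R) -> (forall u, 0 <= F u) ->
  (forall x, (`|c x| <= r' - r)%R) -> g2 y = (\sum_(x <- s) c x *: g x)%R ->
  iterint g (window r) s F v <= iterint g (window r') s (iterint g2 window01 [:: y] F) v.
Proof.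
move=> mF F0 cr g2y.
have mG : measurable_fun setT (fun p : borel V * R => (window01 p.2)%:E * F (p.1 + p.2 *: g2 y : V)%R).
  apply: emeasurable_funM; first by apply/measurable_EFinP; exact: measurableT_comp.
  exact: (measurableT_comp mF (measurable_shift (g2 y))).
have G0 (p : borel V * R) : 0 <= (window01 p.2)%:E * F (p.1 + p.2 *: g2 y : V)%R.
  by rewrite mule_ge0 ?lee_fin.
have -> : iterint g (window r') s (iterint g2 window01 [:: y] F) v = \int[leb]_a
   iterint g (window r') s (fun e => (window01 a)%:E * F (e + a *: g2 y)%R) v.
  exact: (iterint_tonelli g (measurable_window r') (window_ge0 r') leb s v mG G0).
have mI0 := measurable_iterint g (measurable_window r') (window_ge0 r') s mF F0.
apply: (@le_trans _ _ (\int[leb]_a ((window01 a)%:E * iterint g (window r) s F v))).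
  rewrite ge0_integralZr//; last 3 first.
  - by apply/measurable_EFinP; first [exact: measurable_window|exact: measurable_window01].
  - by move=> a _; rewrite lee_fin.
  - exact: iterint_ge0.
  - by rewrite integral_window01 mul1e.
apply: ge0_le_integral => //.
- by move=> a _; rewrite mule_ge0 ?lee_fin//; exact: iterint_ge0.
- by apply: emeasurable_funM; [by apply/measurable_EFinP; exact: measurable_window01|exact: measurable_cst].
- have h := measurable_iterint2 g (measurable_window r') (window_ge0 r') s mG G0.
  have k : measurable_fun setT (fun a : R => (v : borel V, a)).
    by apply/measurable_fun_pairP; split; [exact: measurable_cst|exact: measurable_id].
  exact: (measurableT_comp h k).
move=> a _ /=.
have mFa : measurable_fun setT (fun u : borel V => F (u + a *: g2 y)%R).
  have k : measurable_fun setT (fun u : borel V => (u, a)).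
    by apply/measurable_fun_pairP; split; [exact: measurable_id|exact: measurable_cst].
  exact: (measurableT_comp mF (measurableT_comp (measurable_shift (g2 y)) k)).
rewrite (iterintZ g (measurable_window r') (window_ge0 r'))//; last by rewrite lee_fin.
have [a01|a01] := boolP (a \in (`[0%R, 1%R]%classic : set R)); last first.
  by rewrite /window01 indicE (negbTE a01) !mul0e.
rewrite /window01 indicE a01 !mul1e.
have -> : (fun u => F (u + a *: g2 y)%R) = (fun u => F (a *: g2 y + u)%R).
  by apply/funext => u; rewrite addrC.
rewrite iterint_translate [(a *: _ + v)%R]addrC g2y scaler_sumr.
under eq_bigr do rewrite scalerA.
apply: iterint_shift => // x; rewrite normrM (le_trans _ (cr x))//.
move: a01; rewrite inE /= in_itv /= => /andP[a0 a1].
by rewrite ger0_norm// ler_piMl.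
Qed.

(** A bound for the integrals along the directions g2, uniform in the base point,
    yields a bound for the integral over the whole span of g.  So the directions
    may depend on the pair of points under study, while the span does not. *)
Lemma iterint_average (S S2 : Type) (g : S -> V) (g2 : S2 -> V) r b s (s2 : seq S2) c
    (F : V -> \bar R) v :
  measurable_fun setT (F : borel V -> \bar R) -> (forall u, 0 <= F u) ->
  (forall y x, (`|c y x| <= b)%R) -> (forall y, g2 y = \sum_(x <- s) c y x *: g x)%R ->
  iterint g (window r) s F v <= iterint g (window (r + b *+ size s2)) s (iterint g2 window01 s2 F) v.
Proof.
move=> mF F0 cb g2E; elim: s2 r => [|y s2 ih] r /=.
  by rewrite mulr0n addr0.
apply: (le_trans (ih r)).
have mI := measurable_iterint g2 measurable_window01 window01_ge0 s2 mF F0.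
apply: (@iterint_average1 S S2 g g2 _ _ s (c y) y (iterint g2 window01 s2 F)) => //.
- by move=> u; exact: iterint_ge0.
- move=> x; rewrite mulrS; apply: le_trans (cb y x) _.
  by rewrite le_eqVlt; apply/orP; left; apply/eqP; ring.
Qed.

Lemma iterint_eq0 (S : eqType) (g : S -> V) w s (F : V -> \bar R) e : uniq s ->
  (forall c : S -> R, F (e + \sum_(x <- s) c x *: g x)%R = 0) -> iterint g w s F e = 0.
Proof.
elim: s e => [|x s ih] e /= us H.
  by have := H (fun=> 0%R); rewrite big_nil addr0.
move: us => /andP[xs us].
rewrite integral0_eq// => a _; rewrite ih ?mule0// => c.
have := H (fun z => if z == x then a else c z).
rewrite big_cons eqxx addrA.
under eq_big_seq => z zs.
  have -> : (z == x) = false by apply/eqP => zx; move: xs; rewrite -zx zs.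
  over.
by [].
Qed.

(** If any two parameters at which F does not vanish differ by at most rh in each
    coordinate, the support lies in a cube of side 2 rh. *)
Lemma iterint_small (S : eqType) (g : S -> V) s (F : V -> \bar R) e (rh : R) : uniq s ->
  measurable_fun setT (F : borel V -> \bar R) -> (forall u, 0 <= F u) -> (forall u, F u <= 1) ->
  (0 <= rh)%R ->
  (forall c c' : S -> R, F (e + \sum_(x <- s) c x *: g x)%R != 0 ->
     F (e + \sum_(x <- s) c' x *: g x)%R != 0 -> forall x, x \in s -> (`|c x - c' x| <= rh)%R) ->
  iterint g window01 s F e <= ((2 * rh) ^+ size s)%:E.
Proof.
move=> us mF F0 F1 rh0; elim: s e us => [|x s ih] e /= us H; first by rewrite expr0.
move: us => /andP[xs us].
(* parameters for x :: s from a first coordinate a and parameters for s *)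
pose ext a (c : S -> R) := fun z => if z == x then a else c z.
have extE a c : (e + \sum_(z <- x :: s) ext a c z *: g z =
    e + a *: g x + \sum_(z <- s) c z *: g z)%R.
  rewrite big_cons /ext eqxx addrA; congr (_ + _)%R; apply: eq_big_seq => z zs.
  by have -> : (z == x) = false by apply/eqP => zx; move: xs; rewrite -zx zs.
pose f a := iterint g window01 s F (e + a *: g x)%R.
have fle a : f a <= ((2 * rh) ^+ size s)%:E.
  apply: ih => // c c' h h' z zs.
  have := H (ext a c) (ext a c'); rewrite !extE => /(_ h h' z).
  rewrite in_cons zs orbT => /(_ isT); rewrite /ext.
  by have -> : (z == x) = false by apply/eqP => zx; move: xs; rewrite -zx zs.
have fn0 a : f a != 0 -> exists c, F (e + a *: g x + \sum_(z <- s) c z *: g z)%R != 0.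
  move=> fa; apply: contrapT => nex; move/eqP: fa; apply.
  apply: iterint_eq0 => // c; apply/eqP; apply: contrapT => /negP h; apply: nex; by exists c.
have P0 : (0 <= (2 * rh) ^+ size s)%R by rewrite exprn_ge0// mulr_ge0.
have [[a0 fa0]|nf] := pselect (exists a, f a != 0); last first.
  rewrite integral0_eq ?lee_fin ?exprn_ge0 ?mulr_ge0// => a _.
  by have [fa|fa] := eqVneq (f a) 0; [rewrite -/(f a) fa mule0|exfalso; apply: nf; exists a].
have mf := measurable_iterint_wstep g measurable_window01 window01_ge0 s x e mF F0.
apply: (@le_trans _ _ (\int[leb]_a ((window rh (a - a0))%:E * ((2 * rh) ^+ size s)%:E))).
  have mW : measurable_fun setT (fun a : R => window rh (a - a0)).
    by apply: (measurableT_comp (measurable_window rh)); exact: measurable_funB.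
  apply: ge0_le_integral => //.
  - by move=> a _; rewrite mule_ge0 ?lee_fin//; exact: iterint_ge0.
  - apply: emeasurable_funM; [by apply/measurable_EFinP|exact: measurable_cst].
  move=> a _; have [fa|fa] := eqVneq (f a) 0.
    by rewrite -/(f a) fa mule0 mule_ge0 ?lee_fin.
  rewrite lee_pmul ?lee_fin ?iterint_ge0//; last exact: fle.
  have -> : window rh (a - a0) = 1%R.
    rewrite /window indicE mem_set//= in_itv /=.
    have [c0 h0] := fn0 _ fa0; have [c h] := fn0 _ fa.
    have := H (ext a c) (ext a0 c0); rewrite !extE => /(_ h h0 x).
    by rewrite mem_head => /(_ isT); rewrite /ext eqxx ler_norml.
  by rewrite /window01 indicE lern1 leq_b1.
have mZ : measurable_fun setT (fun a : R => (window rh a)%:E * ((2 * rh) ^+ size s)%:E).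
  apply: emeasurable_funM; [by apply/measurable_EFinP; exact: measurable_window|exact: measurable_cst].
rewrite (integral_translate (- a0)%R mZ); last by move=> a; rewrite mule_ge0 ?lee_fin.
rewrite ge0_integralZr//; last 2 first.
- by apply/measurable_EFinP; first [exact: measurable_window|exact: measurable_window01].
- by move=> a _; rewrite lee_fin.
- by rewrite integral_window// -EFinM exprS.
Qed.

End weights.

(** * The probe measure *)

Section probe.
Context {R : realType} {V : normedModType R}.
Variables (S : Type) (g : S -> V) (s : seq S).
Local Open Scope ereal_scope.

Let indE (B : set V) (v : V) : \bar R := (\1_B v)%:E.

Let ind_ge0 B v : 0 <= indE B v.
Proof. by rewrite /indE lee_fin indicE ler0n. Qed.

Let measurable_ind (B : set (borel V)) : measurable B ->
  measurable_fun setT (indE B : borel V -> \bar R).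
Proof. by move=> mB; apply/measurable_EFinP; exact: measurable_indic. Qed.

(** The law of a_1 g_1 + ... + a_n g_n for a uniform in the cube [-1, 1]^n, up to
    normalization. *)
Definition probe (B : set (borel V)) : \bar R := iterint g (window 1) s (indE B) 0%R.

Lemma probe0 : probe set0 = 0.
Proof.
rewrite /probe (_ : indE set0 = fun=> 0) ?iterint0//.
by apply/funext => v; rewrite /indE indic0.
Qed.

Lemma probe_ge0 B : 0 <= probe B.
Proof. by apply: iterint_ge0 => // a; exact: window_ge0. Qed.

Lemma probe_sigma_additive : semi_sigma_additive probe.
Proof.
move=> F mF tF mUF.
have -> : probe (\bigcup_n F n) = \sum_(n <oo) probe (F n).
  rewrite -(@iterint_nneseries R V S g (window 1) (measurable_window 1) (@window_ge0 R 1) s (fun n => indE (F n)))//.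
    congr (iterint _ _ _ _ _); apply/funext => v; rewrite /indE.
    by rewrite indic_bigcup.
  by move=> n; exact: measurable_ind.
by apply: is_cvg_nneseries => n _ _; exact: probe_ge0.
Qed.

HB.instance Definition _ := isMeasure.Build _ _ _ probe probe0 probe_ge0 probe_sigma_additive.

Fixpoint box (t : seq S) : set V :=
  if t is x :: t' then
    (fun p : R * V => p.1 *: g x + p.2)%R @` ((`[(- 1)%R, 1%R]%classic : set R) `*` box t')
  else [set 0%R].

Lemma box_compact t : compact (box t).
Proof.
elim: t => [|x t ih] /=; first exact: compact_set1.
apply: continuous_compact; last by apply: compact_setX => //; exact: segment_compact.
apply: continuous_subspaceT => p.
apply: (@cvgD _ _ _ _ _ (fun p : R * V => p.1 *: g x)%R (fun p : R * V => p.2)).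
  by apply: cvgZr_tmp; exact: cvg_fst.
exact: cvg_snd.
Qed.

(** The integral only sees the values of F on the translate e + box t. *)
Lemma iterint_box t (F : V -> \bar R) e : measurable_fun setT (F : borel V -> \bar R) ->
  (forall v, box t v -> F (e + v)%R = 1) -> iterint g (window 1) t F e = (2 ^+ size t)%:E.
Proof.
move=> mF; elim: t e => [|x t ih] e /= H.
  by rewrite expr0 -(H 0%R)// addr0.
transitivity (\int[@lebesgue_measure R]_a ((window 1 a)%:E * (2 ^+ size t)%:E)).
  apply: eq_integral => a _.
  have [a1|a1] := boolP (a \in (`[(- 1)%R, 1%R]%classic : set R)); last first.
    by rewrite /window indicE (negbTE a1) !mul0e.
  rewrite ih// => v bv; rewrite -addrA; apply: H; exists (a, v) => //; split => //=.
  by move: a1; rewrite inE.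
rewrite ge0_integralZr//; last 2 first.
- by apply/measurable_EFinP; exact: measurable_window.
- by move=> a _; rewrite lee_fin window_ge0.
by rewrite integral_window// -EFinM exprS mulr1.
Qed.

Lemma probe_box : probe (box s) = (2 ^+ size s)%:E.
Proof.
apply: iterint_box.
  apply: measurable_ind; rewrite -[X in measurable X]setCK; apply: measurableC.
  apply: sub_sigma_algebra; rewrite openC; apply: compact_closed; last exact: box_compact.
  exact: norm_hausdorff.
by move=> v bv; rewrite add0r /indE indicE mem_set.
Qed.

(** The probe measure of the complement of B - v is the iterated integral of the
    indicator of the complement of B, based at v. *)
Lemma borel_prevalent_probe (B : set (borel V)) : measurable B ->
  (forall v, iterint g (window 1) s (fun u => (\1_(~` B) u)%:E) v = 0) -> borel_prevalent B.
Proof.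
move=> mB B0; exists (probe : {measure set (borel V) -> \bar R}); split.
  exists (box s); split; [exact: box_compact| |].
    by rewrite /= probe_box lte_fin exprn_gt0.
  by rewrite /= probe_box ltry.
move=> v; exists ((fun e : V => v + e)%R @^-1` (~` B)); split => //.
  have mv : measurable_fun setT (fun e : borel V => (v + e)%R : borel V).
    have k : measurable_fun setT (fun e : borel V => (e, 1%R : R)).
      by apply/measurable_fun_pairP; split; [exact: measurable_id|exact: measurable_cst].
    have := measurableT_comp (measurable_shift v) k.
    by apply: eq_measurable_fun => e _ /=; rewrite scale1r addrC.
  by rewrite -[X in measurable X]setTI; apply: mv => //; exact: measurableC.
rewrite /= /probe -[RHS](B0 v) -[in RHS](addr0 v) -iterint_translate.
by congr (iterint _ _ _ _ _); apply/funext => u; rewrite /indE !indicE.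
Qed.

End probe.

(** * Observables with energies bounded infinitely often *)

Section energy.
Context {R : realType} {V : normedModType R}.
Variables (S : Type) (g : S -> V) (s : seq S).
Local Open Scope ereal_scope.

Definition finite_liminf (J : nat -> V -> \bar R) : set (borel V) :=
  [set h | limn_einf (J ^~ h) < +oo].

Lemma finite_liminfP (J : nat -> V -> \bar R) h : finite_liminf J h ->
  exists K : R, forall N, exists2 n, (N <= n)%N & J n h <= K%:E.
Proof.
rewrite /finite_liminf /=; set L := limn_einf _ => Loo.
have [K LK] : exists K : R, L < K%:E.
  case: L Loo => [r _|//|_]; last by exists 0%R; rewrite ltNyr.
  by exists (r + 1)%R; rewrite lte_fin ltrDl.
exists K => N.
have h1 : einfs (J ^~ h) N < K%:E.
  apply: le_lt_trans LK; rewrite /L limn_einf_lim.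
  rewrite (cvg_lim _ (@cvg_einfs_sup _ _))//.
  by apply: ereal_sup_ubound; exists N.
have [_ [n Nn <-] Jn] := ereal_inf_lt h1.
by exists n => //; exact: ltW.
Qed.

(** Fatou lemma, followed by the remark that a function with finite integral is
    finite almost everywhere. *)
Lemma iterint_finite_liminf (J : nat -> V -> \bar R) (C : R) :
  (forall n, measurable_fun setT (J n : borel V -> \bar R)) ->
  (forall n v, 0 <= J n v) ->
  (forall n v, iterint g (window 1) s (J n) v <= C%:E) ->
  measurable (finite_liminf J) /\
  forall v, iterint g (window 1) s (fun u => (\1_(~` finite_liminf J) u)%:E) v = 0.
Proof.
move=> mJ J0 JC.
have mL : measurable_fun setT (fun u : borel V => limn_einf (J ^~ u)).
  exact: measurable_fun_limn_einf.
have mB : measurable (finite_liminf J).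
  rewrite (_ : finite_liminf J = (fun u : borel V => limn_einf (J ^~ u)) @^-1` `]-oo, (+oo : \bar R)[%classic).
    by rewrite -[X in measurable X]setTI; apply: mL => //; exact: emeasurable_itv.
  by apply/seteqP; split => u; rewrite /finite_liminf /= in_itv.
have m1 : measurable_fun setT (fun u : borel V => (\1_(~` finite_liminf J) u)%:E : \bar R).
  by apply/measurable_EFinP; apply: measurable_indic; exact: measurableC.
have p1 u : 0 <= (\1_(~` finite_liminf J) u)%:E by rewrite lee_fin indicE ler0n.
split => // v.
have w0 := @window_ge0 R 1; have mw := @measurable_window R 1.
have I0 : 0 <= iterint g (window 1) s (fun u => (\1_(~` finite_liminf J) u)%:E) v.
  exact: iterint_ge0.
have : +oo * iterint g (window 1) s (fun u => (\1_(~` finite_liminf J) u)%:E) v <= C%:E.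
  rewrite -iterintZ//; apply: (@le_trans _ _ (iterint g (window 1) s (fun u => limn_einf (J ^~ u)) v)).
    apply: iterint_le => //.
    - by apply: emeasurable_funM => //; exact: measurable_cst.
    move=> u; rewrite indicE; case: (boolP (u \in _)) => uB /=; last first.
      by rewrite mule0; exact: limn_einf_ge0.
    move: uB; rewrite inE /finite_liminf /= => /negP; rewrite -leNgt leye_eq => /eqP ->.
    by rewrite mule1.
  apply: (le_trans (iterint_fatou g mw w0 s v mJ J0)).
  rewrite limn_einf_lim; apply: lime_le; first exact: is_cvg_einfs.
  apply: nearW => n; apply: le_trans (JC n v).
  by apply: ereal_inf_lbound; exists n => /=.
move: I0; rewrite le_eqVlt => /predU1P[<-//|I0].
by rewrite gt0_mulye// leye_eq.
Qed.

Lemma iterint_bigcap (I : countType) (B : I -> set (borel V)) :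
  (forall i, measurable (B i)) ->
  (forall i v, iterint g (window 1) s (fun u => (\1_(~` B i) u)%:E) v = 0) ->
  measurable (\bigcap_i B i) /\
  forall v, iterint g (window 1) s (fun u => (\1_(~` (\bigcap_i B i)) u)%:E) v = 0.
Proof.
move=> mB B0.
pose D n : set (borel V) := if unpickle n is Some i then B i else setT.
have mD n : measurable (D n) by rewrite /D; case: unpickle.
have DB : \bigcap_i B i = \bigcap_n D n.
  apply/seteqP; split => [v Bv n _|v Dv i _].
    by rewrite /D; case: unpickle => // i; exact: Bv.
  by have := Dv (pickle i) Logic.I; rewrite /D pickleK.
have m1 n : measurable_fun setT (fun u : borel V => (\1_(~` D n) u)%:E : \bar R).
  by apply/measurable_EFinP; apply: measurable_indic; exact: measurableC.
have p1 (A : set V) u : 0 <= (\1_A u)%:E :> \bar R by rewrite lee_fin indicE ler0n.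
have w0 := @window_ge0 R 1; have mw := @measurable_window R 1.
rewrite DB; have mDD : measurable (\bigcap_n D n) by exact: bigcapT_measurable.
split => // v; apply/eqP; rewrite eq_le; apply/andP; split; last exact: iterint_ge0.
apply: (@le_trans _ _ (iterint g (window 1) s (fun u => \sum_(n <oo) (\1_(~` D n) u)%:E) v)).
  apply: iterint_le => //.
  - by apply/measurable_EFinP; apply: measurable_indic; exact: measurableC.
  - by apply: ge0_emeasurable_sum.
  move=> u; rewrite indicE; case: (boolP (u \in _)) => uB /=; last exact: nneseries_ge0.
  move: uB; rewrite inE => /existsNP[n /not_implyP[_ Dn]].
  rewrite (@nneseriesD1 R _ n)//.
  by rewrite indicE mem_set// leeDl// nneseries_ge0.
rewrite iterint_nneseries// eseries0// => n _ _.
rewrite /D; case: unpickle => [i|]; first exact: B0.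
rewrite setCT (_ : (fun u => _) = fun=> 0) ?iterint0//.
by apply/funext => u; rewrite indic0.
Qed.

End energy.

(** * Polynomials that separate finitely many points *)

(** Finitely many positive radii have a positive minimum. *)
Lemma fin_radius (R : realType) (I : finType) (P : I -> R -> Prop) :
  (forall i r r', r' <= r -> P i r -> P i r') ->
  (forall i, exists2 r, 0 < r & P i r) -> exists2 r, 0 < r & forall i, P i r.
Proof.
move=> Pm Pex.
suff [r r0 rP] : exists2 r, 0 < r & forall i, i \in enum I -> P i r.
  by exists r => // i; apply: rP; rewrite mem_enum.
elim: (enum I) => [|i s [r r0 rP]]; first by exists 1.
have [r' r'0 r'P] := Pex i.
exists (Num.min r r'); first by rewrite lt_min r0.
move=> j; rewrite in_cons => /predU1P[->|js].
  by apply: Pm r'P; rewrite ge_min lexx orbT.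
by apply: Pm (rP _ js); rewrite ge_min lexx.
Qed.

Section calculus.
Context {R : realType} {N : nat} (X : set 'rV[R]_N).
Implicit Types (f : 'rV[R]_N -> R) (p u v : 'rV[R]_N).

(** Bounded and Lipschitz on X: the class is closed under products. *)
Definition bounded_lip f := exists2 L, 0 <= L &
  forall u v, X u -> X v -> `|f u| <= L /\ `|f u - f v| <= L * `|u - v|.

(** Strict differentiability at p with derivative 0. *)
Definition flat f p := forall e, 0 < e -> exists2 r, 0 < r &
  forall u v, X u -> X v -> `|u - p| < r -> `|v - p| < r -> `|f u - f v| <= e * `|u - v|.

Lemma blip_cst c : bounded_lip (fun=> c).
Proof.
exists `|c| => // u v _ _; split => //.
by rewrite subrr normr0 mulr_ge0.
Qed.

Lemma blip_coord M d : (forall u, X u -> `|u| <= M) -> bounded_lip (fun u => u 0 d).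
Proof.
move=> XM; have cn (w : 'rV[R]_N) : `|w 0 d| <= `|w|.
  by rewrite [leRHS]mx_normrE; exact: (le_bigmax _ _ (0, d)).
exists (Num.max M 1) => [|u v Xu Xv]; first by rewrite le_max ler01 orbT.
split; first by apply: (le_trans (cn u)); rewrite le_max XM.
have := cn (u - v); rewrite !mxE => /le_trans; apply.
by rewrite ler_peMl// le_max lexx orbT.
Qed.

Lemma blipD f g : bounded_lip f -> bounded_lip g -> bounded_lip (fun u => f u + g u).
Proof.
move=> [L L0 fL] [M M0 gM]; exists (L + M) => [|u v Xu Xv]; first exact: addr_ge0.
have [f1 f2] := fL u v Xu Xv; have [g1 g2] := gM u v Xu Xv; split.
  by rewrite (le_trans (ler_normD _ _))// lerD.
by rewrite opprD addrACA mulrDl (le_trans (ler_normD _ _))// lerD.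
Qed.

Lemma norm_mulB (a b c d A B e1 e2 : R) : `|a| <= A -> `|d| <= B -> `|b - d| <= e1 ->
  `|a - c| <= e2 -> `|a * b - c * d| <= A * e1 + e2 * B.
Proof.
move=> aA dB bd ac; have -> : a * b - c * d = a * (b - d) + (a - c) * d by ring.
rewrite (le_trans (ler_normD _ _))// !normrM lerD// ler_pM//.
Qed.

Lemma blipM f g : bounded_lip f -> bounded_lip g -> bounded_lip (fun u => f u * g u).
Proof.
move=> [L L0 fL] [M M0 gM]; exists (L * M + L * M) => [|u v Xu Xv].
  by rewrite addr_ge0// mulr_ge0.
have [f1 f2] := fL u v Xu Xv; have [g1 g2] := gM u v Xu Xv.
have [g1' _] := gM v u Xv Xu; split.
  by rewrite normrM (le_trans (ler_pM _ _ f1 g1))// lerDl mulr_ge0.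
apply: (le_trans (norm_mulB f1 g1' g2 f2)).
by rewrite mulrDl mulrA [L * _ * M]mulrAC.
Qed.

Lemma blip_sum (I : Type) (s : seq I) (F : I -> 'rV[R]_N -> R) :
  (forall i, bounded_lip (F i)) -> bounded_lip (fun u => \sum_(i <- s) F i u).
Proof.
move=> bF; elim: s => [|i s ih].
  by under [X in bounded_lip X]eq_fun do rewrite big_nil; exact: blip_cst.
by under [X in bounded_lip X]eq_fun do rewrite big_cons; exact: blipD.
Qed.

Lemma blip_prod (I : Type) (s : seq I) (P : pred I) (F : I -> 'rV[R]_N -> R) :
  (forall i, bounded_lip (F i)) -> bounded_lip (fun u => \prod_(i <- s | P i) F i u).
Proof.
move=> bF; elim: s => [|i s ih].
  by under [X in bounded_lip X]eq_fun do rewrite big_nil; exact: blip_cst.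
under [X in bounded_lip X]eq_fun do rewrite big_cons.
by case: (P i) => //; exact: blipM.
Qed.

(** A product of two Lipschitz functions vanishing at p is of second order there. *)
Lemma flatM f g p : X p -> bounded_lip f -> bounded_lip g -> f p = 0 -> g p = 0 ->
  flat (fun u => f u * g u) p.
Proof.
move=> Xp [L L0 fL] [M M0 gM] fp gp e e0.
have LM : 0 < L * M + M * L + 1 by rewrite ltr_wpDl// addr_ge0// mulr_ge0.
exists (e / (L * M + M * L + 1)); first by rewrite divr_gt0.
move=> u v Xu Xv; set r := e / _ => ur vr.
have [_ f2] := fL u v Xu Xv; have [_ g2] := gM u v Xu Xv.
have [_ fu] := fL u p Xu Xp; have [_ gv] := gM v p Xv Xp.
rewrite fp subr0 in fu; rewrite gp subr0 in gv.
have r0 : 0 <= r by rewrite divr_ge0// ltW.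
have fu' : `|f u| <= L * r by rewrite (le_trans fu)// ler_wpM2l// ltW.
have gv' : `|g v| <= M * r by rewrite (le_trans gv)// ler_wpM2l// ltW.
apply: (le_trans (norm_mulB fu' gv' g2 f2)).
have -> : L * r * (M * `|u - v|) + L * `|u - v| * (M * r) = (L * M + M * L) * r * `|u - v| by ring.
rewrite ler_wpM2r// /r mulrCA -[leRHS]mulr1 ler_wpM2l ?(ltW e0)//.
by rewrite ler_pdivrMr// mul1r lerDl.
Qed.

Lemma flat_sum (I : Type) (s : seq I) (F : I -> 'rV[R]_N -> R) p :
  (forall i, flat (F i) p) -> flat (fun u => \sum_(i <- s) F i u) p.
Proof.
move=> bF; elim: s => [|i s ih] e e0.
  by exists 1 => // u v; rewrite !big_nil subrr normr0 mulr_ge0// ltW.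
have e2 : 0 < e / 2 by rewrite divr_gt0.
have [r1 r10 H1] := bF i _ e2; have [r2 r20 H2] := ih _ e2.
exists (Num.min r1 r2) => [|u v Xu Xv]; first by rewrite lt_min r10.
rewrite !lt_min => /andP[u1 u2] /andP[v1 v2].
rewrite !big_cons opprD addrACA (le_trans (ler_normD _ _))//.
have -> : e * `|u - v| = e / 2 * `|u - v| + e / 2 * `|u - v| by field.
by rewrite lerD ?H1 ?H2.
Qed.

End calculus.

Section directions.
Context {R : realType} {N : nat} (X : set 'rV[R]_N) (M : R).
Hypothesis XM : forall u, X u -> `|u| <= M.
Variable k : nat.

Definition monom (l : option (option 'I_N)) (u : 'rV[R]_N) : R :=
  match l with None => 1 | Some None => nsq u | Some (Some d) => u 0 d end.

(** Products of k functions, each equal to 1, to |u|^2 or to a coordinate. *)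
Definition gpoly (sg : {ffun 'I_k -> option (option 'I_N)}) (u : 'rV[R]_N) : R :=
  \prod_(j < k) monom (sg j) u.

Lemma blip_nsq : bounded_lip X (@nsq R N).
Proof.
apply: blip_sum => d; apply: blipM; exact: (blip_coord _ XM).
Qed.

Lemma blip_monom l : bounded_lip X (monom l).
Proof.
case: l => [[d|]|]; [exact: (blip_coord _ XM)|exact: blip_nsq|exact: blip_cst].
Qed.

Lemma blip_gpoly sg : bounded_lip X (gpoly sg).
Proof. by apply: blip_prod => j; exact: blip_monom. Qed.

Definition inspan (f : 'rV[R]_N -> R) := exists A : option (option 'I_N) -> R,
  forall u, f u = \sum_l A l * monom l u.

Lemma sum_option (T : finType) (F : option T -> R) : \sum_l F l = F None + \sum_t F (Some t).
Proof.
rewrite (bigD1 None)//=; congr (_ + _).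
rewrite (reindex_omap Some id) /=; last by case.
by apply: eq_bigl => t; rewrite eqxx.
Qed.

Lemma inspanE a b (c : 'I_N -> R) :
  inspan (fun u => a + b * nsq u + \sum_d c d * u 0 d).
Proof.
exists (fun l => match l with None => a | Some None => b | Some (Some d) => c d end) => u.
by rewrite !sum_option /= mulr1 addrA.
Qed.

Lemma inspan_blip f : inspan f -> bounded_lip X f.
Proof.
move=> [A AE]; have -> : f = fun u => \sum_l A l * monom l u by apply/funext.
by apply: blip_sum => l; apply: blipM; [exact: blip_cst|exact: blip_monom].
Qed.

(** Distributivity turns a product of k linear combinations into a linear
    combination of products. *)
Lemma prod_inspan (F : 'I_k -> 'rV[R]_N -> R) : (forall j, inspan (F j)) ->
  exists A : {ffun 'I_k -> option (option 'I_N)} -> R,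
  forall u, \prod_j F j u = \sum_sg A sg * gpoly sg u.
Proof.
move=> /choice[A AE]; exists (fun sg => \prod_j A j (sg j)) => u.
rewrite (eq_bigr (fun j => \sum_l A j l * monom l u)); last by move=> j _; exact: AE.
by rewrite bigA_distr_bigA /=; apply: eq_bigr => sg _; rewrite big_split.
Qed.

Variables (x : 'I_k -> 'rV[R]_N) (Q : {set 'I_k}).
Hypothesis Xx : forall i, X (x i).
Hypothesis xinj : {in Q &, injective x}.

(** The product over j is the Hermite interpolation polynomial that vanishes to
    second order at x j for j in Q other than i, and behaves like the coordinate c
    of u - x i near x i. *)
Definition factor (i : 'I_k) (c : 'I_N) (j : 'I_k) (u : 'rV[R]_N) : R :=
  if j == i then (u - x i) 0 c
  else if j \in Q then nsq (u - x j) / nsq (x i - x j) else 1.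

Lemma inspan_factor i c j : inspan (factor i c j).
Proof.
have [->|ji] := eqVneq j i; rewrite /factor ?eqxx.
  have -> : (fun u : 'rV[R]_N => (u - x i) 0 c) =
    (fun u => - x i 0 c + 0 * nsq u + \sum_d (d == c)%:R * u 0 d).
    apply/funext => u; rewrite !mxE mul0r addr0 (bigD1 c)//= eqxx mul1r big1 ?addr0 1?addrC//.
    by move=> d /negbTE ->; rewrite mul0r.
  exact: inspanE.
rewrite (negbTE ji); have [jQ|jQ] := boolP (j \in Q).
  have -> : (fun u : 'rV[R]_N => nsq (u - x j) / nsq (x i - x j)) =
    (fun u => nsq (x j) / nsq (x i - x j) + (nsq (x i - x j))^-1 * nsq u +
              \sum_d (- 2 * x j 0 d / nsq (x i - x j)) * u 0 d).
    apply/funext => u; rewrite nsqB mulrBl mulrDl [X in _ = X + _]addrC [X in _ = X + _ + _]mulrC.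
    congr (_ + _); rewrite mulr_sumr mulr_suml -sumrN.
    by apply: eq_bigr => d _; ring.
  exact: inspanE.
have -> : (fun _ : 'rV[R]_N => 1) = (fun u => 1 + 0 * nsq u + \sum_d 0 * u 0 d).
  by apply/funext => u; rewrite mul0r addr0 big1 ?addr0// => d _; rewrite mul0r.
exact: inspanE.
Qed.

Lemma nsq_gt0 (v : 'rV[R]_N) : v != 0 -> 0 < nsq v.
Proof.
move=> v0; rewrite lt_neqAle nsq_ge0 andbT; apply: contra v0 => /eqP n0.
by apply/eqP/enorm0_eq0; rewrite enormE -n0 sqrtr0.
Qed.

(** At x i the remaining factors equal 1, so that the product differs from its
    linear factor by a term of second order; at the other points of Q the squared
    distance makes it of second order. *)
Lemma near_diagonal i i' c e : i \in Q -> i' \in Q -> 0 < e ->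
  exists2 r, 0 < r & forall u v, X u -> X v -> `|u - x i'| < r -> `|v - x i'| < r ->
    `|\prod_j factor i c j u - \prod_j factor i c j v - (i == i')%:R * (u - v) 0 c| <= e * `|u - v|.
Proof.
move=> iQ i'Q e0.
have bf j : bounded_lip X (factor i c j) by apply: inspan_blip; exact: inspan_factor.
have bc (p : 'rV[R]_N) d : bounded_lip X (fun u => (u - p) 0 d).
  have -> : (fun u : 'rV[R]_N => (u - p) 0 d) = (fun u => u 0 d + - p 0 d).
    by apply/funext => u; rewrite !mxE.
  by apply: blipD; [exact: (blip_coord _ XM)|exact: blip_cst].
have [<-|ii'] := eqVneq i i'.
  (* the factors other than the linear one; W (x i) = 1 *)
  pose W u := \prod_(j < k | j != i) factor i c j u.
  have WE u : \prod_j factor i c j u = (u - x i) 0 c * W u.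
    by rewrite (bigD1 i)//= {1}/factor eqxx.
  have [|||||r r0 H] := @flatM R N X (fun u => (u - x i) 0 c) (fun u => W u - 1) (x i) _ _ _ _ _ e e0.
  - exact: Xx.
  - exact: bc.
  - by apply: blipD; [exact: blip_prod|exact: blip_cst].
  - by rewrite subrr mxE.
  - rewrite /W big1 ?subrr// => j ji; rewrite /factor (negbTE ji).
    case: ifP => // jQ; rewrite divff// gt_eqF// nsq_gt0// subr_eq0.
    by apply: contra ji => /eqP /xinj h; rewrite h.
  exists r => // u v Xu Xv ur vr; apply: le_trans (H u v Xu Xv ur vr).
  by rewrite le_eqVlt; apply/orP; left; apply/eqP; congr (`| _ |); rewrite !WE ?eqxx !mxE ?mulr1n; ring.
pose D := nsq (x i - x i').
pose W u := \prod_(j < k | j != i') factor i c j u.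
have WE u : \prod_j factor i c j u = \sum_d (u - x i') 0 d * ((u - x i') 0 d * (D^-1 * W u)).
  rewrite (bigD1 i')//= {1}/factor eq_sym (negbTE ii') i'Q -/(W u) /nsq !mulr_suml.
  by apply: eq_bigr => d _; rewrite -/D; ring.
have H : flat X (fun u => \prod_j factor i c j u) (x i').
  have -> : (fun u => \prod_j factor i c j u) =
    (fun u => \sum_d (u - x i') 0 d * ((u - x i') 0 d * (D^-1 * W u))) by apply/funext.
  apply: flat_sum => d; apply: flatM => //.
  - apply: blipM => //; apply: blipM; first exact: blip_cst.
    exact: blip_prod.
  - by rewrite subrr mxE.
  - by rewrite subrr mxE mul0r.
have [r r0 Hr] := H e e0.
exists r => // u v Xu Xv ur vr; rewrite mul0r subr0; exact: Hr.
Qed.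

(** The constants depend on the points, but the family [gpoly] does not. *)
Lemma directions (e : R) : 0 < e ->
  exists (A : 'I_k -> 'I_N -> {ffun 'I_k -> option (option 'I_N)} -> R), exists2 r, 0 < r &
  forall i i' c, i \in Q -> i' \in Q ->
   forall u v, X u -> X v -> `|u - x i'| < r -> `|v - x i'| < r ->
    `|\sum_sg A i c sg * gpoly sg u - \sum_sg A i c sg * gpoly sg v - (i == i')%:R * (u - v) 0 c|
     <= e * `|u - v|.
Proof.
move=> e0.
have /choice[A AE] : forall ic : 'I_k * 'I_N, exists A : {ffun 'I_k -> option (option 'I_N)} -> R,
   forall u, \prod_j factor ic.1 ic.2 j u = \sum_sg A sg * gpoly sg u.
  by move=> ic; apply: prod_inspan => j; exact: inspan_factor.
exists (fun i c => A (i, c)).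
have [||r r0 H] := @fin_radius R ('I_k * 'I_k * 'I_N)%type (fun t r =>
   t.1.1 \in Q -> t.1.2 \in Q ->
   forall u v, X u -> X v -> `|u - x t.1.2| < r -> `|v - x t.1.2| < r ->
    `|\prod_j factor t.1.1 t.2 j u - \prod_j factor t.1.1 t.2 j v
      - (t.1.1 == t.1.2)%:R * (u - v) 0 t.2| <= e * `|u - v|).
- move=> t r r' rr' H tQ tQ' u v Xu Xv ur vr; apply: H => //; exact: lt_le_trans rr'.
- move=> [[i i'] c] /=.
  have [iQ|niQ] := boolP (i \in Q); last by exists 1.
  have [i'Q|ni'Q] := boolP (i' \in Q); last by exists 1.
  by have [r r0 H] := near_diagonal c iQ i'Q e0; exists r.
exists r => // i i' c iQ i'Q u v Xu Xv ur vr.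
have := H ((i, i'), c) iQ i'Q u v Xu Xv ur vr.
by rewrite /= !(AE (i, c)).
Qed.

End directions.

(** * Transversality for a pair of points *)

Section lip_elements.
Context {R : realType} {N : nat} {X : set 'rV[R]_N} (cX : compact X).

Lemma X_bound : exists M, forall u, X u -> `|u| <= M.
Proof.
have [M [_ XM]] := compact_bounded cX.
by exists (M + 1) => x Xx; apply: XM => //; rewrite ltrDl.
Qed.

Lemma lip_evalD (f g : Lip cX) x : (f + g) x = f x + g x. Proof. by []. Qed.
Lemma lip_eval_sum (I : Type) (s : seq I) (P : pred I) (F : I -> Lip cX) x :
  (\sum_(i <- s | P i) F i) x = \sum_(i <- s | P i) F i x.
Proof. by elim/big_ind2 : _ => // f u g w <- <-. Qed.

Lemma blip_lipschitz (f : 'rV[R]_N -> R) : bounded_lip X f ->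
  (fun x : X => f (set_val x)) \in @lip_pred R N X.
Proof.
move=> [L L0 fL]; rewrite inE; exists L; split => // x y.
have [_ h] := fL (set_val x) (set_val y) (set_mem (valP x)) (set_mem (valP y)).
by apply: (le_trans h); rewrite ler_wpM2l// norm_le_enorm.
Qed.

Variable k : nat.

Lemma gpoly_lip sg : (fun x : X => gpoly (k := k) sg (set_val x)) \in @lip_pred R N X.
Proof. by have [M XM] := X_bound; apply: blip_lipschitz; exact: blip_gpoly XM k sg. Qed.

Definition lip_gpoly (sg : {ffun 'I_k -> option (option 'I_N)}) : Lip cX := MkLip cX (gpoly_lip sg).

End lip_elements.

Section pairs.
Context {R : realType} {N : nat} {X : set 'rV[R]_N} (cX : compact X) (X0 : X !=set0).
Notation XT := (psubspace X0).
Variables (T : X -> X) (k : nat).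
Hypothesis lipT : lipschitz_self_map T.

Definition orbit_pt (i : nat) (x : X) : 'rV[R]_N := set_val (iter i T x).

Lemma orbit_pt_in i x : X (orbit_pt i x). Proof. exact: set_mem (valP _). Qed.

(** Lipschitz bounds for the iterates of T, used to compare the last point of the
    orbit segment with the earlier ones. *)
Lemma lip_consts_iter : exists2 L : R, 0 < L &
  forall i j (x y : X), (i <= j <= k)%N -> `|orbit_pt j x - orbit_pt j y| <= L * `|orbit_pt i x - orbit_pt i y|.
Proof.
have [L0 TL0] := lipT.
pose L := Num.max L0 1.
have L1 : 1 <= L by rewrite le_max lexx orbT.
have TL (x y : X) : enorm (set_val (T x) - set_val (T y)) <= L * enorm (set_val x - set_val y).
  by apply: (le_trans (TL0 x y)); rewrite ler_wpM2r ?enorm_ge0// le_max lexx.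
have TLn n i x y : enorm (orbit_pt (n + i) x - orbit_pt (n + i) y) <= L ^+ n * enorm (orbit_pt i x - orbit_pt i y).
  elim: n => [|n ih]; first by rewrite expr0 mul1r.
  rewrite addSn exprS -mulrA; apply: (le_trans (TL _ _)).
  by rewrite ler_wpM2l// (le_trans _ L1).
exists (L ^+ k * N.+1%:R) => [|i j x y /andP[ij jk]].
  by rewrite mulr_gt0 ?exprn_gt0 ?ltr0n// (lt_le_trans ltr01).
apply: (le_trans (norm_le_enorm _)).
have := TLn (j - i)%N i x y; rewrite subnK// => /le_trans; apply.
rewrite -mulrA; apply: ler_pM; rewrite ?exprn_ge0 ?(le_trans ler01 L1)//.
- exact: enorm_ge0.
- by rewrite ler_weXn2l// (leq_trans (leq_subr _ _)).
- exact: enorm_le_norm.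
Qed.

Lemma iter_continuous i : continuous (iter i T : XT -> XT).
Proof.
have cT : continuous (T : XT -> XT).
  have [L0 TL0] := lipT.
  move=> x A /psub_nbhs[r r0 rA].
  have L0' : 0 < `|L0| * N.+1%:R + 1 by rewrite ltr_wpDl// mulr_ge0.
  have nx : nbhs x ((set_val @^-1` ball (set_val x : 'rV[R]_N) (r / (`|L0| * N.+1%:R + 1)) : set X) : set XT).
    apply: open_nbhs_nbhs; split; first by apply: psub_open; exact: ball_open.
    by apply: ballxx; rewrite divr_gt0.
  have FF : Filter (nbhs (x : XT)) by exact: nbhs_filter.
  apply: filterS nx => y; rewrite /= -ball_normE /= => xy.
  apply: rA; rewrite distrC; apply: (le_lt_trans (norm_le_enorm _)).
  apply: (le_lt_trans (TL0 x y)).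
  apply: (@le_lt_trans _ _ (`|L0| * (N.+1%:R * `|set_val x - set_val y|))).
    apply: (le_trans (ler_wpM2r (enorm_ge0 _) (ler_norm L0))).
    by rewrite ler_wpM2l// enorm_le_norm.
  move: xy; rewrite ltr_pdivlMr// => /(le_lt_trans _); apply.
  by rewrite mulrDr mulr1 mulrA mulrC lerDl.
elim: i => [|i ih] /=; first by move=> x; exact: cvg_id.
by move=> x; apply: (@continuous_comp _ _ _ (iter i T : XT -> XT) (T : XT -> XT)); [exact: ih|exact: cT].
Qed.

Lemma orbit_pt_measurable i : measurable_fun setT (orbit_pt i : borel XT -> borel 'rV[R]_N).
Proof.
apply: continuous_measurable_borel => x.
by apply: (@continuous_comp _ _ _ (iter i T : XT -> XT) (fun x : XT => set_val x : 'rV[R]_N));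
  [exact: iter_continuous|exact: set_val_continuous].
Qed.

Definition close_pairs (delta : R) : set (borel (Lip cX) * (borel XT * borel XT)) :=
  [set p | forall i : 'I_k, `|(p.1 : Lip cX) (iter i T (p.2.1 : XT)) - (p.1 : Lip cX) (iter i T (p.2.2 : XT))| < delta].

Lemma measurable_close_pairs delta : measurable (close_pairs delta).
Proof.
have mi i : measurable_fun setT (iter i T : borel XT -> borel XT).
  by apply: continuous_measurable_borel; exact: iter_continuous.
have meval i (f : borel (Lip cX) * (borel XT * borel XT) -> borel XT) : measurable_fun setT f ->
    measurable_fun setT (fun q : borel (Lip cX) * (borel XT * borel XT) =>
      (q.1 : Lip cX) (iter i T (f q : XT))).
  move=> mf.
  have h1 : measurable_fun setT (fun q : borel (Lip cX) * (borel XT * borel XT) => q.1).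
    exact: measurable_fst.
  have h2 := measurable_fun_pair h1 (measurableT_comp (mi i) mf).
  exact: (measurableT_comp (@measurable_eval R N X X0 cX) h2).
have m1 i := meval i (fun q => q.2.1) (measurableT_comp measurable_fst measurable_snd).
have m2 i := meval i (fun q => q.2.2) (measurableT_comp measurable_snd measurable_snd).
rewrite (_ : close_pairs delta = \bigcap_(i : 'I_k) [set p |
   `|(p.1 : Lip cX) (iter i T (p.2.1 : XT)) - (p.1 : Lip cX) (iter i T (p.2.2 : XT))| < delta]); last first.
  by apply/seteqP; split => p h i; [move=> _; exact: h|exact: (h i Logic.I)].
apply: fin_bigcap_measurable => // i _.
have md := measurableT_comp (@normr_measurable R setT) (measurable_funB (m1 i) (m2 i)).
rewrite -[X in measurable X]setTI.
have -> : [set p : borel (Lip cX) * (borel XT * borel XT) |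
   `|(p.1 : Lip cX) (iter i T (p.2.1 : XT)) - (p.1 : Lip cX) (iter i T (p.2.2 : XT))| < delta] =
   (@Num.norm R R \o (fun p : borel (Lip cX) * (borel XT * borel XT) =>
     (p.1 : Lip cX) (iter i T (p.2.1 : XT)) - (p.1 : Lip cX) (iter i T (p.2.2 : XT)))) @^-1`
     `]-oo, delta[%classic.
  by apply/seteqP; split => p /=; rewrite in_itv.
by apply: md => //; exact: measurable_itv.
Qed.

Lemma sup_attained (w : 'rV[R]_N) : 0 < `|w| -> exists c, `|w| <= `|w 0 c|.
Proof.
move=> w0; apply: contrapT => nc.
have : `|w| < `|w| by apply/norm_lt_coord => // c; rewrite ltNge; apply/negP => h; apply: nc; exists c.
by rewrite ltxx.
Qed.

Definition gpoly_indices := index_enum ({ffun 'I_k -> option (option 'I_N)} : finType).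

Variables (Q : {set 'I_k}) (p : 'I_k -> 'rV[R]_N) (m : R).
Variable A : 'I_k -> 'I_N -> {ffun 'I_k -> option (option 'I_N)} -> R.
Hypothesis k0 : (0 < k)%N.
Hypothesis dirA : forall i i' c, i \in Q -> i' \in Q ->
   forall u v, X u -> X v -> `|u - p i'| < m -> `|v - p i'| < m ->
    `|\sum_sg A i c sg * gpoly sg u - \sum_sg A i c sg * gpoly sg v - (i == i')%:R * (u - v) 0 c|
     <= (2 * k%:R)^-1 * `|u - v|.

Lemma coef_bound : exists2 b : R, 0 <= b & forall i c sg, `|A i c sg| <= b.
Proof.
exists (\sum_(t : 'I_k * 'I_N * {ffun 'I_k -> option (option 'I_N)}) `|A t.1.1 t.1.2 t.2|).
  by apply: sumr_ge0.
move=> i c sg; rewrite (bigD1 (i, c, sg))//= lerDl.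
by apply: sumr_ge0.
Qed.

(** The linear map tau |-> (sum_z tau_z (P_z (T^i x) - P_z (T^i y)))_i is
    close to a diagonal one: in row i the diagonal entry has modulus
    |T^i x - T^i y|, and every entry is known up to 1/(2k) times that. *)
Lemma diagonal_dominance (x y : X) (c : 'I_k -> 'I_N) (tau : 'I_k -> R) (D delta L : R) :
  0 < D -> 0 < L ->
  (forall i : 'I_k, i \in Q -> `|orbit_pt i x - p i| < m /\ `|orbit_pt i y - p i| < m) ->
  (forall i : 'I_k, D <= L * `|orbit_pt i x - orbit_pt i y|) ->
  (forall i : 'I_k, `|orbit_pt i x - orbit_pt i y| <= `|(orbit_pt i x - orbit_pt i y) 0 (c i)|) ->
  (forall i : 'I_k, `|\sum_(z in Q) tau z *
      (\sum_sg A z (c z) sg * gpoly sg (orbit_pt i x) - \sum_sg A z (c z) sg * gpoly sg (orbit_pt i y))| <= delta) ->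
  forall i, i \in Q -> `|tau i| <= 2 * L * delta / D.
Proof.
move=> D0 L0 xyp DL cP H i0 i0Q.
have [i iQ imax] : exists2 i, i \in Q & forall z, z \in Q -> `|tau z| <= `|tau i|.
  case: (@Order.TotalTheory.arg_maxP _ _ _ i0 (mem Q) (fun z => `|tau z|) i0Q) => i iQ h.
  by exists i => // z zQ; exact: h.
apply: (le_trans (imax _ i0Q)).
have [xi yi] := xyp i iQ.
set w := orbit_pt i x - orbit_pt i y.
have w0 : 0 < `|w| by have := lt_le_trans D0 (DL i); rewrite pmulr_rgt0.
have kp : 0 < k%:R :> R by rewrite ltr0n.
pose E z := \sum_sg A z (c z) sg * gpoly sg (orbit_pt i x) - \sum_sg A z (c z) sg * gpoly sg (orbit_pt i y).
have EP z : z \in Q -> `|E z - (z == i)%:R * w 0 (c z)| <= (2 * k%:R)^-1 * `|w|.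
  by move=> zQ; apply: dirA => //; exact: orbit_pt_in.
(* row i of the linear map, for i with |tau i| maximal, solved for its diagonal term *)
have eq1 : tau i * w 0 (c i) = \sum_(z in Q) tau z * E z -
     \sum_(z in Q) tau z * (E z - (z == i)%:R * w 0 (c z)).
  rewrite -sumrB (bigD1 i)//= eqxx mul1r big1 ?addr0; first by ring.
  by move=> z /andP[_ /negbTE ->]; rewrite mul0r; ring.
have err : `|\sum_(z in Q) tau z * (E z - (z == i)%:R * w 0 (c z))| <= `|tau i| * `|w| / 2.
  apply: (le_trans (ler_norm_sum _ _ _)).
  apply: (@le_trans _ _ (\sum_(z in Q) `|tau i| * ((2 * k%:R)^-1 * `|w|))).
    by apply: ler_sum => z zQ; rewrite normrM ler_pM ?imax ?EP.
  rewrite sumr_const -[_ *+ #|_|]mulr_natl.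
  apply: (@le_trans _ _ (k%:R * (`|tau i| * ((2 * k%:R)^-1 * `|w|)))).
    rewrite ler_wpM2r ?mulr_ge0 ?invr_ge0//.
    by rewrite ler_nat -[leqRHS](card_ord k) max_card.
  by rewrite le_eqVlt; apply/orP; left; apply/eqP; field; rewrite gt_eqF.
have main : `|tau i| * `|w| <= delta + `|tau i| * `|w| / 2.
  apply: (@le_trans _ _ (`|tau i * w 0 (c i)|)); first by rewrite normrM ler_wpM2l// cP.
  rewrite eq1; apply: (le_trans (ler_normB _ _)); apply: lerD => //; exact: H.
rewrite ler_pdivlMr//; apply: (@le_trans _ _ (`|tau i| * (L * `|w|))); first by rewrite ler_wpM2l// DL.
rewrite mulrCA [2 * L]mulrC -mulrA ler_pM2l//; lra.
Qed.

(** Transversality.  The points of x and y with index in Q must lie near the same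
    centres for the same directions to serve both, which is why the space will be
    cut into pieces. *)
Lemma pair_bound (L : R) : 0 < L ->
  (forall (x y : X) (i : 'I_k), `|orbit_pt k.-1 x - orbit_pt k.-1 y| <= L * `|orbit_pt i x - orbit_pt i y|) ->
  exists2 K : R, 0 <= K & forall (x y : XT) (D delta : R) v,
    D = `|orbit_pt k.-1 x - orbit_pt k.-1 y| -> 0 < D -> 0 < delta ->
    (forall i : 'I_k, i \in Q -> `|orbit_pt i x - p i| < m /\ `|orbit_pt i y - p i| < m) ->
    (iterint (lip_gpoly cX (k := k)) (window 1) gpoly_indices
      (fun h => (\1_(close_pairs delta) ((h : borel (Lip cX)), ((x : borel XT), (y : borel XT))))%:E) v
     <= (K * (delta / D) ^+ #|Q|)%:E)%E.
Proof.
move=> L0 piL; have [b b0 Ab] := coef_bound.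
(* cubes of side 2 (4 L delta / D), times the volume of the enlarged box *)
exists ((8 * L) ^+ #|Q| * (2 * (1 + b *+ #|Q|)) ^+ size gpoly_indices).
  by rewrite mulr_ge0// exprn_ge0// mulr_ge0 ?addr_ge0 ?mulrn_wge0// ltW.
move=> x y D delta v DE D0 delta0 xyp.
have DL (i : 'I_k) : D <= L * `|orbit_pt i x - orbit_pt i y| by rewrite DE.
have wi (i : 'I_k) : 0 < `|orbit_pt i x - orbit_pt i y| by have := lt_le_trans D0 (DL i); rewrite pmulr_rgt0.
have /choice[c cP] := fun i : 'I_k => sup_attained (wi i).
pose g2 (z : 'I_k) : Lip cX := \sum_sg A z (c z) sg *: lip_gpoly cX sg.
pose F (h : Lip cX) : \bar R := (\1_(close_pairs delta) ((h : borel (Lip cX)), ((x : borel XT), (y : borel XT))))%:E.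
have mF : measurable_fun setT (F : borel (Lip cX) -> \bar R).
  apply/measurable_EFinP.
  have k1 : measurable_fun setT (fun h : borel (Lip cX) => (h, ((x : borel XT), (y : borel XT)))).
    by apply/measurable_fun_pairP; split; [exact: measurable_id|exact: measurable_cst].
  apply: (measurableT_comp _ k1); apply: measurable_indic; exact: measurable_close_pairs.
have F0 h : (0 <= F h)%E by rewrite lee_fin indicE ler0n.
have F1 h : (F h <= 1)%E by rewrite lee_fin indicE lern1 leq_b1.
have r10 : 0 <= 1 + b *+ #|Q| by rewrite addr_ge0// mulrn_wge0.
apply: (le_trans (@iterint_average R _ _ _ (lip_gpoly cX (k := k)) g2 1 b gpoly_indices (enum Q) (fun z => A z (c z)) F v mF F0 _ _)) => //.
rewrite -cardE.
have rho0 : 0 <= 4 * L * delta / D by rewrite divr_ge0 ?mulr_ge0// ltW.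
apply: (@le_trans _ _ (iterint (lip_gpoly cX (k := k)) (window (1 + b *+ #|Q|)) gpoly_indices
    (fun=> ((2 * (4 * L * delta / D)) ^+ #|Q|)%:E) v)); last first.
  rewrite iterint_cst//; last by rewrite exprn_ge0// mulr_ge0.
  rewrite lee_fin le_eqVlt; apply/orP; left; apply/eqP.
  rewrite [RHS]mulrAC -[(8 * L) ^+ _ * _]exprMn; congr (_ ^+ _ * _); field.
  by rewrite gt_eqF.
have mI : measurable_fun setT (iterint g2 window01 (enum Q) F : borel (Lip cX) -> \bar R).
  by apply: measurable_iterint => //; first [exact: measurable_window01|exact: window01_ge0].
apply: iterint_le => //; first exact: measurable_window.
  by move=> u; apply: iterint_ge0 => // a; exact: window01_ge0.
move=> e; rewrite [X in (2 * _) ^+ X]cardE; apply: iterint_small => //; first exact: enum_uniq.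
move=> c1 c2 h1 h2 z; rewrite mem_enum => zQ.
have Fn0 h : F h != 0%E -> forall i : 'I_k, `|h (iter i T x) - h (iter i T y)| < delta.
  rewrite /F indicE; case: (boolP (_ \in _)); last by rewrite eqxx.
  by rewrite inE => hh _; exact: hh.
have := @diagonal_dominance x y c (fun z => c1 z - c2 z) D (2 * delta) L D0 L0 xyp DL cP _ z zQ.
have -> : 2 * L * (2 * delta) / D = 4 * L * delta / D by ring.
apply => i.
have hev (cc : 'I_k -> R) (u : X) : (e + \sum_(z <- enum Q) cc z *: g2 z) u =
   e u + \sum_(z in Q) cc z * \sum_sg A z (c z) sg * gpoly sg (set_val u).
  rewrite lip_evalD lip_eval_sum big_enum_cond /=; congr (_ + _).
  apply: eq_big => [?|z' _]; first by rewrite andbT.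
  rewrite -[LHS]/(cc z' * g2 z' u); congr (_ * _).
  by rewrite lip_eval_sum; apply: eq_bigr.
have H1 := Fn0 _ h1 i; have H2 := Fn0 _ h2 i.
rewrite !hev in H1 H2.
have -> : \sum_(z in Q) (c1 z - c2 z) *
   (\sum_sg A z (c z) sg * gpoly sg (orbit_pt i x) - \sum_sg A z (c z) sg * gpoly sg (orbit_pt i y)) =
   (e (iter i T x) + \sum_(z in Q) c1 z * (\sum_sg A z (c z) sg * gpoly sg (orbit_pt i x))
    - (e (iter i T y) + \sum_(z in Q) c1 z * (\sum_sg A z (c z) sg * gpoly sg (orbit_pt i y)))) -
   (e (iter i T x) + \sum_(z in Q) c2 z * (\sum_sg A z (c z) sg * gpoly sg (orbit_pt i x))
    - (e (iter i T y) + \sum_(z in Q) c2 z * (\sum_sg A z (c z) sg * gpoly sg (orbit_pt i y)))).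
  rewrite (eq_bigr (fun z => (c1 z * (\sum_sg A z (c z) sg * gpoly sg (orbit_pt i x)) -
      c1 z * (\sum_sg A z (c z) sg * gpoly sg (orbit_pt i y))) -
     (c2 z * (\sum_sg A z (c z) sg * gpoly sg (orbit_pt i x)) -
      c2 z * (\sum_sg A z (c z) sg * gpoly sg (orbit_pt i y))))); last by move=> z' _; ring.
  by rewrite !sumrB; ring.
apply: (le_trans (ler_normB _ _)).
have -> : 2 * delta = delta + delta by ring.
by apply: lerD; apply: ltW; [exact: H1|exact: H2].
Qed.

End pairs.

(** * Riesz energies *)

Section riesz.
Context {R : realType} {N : nat} d {Y : measurableType d} (mu : probability Y R).
Variable pi : Y -> borel 'rV[R]_N.
Hypothesis mpi : measurable_fun setT pi.

Definition dist_pi (x y : Y) : R := `|(pi x : 'rV[R]_N) - (pi y : 'rV[R]_N)|.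

Lemma measurable_dist_pi : measurable_fun setT (fun p : Y * Y => dist_pi p.1 p.2).
Proof.
apply: (measurability _ (RGenCInfty.measurableE R)) => _ [_ [r ->] <-].
rewrite setTI.
have h1 : measurable_fun setT (fun p : Y * Y => (pi p.1, p.2)).
  have m1 : measurable_fun setT (fun p : Y * Y => p.1) by exact: measurable_fst.
  exact: (measurable_fun_pair (measurableT_comp mpi m1) measurable_snd).
rewrite (_ : _ @^-1` _ = ~` ((fun p : Y * Y => (pi p.1, p.2)) @^-1`
    [set q : borel 'rV[R]_N * Y | setT q.2 /\ near_pi pi q.1 r q.2])); last first.
  apply/seteqP; split => p /=; rewrite in_itv /= andbT.
    by move=> rp [_]; rewrite /near_pi /= ltNge -/(dist_pi _ _) rp.
  by move=> h; rewrite leNgt; apply/negP => h'; apply: h; split.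
apply: measurableC; rewrite -[X in measurable X]setTI; apply: h1 => //.
exact: measurable_near_pi2.
Qed.

Lemma half_powR_lt1 (s : R) : 0 < s -> 2^-1 `^ s < (1 : R).
Proof.
move=> s0; rewrite /powR; have -> : (2^-1 : R) == 0 = false by rewrite invr_eq0 pnatr_eq0.
have l2 : ln (2^-1 : R) < 0 by rewrite lnV ?posrE// oppr_lt0 ln_gt0// ltr1n.
by rewrite -[ltRHS]expR0 ltr_expR pmulr_rlt0.
Qed.

(** Dyadic scale of a number in ]0, 1[. *)
Lemma rho_bracket (D : R) : 0 < D -> D < 1 -> exists l, rho R l.+1 <= D /\ D < rho R l.
Proof.
move=> D0 D1.
have half1 : (2^-1 : R) < 1 by rewrite invf_lt1// ltr1n.
have half0 : 0 <= (2^-1 : R) by rewrite invr_ge0.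
pose P l := rho R l.+1 <= D.
have exP : exists l, P l.
  by have [l0 Hl] := expr_small half0 half1 D0; exists l0; apply: Hl.
case: (ex_minnP exP) => l Pl lmin; exists l; split => //.
case: l Pl lmin => [_ _|l _ lmin]; first by rewrite /rho expr0.
by rewrite ltNge; apply/negP => h; have := lmin l h; rewrite ltnn.
Qed.

Variables (H : set Y) (s u : R) (C : nat).
Hypotheses (mH : measurable H) (u0 : 0 < u) (us : u < s).
Hypothesis HC : forall x, H x -> forall n,
  pr mu (H `&` near_pi pi (pi x) (rho R n)) <= C%:R * (2^-1 `^ s) ^+ n.

Let a : R := 2^-1 `^ (- u).
Let a0 : 0 <= a. Proof. exact: powR_ge0. Qed.

Let th_lt1 : a * 2^-1 `^ s < 1.
Proof.
rewrite /a -powRD; last by rewrite invr_eq0 pnatr_eq0 implybT.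
by apply: half_powR_lt1; rewrite addrC subr_gt0.
Qed.

(** Dyadic decomposition of the kernel: the shell at scale 2^-l contributes at most
    a constant times 2^(u l) 2^(-s l). *)
Lemma riesz_energy : exists2 M : R, 0 <= M & forall x, H x ->
  (\int[mu]_y ((\1_H y * dist_pi x y `^ (- u))%:E) <= M%:E)%E.
Proof.
exists (1 + a * C%:R / (1 - a * 2^-1 `^ s)) => [|x Hx].
  by rewrite addr_ge0// divr_ge0 ?mulr_ge0// subr_ge0 ltW.
pose G l (y : Y) : \bar R := ((a ^+ l.+1)%:E * (\1_(H `&` near_pi pi (pi x) (rho R l)) y)%:E)%E.
have mHn l : measurable (H `&` near_pi pi (pi x) (rho R l)).
  by apply: measurableI => //; exact: measurable_near_pi.
have mG l : measurable_fun setT (G l).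
  by apply: emeasurable_funM; [exact: measurable_cst|apply/measurable_EFinP; exact: measurable_indic].
have G0 l y : (0 <= G l y)%E by rewrite mule_ge0 ?lee_fin ?exprn_ge0// indicE ler0n.
have mD : measurable_fun setT (fun y => dist_pi x y).
  have k : measurable_fun setT (fun y : Y => (x, y)) by apply: measurable_fun_pair.
  exact: (measurableT_comp measurable_dist_pi k).
apply: (@le_trans _ _ (\int[mu]_y (1 + \sum_(0 <= l <oo) G l y))%E).
  apply: ge0_le_integral => //.
  - by move=> y _; rewrite lee_fin mulr_ge0 ?powR_ge0// indicE ler0n.
  - apply/measurable_EFinP; apply: measurable_funM; first exact: measurable_indic.
    exact: (measurableT_comp (measurable_powR _) mD).
  - by apply: emeasurable_funD; [exact: measurable_cst|exact: ge0_emeasurable_sum].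
  move=> y _.
  have S0 : (0 <= \sum_(l <oo) G l y)%E by apply: nneseries_ge0.
  rewrite indicE; case: (boolP (y \in H)) => Hy /=; last by rewrite mul0r adde_ge0.
  rewrite mul1r; move: Hy; rewrite inE => Hy.
  have := normr_ge0 ((pi x : 'rV[R]_N) - (pi y : 'rV[R]_N)); rewrite -/(dist_pi x y) le_eqVlt => /predU1P[<-|D0].
    by rewrite powR0 ?oppr_eq0 ?gt_eqF// adde_ge0.
  have [D1|D1] := ltP (dist_pi x y) 1; last first.
    apply: (@le_trans _ _ 1%E); last by rewrite leeDl.
    rewrite lee_fin powRN invf_le1 ?powR_gt0//.
    by have := ge0_ler_powR (ltW u0); move=> /(_ 1 (dist_pi x y)); rewrite powR1; apply; rewrite ?nnegrE// ltW.
  have [l [l1 l2]] := rho_bracket D0 D1.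
  apply: (@le_trans _ _ (G l y)).
    rewrite /G indicE mem_set//= mule1 lee_fin /a -rho_powR !powRN lef_pV2 ?posrE ?powR_gt0 ?rho_gt0//.
    by apply: (ge0_ler_powR (ltW u0)) => //; rewrite nnegrE ltW// rho_gt0.
  rewrite (@nneseriesD1 R _ l)//.
  apply: (@le_trans _ _ (G l y + \sum_(0 <= k0 <oo | k0 != l) G k0 y)%E).
    by rewrite leeDl// nneseries_ge0.
  by rewrite leeDr.
rewrite ge0_integralD//; last 2 first.
- by move=> y _; exact: nneseries_ge0.
- exact: ge0_emeasurable_sum.
have -> : (\int[mu]_y 1 = 1 :> \bar R)%E.
  rewrite (integral_cst mu measurableT 1) mul1e; exact: probability_setT.
rewrite EFinD leeD2l//.
rewrite integral_nneseries//.
apply: (@le_trans _ _ (\sum_(0 <= l <oo) (a * C%:R * (a * 2^-1 `^ s) ^+ l)%:E)%E).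
  apply: lee_nneseries => [l _ _|l _]; first exact: integral_ge0.
  have m1 : measurable_fun setT (fun y => (\1_(H `&` near_pi pi (pi x) (rho R l)) y)%:E : \bar R).
    by apply/measurable_EFinP; exact: measurable_indic.
  have p1 y : (0 <= (\1_(H `&` near_pi pi (pi x) (rho R l)) y)%:E :> \bar R)%E by rewrite lee_fin indicE ler0n.
  have p2 : (0 <= (a ^+ l.+1)%:E)%E by rewrite lee_fin exprn_ge0.
  rewrite ge0_integralZl//.
  rewrite integral_indic // setIT [X in (_ * X)%E](_ : _ = (pr mu (H `&` near_pi pi (pi x) (rho R l)))%:E); last exact: prE.
  rewrite -EFinM lee_fin.
  apply: (@le_trans _ _ (a ^+ l.+1 * (C%:R * (2^-1 `^ s) ^+ l))).
    by rewrite ler_wpM2l ?exprn_ge0// HC.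
  by rewrite le_eqVlt; apply/orP; left; apply/eqP; rewrite exprS exprMn; ring.
apply: geo_series_le => //; first by rewrite mulr_ge0.
by rewrite mulr_ge0 ?powR_ge0.
Qed.

End riesz.

(** * The expected energy of a piece *)

Section piece.
Context {R : realType} {N : nat} {X : set 'rV[R]_N} (cX : compact X) (X0 : X !=set0).
Notation XT := (psubspace X0).
Variables (mu : probability (borel XT) R) (T : X -> X) (k : nat).
Hypotheses (lipT : lipschitz_self_map T) (k0 : (0 < k)%N).

Definition last_pt (x : borel XT) : borel 'rV[R]_N := orbit_pt T k.-1 x.

Lemma measurable_last_pt : measurable_fun setT last_pt.
Proof. exact: orbit_pt_measurable. Qed.

Variables (H : set (borel XT)) (Q : {set 'I_k}) (p : 'I_k -> 'rV[R]_N) (m : R).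
Variable A : 'I_k -> 'I_N -> {ffun 'I_k -> option (option 'I_N)} -> R.
Hypothesis dirA : forall i i' c, i \in Q -> i' \in Q ->
   forall u v, X u -> X v -> `|u - p i'| < m -> `|v - p i'| < m ->
    `|\sum_sg A i c sg * gpoly sg u - \sum_sg A i c sg * gpoly sg v - (i == i')%:R * (u - v) 0 c|
     <= (2 * k%:R)^-1 * `|u - v|.
Hypothesis mH : measurable H.
Hypothesis HQ : forall x, H x -> forall i : 'I_k, i \in Q -> `|orbit_pt T i x - p i| < m.
Variables (s t : R) (C : nat).
Hypotheses (t0 : 0 < t) (ts : t + #|Q|%:R < s).
Hypothesis HC : forall x, H x -> forall n,
  pr mu (H `&` near_pi last_pt (last_pt x) (rho R n)) <= C%:R * (2^-1 `^ s) ^+ n.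

(** Since 0 to a nonzero power is 0, pairs with the same image under pi get weight 0;
    they are negligible by the ball bounds. *)
Definition weight n (z : borel XT * borel XT) : R :=
  \1_H z.1 * \1_H z.2 * (inv_succ R n ^+ #|Q|)^-1 * dist_pi last_pt z.1 z.2 `^ (- t).

Definition integrand n (q : borel (Lip cX) * (borel XT * borel XT)) : \bar R :=
  ((weight n q.2)%:E * (\1_(close_pairs (cX := cX) (X0 := X0) T k (inv_succ R n)) q)%:E)%E.

Let mu2 : probability (borel XT * borel XT)%type R := (mu \x mu)%E.

Definition energy n (h : Lip cX) : \bar R :=
  (\int[mu2]_z integrand n ((h : borel (Lip cX)), z))%E.

Let mHx1 : measurable_fun setT (fun z : borel XT * borel XT => \1_H z.1 : R).
Proof. by apply: (measurableT_comp _ measurable_fst); exact: measurable_indic. Qed.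

Let mHx2 : measurable_fun setT (fun z : borel XT * borel XT => \1_H z.2 : R).
Proof. by apply: (measurableT_comp _ measurable_snd); exact: measurable_indic. Qed.

Let mdist r : measurable_fun setT (fun z : borel XT * borel XT => dist_pi last_pt z.1 z.2 `^ r).
Proof. exact: (measurableT_comp (measurable_powR r) (measurable_dist_pi measurable_last_pt)). Qed.

Lemma weight_ge0 n z : 0 <= weight n z.
Proof.
by rewrite /weight !mulr_ge0 ?powR_ge0// ?indicE ?ler0n// invr_ge0 exprn_ge0// ltW// inv_succ_gt0.
Qed.

Lemma measurable_weight n : measurable_fun setT (weight n).
Proof.
apply: measurable_funM => //; apply: measurable_funM => //.
exact: measurable_funM.
Qed.

Lemma integrand_ge0 n q : (0 <= integrand n q)%E.
Proof. by rewrite mule_ge0 ?lee_fin ?weight_ge0// indicE ler0n. Qed.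

Lemma measurable_close n :
  measurable_fun setT (fun q => (\1_(close_pairs (cX := cX) (X0 := X0) T k (inv_succ R n)) q)%:E : \bar R).
Proof.
apply/measurable_EFinP; apply: measurable_indic; exact: measurable_close_pairs.
Qed.

Lemma measurable_integrand n : measurable_fun setT (integrand n).
Proof.
apply: emeasurable_funM; last exact: measurable_close.
by apply/measurable_EFinP; exact: (measurableT_comp (measurable_weight n) measurable_snd).
Qed.

(** Tonelli reduces the mean energy to the mean for a single pair, that is to
    [pair_bound], and then to the Riesz energy of exponent t + q. *)
Lemma energy_bound : exists E0 : R, forall n v,
  (iterint (lip_gpoly cX (k := k)) (window 1) (gpoly_indices (N := N) k) (energy n) v <= E0%:E)%E.
Proof.
have [L L0 piL] := @lip_consts_iter R N X T k lipT.
have piL' (x y : X) (i : 'I_k) : `|orbit_pt T k.-1 x - orbit_pt T k.-1 y| <= L * `|orbit_pt T i x - orbit_pt T i y|.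
  by apply: piL; rewrite leq_pred andbT -ltnS prednK.
have [K K0 KP] := @pair_bound R N X cX X0 T k lipT Q p m A k0 dirA L L0 piL'.
have u0 : 0 < t + #|Q|%:R by rewrite ltr_wpDr.
have [M M0 MP] := riesz_energy measurable_last_pt mH u0 ts HC.
exists (K * M) => n v.
have w0 := @window_ge0 R 1; have mw := @measurable_window R 1.
rewrite (iterint_tonelli (lip_gpoly cX (k := k)) mw w0 mu2 (gpoly_indices (N := N) k) v
  (measurable_integrand n) (integrand_ge0 n)).
pose G (z : borel XT * borel XT) : \bar R :=
  (K%:E * ((\1_H z.1)%:E * (\1_H z.2 * dist_pi last_pt z.1 z.2 `^ (- (t + #|Q|%:R)))%:E))%E.
have mG1 : measurable_fun setT (fun z : borel XT * borel XT =>
    (\1_H z.2 * dist_pi last_pt z.1 z.2 `^ (- (t + #|Q|%:R)))%:E : \bar R).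
  by apply/measurable_EFinP; exact: measurable_funM.
have G10 (z : borel XT * borel XT) : (0 <= (\1_H z.2 * dist_pi last_pt z.1 z.2 `^ (- (t + #|Q|%:R)))%:E :> \bar R)%E.
  by rewrite lee_fin mulr_ge0 ?powR_ge0// indicE ler0n.
have mG : measurable_fun setT G.
  apply: emeasurable_funM; first exact: measurable_cst.
  by apply: emeasurable_funM => //; exact/measurable_EFinP.
have G0 z : (0 <= G z)%E.
  apply: mule_ge0; first by rewrite lee_fin.
  by apply: mule_ge0 => //; rewrite lee_fin indicE ler0n.
apply: (@le_trans _ _ (\int[mu2]_z G z)%E).
  apply: ge0_le_integral => //.
  - by move=> z _; apply: iterint_ge0 => // h; exact: integrand_ge0.
  - have h := measurable_iterint2 (lip_gpoly cX (k := k)) mw w0 (gpoly_indices (N := N) k) (measurable_integrand n) (integrand_ge0 n).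
    have k1 : measurable_fun setT (fun z : borel XT * borel XT => ((v : borel (Lip cX)), z)).
      by apply: measurable_fun_pair; [exact: measurable_cst|exact: measurable_id].
    exact: (measurableT_comp h k1).
  move=> [x y] _.
  have mc : measurable_fun setT (fun h : borel (Lip cX) =>
     (\1_(close_pairs (cX := cX) (X0 := X0) T k (inv_succ R n)) (h, (x, y)))%:E : \bar R).
    have k1 : measurable_fun setT (fun h : borel (Lip cX) => (h, (x, y))).
      by apply: measurable_fun_pair; [exact: measurable_id|exact: measurable_cst].
    exact: (measurableT_comp (measurable_close n) k1).
  have -> : iterint (lip_gpoly cX (k := k)) (window 1) (gpoly_indices (N := N) k) (fun e => integrand n (e, (x, y))) v =
     ((weight n (x, y))%:E * iterint (lip_gpoly cX (k := k)) (window 1) (gpoly_indices (N := N) k)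
       (fun h : Lip cX => (\1_(close_pairs (cX := cX) (X0 := X0) T k (inv_succ R n))
         ((h : borel (Lip cX)), (x, y)))%:E) v)%E.
    have p1 (h : Lip cX) : (0 <= (\1_(close_pairs (cX := cX) (X0 := X0) T k (inv_succ R n))
         ((h : borel (Lip cX)), (x, y)))%:E :> \bar R)%E by rewrite lee_fin indicE ler0n.
    have p2 : (0 <= (weight n (x, y))%:E)%E by rewrite lee_fin weight_ge0.
    by rewrite -(iterintZ (lip_gpoly cX (k := k)) mw w0 (gpoly_indices (N := N) k) v mc p1 p2).
  rewrite /G /weight /= !indicE.
  case: (boolP (x \in H)) => [|_]; last by rewrite !mul0r mul0e mule_ge0// mul0e.
  case: (boolP (y \in H)) => [|_]; last by rewrite mulr0 !mul0r mul0e mule0 mule0.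
  rewrite !inE => Hy Hx; rewrite !mul1r mul1e.
  have := normr_ge0 ((last_pt x : 'rV[R]_N) - (last_pt y : 'rV[R]_N)).
  rewrite -/(dist_pi last_pt x y) le_eqVlt => /predU1P[<-|D0].
    by rewrite !powR0 ?oppr_eq0 ?gt_eqF// mulr0 mul0e mule0.
  have := KP x y (dist_pi last_pt x y) (inv_succ R n) v erefl D0 (inv_succ_gt0 R n)
    (fun i iQ => conj (HQ Hx iQ) (HQ Hy iQ)).
  move=> h; apply: (@le_trans _ _ (((inv_succ R n ^+ #|Q|)^-1 * dist_pi last_pt x y `^ (- t))%:E *
      (K * (inv_succ R n / dist_pi last_pt x y) ^+ #|Q|)%:E)%E).
    by rewrite lee_wpmul2l// lee_fin mulr_ge0 ?powR_ge0// invr_ge0 exprn_ge0// ltW// inv_succ_gt0.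
  rewrite -!EFinM lee_fin opprD powRD; last by rewrite (gt_eqF D0) implybT.
  rewrite [_ `^ (- #|Q|%:R)]powRN powR_mulrn ?(ltW D0)// expr_div_n.
  rewrite le_eqVlt; apply/orP; left; apply/eqP; field.
  by rewrite !expf_neq0// gt_eqF// inv_succ_gt0.
have -> : (\int[mu2]_z G z = \int[mu]_x fubini_F mu G x)%E by exact: fubini_tonelli1.
apply: (@le_trans _ _ (\int[mu]_x (K * M)%:E)%E); last first.
  rewrite (integral_cst mu measurableT (K * M)%:E) -[leRHS]mule1.
  by rewrite le_eqVlt; apply/orP; left; apply/eqP; congr (_ * _)%E; exact: probability_setT.
apply: ge0_le_integral => //.
- by move=> x _; exact: integral_ge0.
- exact: measurable_fun_fubini_tonelli_F.
move=> x _; rewrite /fubini_F /G /=.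
have mG1x : measurable_fun setT (fun y : borel XT => (\1_H y * dist_pi last_pt x y `^ (- (t + #|Q|%:R)))%:E : \bar R).
  have k1 : measurable_fun setT (fun y : borel XT => (x, y)).
    by apply: measurable_fun_pair; [exact: measurable_cst|exact: measurable_id].
  exact: (measurableT_comp mG1 k1).
have G1x0 (y : borel XT) : (0 <= (\1_H y * dist_pi last_pt x y `^ (- (t + #|Q|%:R)))%:E :> \bar R)%E.
  exact: (G10 (x, y)).
have [Hx|Hx] := boolP (x \in H); last first.
  rewrite indicE (negbTE Hx) integral0_eq ?lee_fin; last 1 first.
  - by move=> y _; rewrite mul0e mule0.
  - by rewrite mulr_ge0.
rewrite indicE Hx.
under eq_integral do rewrite mul1e.
rewrite ge0_integralZl// EFinM lee_wpmul2l// MP//.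
by move: Hx; rewrite inE.
Qed.

Lemma measurable_energy n : measurable_fun setT (energy n : borel (Lip cX) -> \bar R).
Proof.
have h := @measurable_fun_fubini_tonelli_F _ _ (borel (Lip cX)) (borel XT * borel XT)%type R mu2
  (integrand n) (measurable_integrand n).
exact: h (integrand_ge0 n).
Qed.

Lemma piece_energy : measurable (finite_liminf energy) /\
  forall v, iterint (lip_gpoly cX (k := k)) (window 1) (gpoly_indices (N := N) k)
     (fun u => (\1_(~` finite_liminf energy) u)%:E) v = 0.
Proof.
have [E0 E0P] := energy_bound.
apply: (iterint_finite_liminf (C := E0)) => [n|n v|n v].
- exact: measurable_energy.
- by apply: integral_ge0 => z _; exact: integrand_ge0.
- exact: E0P.
Qed.

End piece.

(** * Points in balls of substantial mass *)

(** A Borel-Cantelli argument: points that leave G j n for all large n have mass at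
    most C1 / (j + 1), for each j. *)
Lemma frequently_good (R : realType) d (Y : measurableType d) (mu : probability Y R)
  (H : set Y) (G : nat -> nat -> set Y) (C1 : R) : measurable H ->
  (forall j n, measurable (G j n)) ->
  (forall j n0, exists2 n, (n0 <= n)%N & pr mu (H `\` G j n) <= C1 / j.+1%:R) ->
  {ae mu, forall x, H x -> exists j, forall n0, exists2 n, (n0 <= n)%N & G j n x}.
Proof.
move=> mH mG HG; apply: negligible_small => e e0.
have [j Hj] : exists j : nat, C1 / j.+1%:R <= e.
  exists (Num.truncn (`|C1| / e)); rewrite ler_pdivrMr ?ltr0n//.
  apply: (le_trans (ler_norm _)); rewrite -ler_pdivrMl// mulrC ltW//.
  exact: truncnS_gt.
pose F n0 := \bigcap_(n in [set n | (n0 <= n)%N]) (H `\` G j n).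
have mF n0 : measurable (F n0).
  by apply: bigcap_measurable; [exists n0; exact: leqnn|move=> n _; exact: measurableD].
exists (\bigcup_n F n); split; first exact: bigcupT_measurable.
- move=> x /= /not_implyP[Hx nex].
  apply: contrapT => nF; apply: nex; exists j => n0.
  apply: contrapT => nn; apply: nF; exists n0 => // n /= nn0; split => // Gx.
  by apply: nn; exists n.
apply: measure_bigcup_le => // [n m nm x Fx i /= mi|n0]; first by apply: Fx; exact: leq_trans mi.
have [n nn0 Hn] := HG j n0.
apply: (@le_trans _ _ (mu (H `\` G j n))).
  apply: le_measure; rewrite ?inE//; first exact: measurableD.
  by move=> x; apply.
rewrite prE; last exact: measurableD.
by rewrite lee_fin; exact: le_trans Hj.
Qed.

Section small_mass.
Context {R : realType} d {Y : measurableType d} (mu : probability Y R).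
Variables (k : nat) (phi : Y -> 'rV[R]_k) (M : R).
Hypothesis mphi : forall c, measurable_fun setT (fun y => phi y 0 c).
Hypotheses (M0 : 0 <= M) (phiM : forall y c, `|phi y 0 c| <= M).
Variables (H : set Y) (Q : {set 'I_k}) (r : 'I_k -> 'I_k).
Hypotheses (mH : measurable H) (rQ : forall i, r i \in Q).
Hypothesis Hr : forall x, H x -> forall i, phi x 0 i = phi x 0 (r i).

Definition thin (delta c : R) : set Y :=
  [set x | H x /\ pr mu (H `&` pball phi x delta) < c].

Lemma measurable_thin delta c : measurable (thin delta c).
Proof.
have mm := measurable_mu_pball mu mphi delta mH.
rewrite (_ : thin delta c = H `&` ((fun x => mu (H `&` pball phi x delta)) @^-1` `]-oo, c%:E[%classic)).
  by apply: measurableI => //; rewrite -[X in measurable X]setTI; apply: mm => //; exact: emeasurable_itv.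
apply/seteqP; split => x [Hx] /=; rewrite in_itv /= => h; split => //.
  by rewrite prE ?lte_fin//; apply: measurableI => //; exact: measurable_pball.
by move: h; rewrite prE ?lte_fin//; apply: measurableI => //; exact: measurable_pball.
Qed.

(** If a maximal family of points of the thin set is delta-separated in the
    coordinates of Q, it has at most C delta^-q members, and the balls about them
    cover the thin set.  On H the coordinates in Q determine all coordinates. *)
Lemma thin_le : exists2 C0 : R, 0 <= C0 & forall delta c, 0 < delta -> delta <= 1 -> 0 <= c ->
  pr mu (thin delta (c * delta ^+ #|Q|)) <= C0 * c.
Proof.
have kp : 0 < k.+1%:R :> R by rewrite ltr0n.
exists ((2 * M * k.+1%:R + 1) ^+ #|Q|) => [|delta c d0 d1 c0].
  by rewrite exprn_ge0// addr_ge0// !mulr_ge0.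
set Z := thin _ _.
pose f (x : Y) (i : 'I_#|Q|) := phi x 0 (enum_val i).
pose eta := delta / k.+1%:R.
have e0 : 0 < eta by rewrite divr_gt0.
pose sep (x y : Y) := [exists i, eta <= `|f x i - f y i|].
pose sz := ((2 * M) / eta + 1) ^+ #|Q|.
have szb (l : seq Y) : (forall x, x \in l -> Z x) -> pairwise sep l -> (size l)%:R <= sz.
  move=> _ lp; apply: (@separated_size_le R Y #|Q| f M eta l M0 e0) => // x _ i.
  exact: phiM.
have [|l [lZ lp lc]] := @maximal_separated Y Z sep (Num.truncn sz).
  move=> l lZ lp; have h := szb l lZ lp.
  by rewrite truncn_ge_nat// (le_trans _ h).
have mP (x : Y) : measurable (H `&` pball phi x delta).
  by apply: measurableI => //; exact: measurable_pball.
have Zsub : Z `<=` \big[setU/set0]_(x <- l) (H `&` pball phi x delta).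
  move=> z Zz; have [x xl nsep] := lc z Zz.
  rewrite -bigcup_seq; exists x => //; split; first by case: Zz.
  rewrite /pball /= ltNge; apply/negP => h.
  have [i] := enorm_coord_ge d0 h; rewrite !mxE -/eta => hi.
  move/negP: nsep; apply; apply/existsP; exists (enum_rank_in (rQ i) (r i)).
  rewrite /f enum_rankK_in//; case: Zz => Hz _; case: (lZ x xl) => Hx _.
  by rewrite -(Hr Hz) -(Hr Hx).
have sumle : pr mu (\big[setU/set0]_(x <- l) (H `&` pball phi x delta)) <=
    (size l)%:R * (c * delta ^+ #|Q|).
  elim: l lZ {lp lc Zsub} => [|x l ih] lZ.
    by rewrite big_nil /pr measure0 mul0r.
  rewrite big_cons; apply: (le_trans (prU_le _ (mP x) _)).
    by apply: bigsetU_measurable.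
  rewrite /= -natr1 mulrDl mul1r addrC; apply: lerD.
    by apply: ih => y yl; apply: lZ; rewrite in_cons yl orbT.
  by case: (lZ x (mem_head _ _)) => _ /ltW.
apply: (@le_trans _ _ (pr mu (\big[setU/set0]_(x <- l) (H `&` pball phi x delta)))).
  by apply: pr_le => //; [exact: measurable_thin|exact: bigsetU_measurable].
apply: (le_trans sumle).
apply: (@le_trans _ _ (sz * (c * delta ^+ #|Q|))).
  by rewrite ler_wpM2r ?szb// mulr_ge0// exprn_ge0// ltW.
rewrite mulrCA -exprMn mulrC ler_wpM2r// lerXn2r ?nnegrE//.
- by rewrite mulr_ge0 ?(ltW d0)// addr_ge0// divr_ge0 ?mulr_ge0// ltW.
- by rewrite addr_ge0// !mulr_ge0.
have -> : (2 * M / eta + 1) * delta = 2 * M * k.+1%:R + delta.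
  by rewrite /eta; field; rewrite !gt_eqF.
by rewrite lerD2l.
Qed.

End small_mass.

(** * Decay of relative masses *)

Lemma markov_bound (R : realType) d (Y : measurableType d) (mu : {measure set Y -> \bar R})
  (f : Y -> \bar R) (c : R) (E : set Y) : measurable_fun setT f -> (forall y, 0 <= f y)%E ->
  0 <= c -> measurable E -> (forall y, E y -> (c%:E <= f y)%E) ->
  (c%:E * mu E <= \int[mu]_y f y)%E.
Proof.
move=> mf f0 c0 mE cE.
have m1 : measurable_fun setT (fun y => (\1_E y)%:E : \bar R).
  by apply/measurable_EFinP; exact: measurable_indic.
have p1 y : (0 <= (\1_E y)%:E :> \bar R)%E by rewrite lee_fin indicE ler0n.
have -> : mu E = (\int[mu]_y (\1_E y)%:E)%E by rewrite integral_indic// setIT.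
rewrite -ge0_integralZl//.
apply: ge0_le_integral => //.
- by move=> y _; apply: mule_ge0.
- by apply: emeasurable_funM => //; exact: measurable_cst.
move=> y _; rewrite indicE; case: (boolP (y \in E)) => Ey; last by rewrite mule0.
by rewrite mule1; apply: cE; move: Ey; rewrite inE.
Qed.

Section good.
Context {R : realType} {N : nat} {X : set 'rV[R]_N} (cX : compact X) (X0 : X !=set0).
Notation XT := (psubspace X0).
Variables (mu : probability (borel XT) R) (T : X -> X) (k : nat).
Hypotheses (lipT : lipschitz_self_map T).
Notation last_pt := (@last_pt R N X X0 T k).

Lemma delay_continuous (h : Lip cX) : continuous (delay_map k T h : XT -> 'rV[R]_k).
Proof.
move=> x; have FF : Filter (nbhs (x : XT)) by exact: nbhs_filter.
apply/cvgrPdist_lt => e e0.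
have := @filter_forall XT 'I_k (fun i : 'I_k => [set y : XT | `|h (iter i T x) - h (iter i T y)| < e])
  (nbhs (x : XT)) FF.
have near_i (i : 'I_k) : nbhs (x : XT) [set y : XT | `|h (iter i T x) - h (iter i T y)| < e].
  have cc : continuous (fun x : XT => h (iter i T x)).
    move=> y; apply: (@continuous_comp _ _ _ (iter i T : XT -> XT) (h : XT -> R)).
      exact: iter_continuous.
    exact: lip_continuous.
  by have /cvgrPdist_lt/(_ e e0) := cc x.
move=> /(_ near_i); apply: filterS => y hy; apply/norm_lt_coord => // i.
by rewrite !mxE; exact: hy.
Qed.

Variables (H : set (borel XT)) (Q : {set 'I_k}) (r : 'I_k -> 'I_k).
Hypotheses (mH : measurable H) (rQ : forall i, r i \in Q).
Hypothesis Hr : forall x, H x -> forall i : 'I_k, iter i T x = iter (r i) T x.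
Variables (s t : R) (C : nat).
Hypotheses (s0 : 0 < s) (t0 : 0 < t).
Hypothesis HC : forall x, H x -> forall n,
  pr mu (H `&` near_pi last_pt (last_pt x) (rho R n)) <= C%:R * (2^-1 `^ s) ^+ n.
Variable h : Lip cX.
Hypothesis hJ : finite_liminf (energy (cX := cX) mu T H Q t) h.
Notation phi := (delay_map k T h : borel XT -> 'rV[R]_k).

Let mphi (c : 'I_k) : measurable_fun setT (fun y : borel XT => phi y 0 c).
Proof.
apply: continuous_borel_measurable => y.
apply: (@continuous_comp _ _ _ (phi : XT -> 'rV[R]_k) (fun v : 'rV[R]_k => v 0 c)).
  exact: delay_continuous.
exact: (@coord_continuous R 1 k 0 c).
Qed.

Let mslice n (x : borel XT) :
  measurable_fun setT (fun y : borel XT => integrand (cX := cX) T H Q t n ((h : borel (Lip cX)), (x, y))).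
Proof.
have k1 : measurable_fun setT (fun y : borel XT => ((h : borel (Lip cX)), (x, y))).
  apply: measurable_fun_pair; first exact: measurable_cst.
  by apply: measurable_fun_pair; [exact: measurable_cst|exact: measurable_id].
exact: (measurableT_comp (measurable_integrand (cX := cX) lipT Q mH t n) k1).
Qed.

Let Phi n (x : borel XT) : \bar R :=
  (\int[mu]_y integrand (cX := cX) T H Q t n ((h : borel (Lip cX)), (x, y)))%E.

Let Phi_ge0 n x : (0 <= Phi n x)%E.
Proof. by apply: integral_ge0 => y _; exact: integrand_ge0. Qed.

Let mint n : measurable_fun setT (fun z : borel XT * borel XT =>
   integrand (cX := cX) T H Q t n ((h : borel (Lip cX)), z)).
Proof.
have k1 : measurable_fun setT (fun z : borel XT * borel XT => ((h : borel (Lip cX)), z)).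
  by apply: measurable_fun_pair; [exact: measurable_cst|exact: measurable_id].
exact: (measurableT_comp (measurable_integrand (cX := cX) lipT Q mH t n) k1).
Qed.

Let mPhi n : measurable_fun setT (Phi n).
Proof.
exact: (@measurable_fun_fubini_tonelli_F _ _ (borel XT) (borel XT) R mu _ (mint n)
  (fun z => integrand_ge0 _ _ _ _ _ _)).
Qed.

Let energyE n : (energy (cX := cX) mu T H Q t n h = \int[mu]_x Phi n x)%E.
Proof.
exact: (@fubini_tonelli1 _ _ (borel XT) (borel XT) R mu mu _ (mint n)
  (fun z => integrand_ge0 _ _ _ _ _ _)).
Qed.

Let mnear (x : borel XT) l : measurable (H `&` near_pi last_pt (last_pt x) (rho R l)).
Proof. by apply: measurableI => //; apply: measurable_near_pi; exact: measurable_last_pt. Qed.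

Let fiber (x : borel XT) : set (borel XT) := [set y | H y /\ dist_pi last_pt x y = 0].

Let mfiber x : measurable (fiber x).
Proof.
rewrite (_ : fiber x = \bigcap_l (H `&` near_pi last_pt (last_pt x) (rho R l))).
  exact: bigcapT_measurable.
apply/seteqP; split => y /=.
  by move=> [Hy xy] l _; split => //; rewrite /near_pi /= -/(dist_pi last_pt x y) xy rho_gt0.
move=> Hy; split; first by case: (Hy 0%N Logic.I).
apply/eqP; rewrite eq_le normr_ge0 andbT leNgt; apply/negP => D0.
have half1 : (2^-1 : R) < 1 by rewrite invf_lt1// ltr1n.
have half0 : 0 <= (2^-1 : R) by rewrite invr_ge0.
have [l0 Hl] := expr_small half0 half1 D0.
have [_] := Hy l0 Logic.I; rewrite /near_pi /= -/(dist_pi last_pt x y) => /lt_le_trans/(_ (Hl _ (leqnn _))).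
by rewrite ltxx.
Qed.

Let fiber0 x : H x -> pr mu (fiber x) = 0.
Proof.
move=> Hx; apply/eqP; rewrite eq_le pr_ge0 andbT; apply/ler_addgt0Pl => e e0; rewrite addr0.
have e'0 : 0 < e / (C%:R + 1) by rewrite divr_gt0// ltr_wpDl.
have [l0 Hl] := expr_small (powR_ge0 2^-1 s) (half_powR_lt1 s0) e'0.
apply: (@le_trans _ _ (pr mu (H `&` near_pi last_pt (last_pt x) (rho R l0)))).
  apply: pr_le => // y [Hy xy]; split => //.
  by rewrite /near_pi /= -/(dist_pi last_pt x y) xy rho_gt0.
apply: (le_trans (HC Hx l0)); apply: (@le_trans _ _ (C%:R * (e / (C%:R + 1)))).
  by rewrite ler_wpM2l// Hl.
rewrite mulrCA -[leRHS]mulr1 ler_wpM2l ?(ltW e0)//.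
by rewrite ler_pdivrMr ?ltr_wpDl// mul1r lerDl.
Qed.

(** Outside a set of mass C / (j + 1), the inner integral of the energy is at most
    j + 1 by the Markov inequality and the ball has mass at least
    delta^q / (j + 1) by [thin_le]; the quotient of the two gives the bound. *)
Lemma good_points : {ae mu, forall x, H x -> exists j : nat,
  forall n0, exists2 n, (n0 <= n)%N & forall l,
    pr mu ((H `&` near_pi last_pt (last_pt x) (rho R l)) `&` pball phi x (inv_succ R n)) <=
      j.+1%:R ^+ 2 * (2^-1 `^ t) ^+ l * pr mu (pball phi x (inv_succ R n))}.
Proof.
have [K KP] := finite_liminfP hJ.
have [M phiM] := phi_bounded cX (@delay_continuous h).
have M0 : 0 <= Num.max M 0 by rewrite le_max lexx orbT.
have phiM' y c : `|phi y 0 c| <= Num.max M 0 by rewrite le_max phiM.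
have Hphi x : H x -> forall i : 'I_k, phi x 0 i = phi x 0 (r i).
  by move=> Hx i; rewrite !mxE Hr.
have [C0 C00 C0P] := thin_le mu mphi M0 phiM' mH rQ Hphi.
pose th j n := thin mu phi H (inv_succ R n) (j.+1%:R^-1 * inv_succ R n ^+ #|Q|).
have mth j n : measurable (th j n) by exact: measurable_thin.
(* points with moderate inner energy whose ball is not thin *)
pose G (j n : nat) : set (borel XT) := (H `&` (Phi n @^-1` `]-oo, j.+1%:R%:E[%classic)) `\` th j n.
have mE (I : interval (\bar R)) n : measurable (Phi n @^-1` [set` I]).
  by rewrite -[X in measurable X]setTI; apply: mPhi => //; exact: emeasurable_itv.
have mG j n : measurable (G j n) by apply: measurableD => //; apply: measurableI.
have dl1 n : inv_succ R n <= 1 by rewrite /inv_succ invf_le1 ?ltr0n// ler1n.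
have := @frequently_good R _ (borel XT) mu H G (K + C0) mH mG.
have HG j n0 : exists2 n, (n0 <= n)%N & pr mu (H `\` G j n) <= (K + C0) / j.+1%:R.
  have [n nn0 Jn] := KP n0; exists n => //.
  have j0 : 0 < j.+1%:R :> R by rewrite ltr0n.
  pose E1 := Phi n @^-1` `[j.+1%:R%:E, (+oo)%E]%classic.
  have mE1 : measurable E1 by exact: mE.
  have E1le : pr mu E1 <= K / j.+1%:R.
    rewrite ler_pdivlMr// mulrC -lee_fin EFinM -prE//.
    apply: le_trans Jn; rewrite energyE; apply: (markov_bound mu (mPhi n) (Phi_ge0 n) (ltW j0) mE1).
    by move=> y; rewrite /E1 /= in_itv /= => /andP[].
  apply: (@le_trans _ _ (pr mu (E1 `|` th j n))).
    apply: pr_le; [exact: measurableD|exact: measurableU|].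
    move=> y [Hy nG]; have [tj|ntj] := pselect (th j n y); [by right|left].
    rewrite /E1 /= in_itv /=; apply/andP; split; last by rewrite leey.
    rewrite leNgt; apply/negP => lt; apply: nG; split; last exact: ntj.
    by split; [exact: Hy|rewrite /= in_itv /=].
  apply: (le_trans (prU_le _ mE1 (mth j n))); rewrite mulrDl; apply: lerD => //.
  by apply: C0P; [exact: inv_succ_gt0|exact: dl1|rewrite invr_ge0 ltW].
move=> /(_ HG); apply: filterS => x hx Hx; have [j Hj] := hx Hx.
exists j => n0; have [n nn0 [[_ Px] nth]] := Hj n0; exists n => // l.
set P := pball phi x (inv_succ R n).
have mP : measurable P by exact: measurable_pball.
have d0 : 0 < inv_succ R n := inv_succ_gt0 R n.
have q0 : 0 < inv_succ R n ^+ #|Q| by rewrite exprn_gt0.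
have tau0 : 0 < (2^-1 `^ t : R) ^+ l by rewrite exprn_gt0// powR_gt0// invr_gt0.
have j0 : 0 < j.+1%:R :> R by rewrite ltr0n.
pose B := (H `&` near_pi last_pt (last_pt x) (rho R l)) `&` P.
have mB : measurable B by exact: measurableI.
have mBf : measurable (B `\` fiber x) by exact: measurableD.
have fat : j.+1%:R^-1 * inv_succ R n ^+ #|Q| <= pr mu (H `&` P).
  by rewrite leNgt; apply/negP => lt; apply: nth; split.
have HP : pr mu (H `&` P) <= pr mu P by apply: pr_le => //; exact: measurableI.
have main : (inv_succ R n ^+ #|Q|)^-1 * ((2^-1 `^ t) ^+ l)^-1 * pr mu (B `\` fiber x) <= j.+1%:R.
  rewrite -lee_fin EFinM -prE//; apply: (@le_trans _ _ (Phi n x)); last first.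
    by move: Px; rewrite /= in_itv /= => /ltW.
  have c0 : 0 <= (inv_succ R n ^+ #|Q|)^-1 * ((2^-1 `^ t) ^+ l)^-1 by rewrite mulr_ge0// invr_ge0 ltW.
  apply: (markov_bound mu (mslice n x) (fun y => integrand_ge0 _ _ _ _ _ _) c0 mBf).
  move=> y [[[Hy near] Py] nf].
  have D0 : 0 < dist_pi last_pt x y.
    by rewrite lt_neqAle normr_ge0 andbT eq_sym; apply/eqP => D0; apply: nf.
  rewrite /integrand /weight /= [\1_(close_pairs _ _ _) _]indicE mem_set; last first.
    move=> i /=; apply: le_lt_trans Py.
    by have := coord_le_enorm (phi y - phi x) i; rewrite !mxE distrC.
  rewrite mule1 lee_fin !indicE !mem_set//= !mul1r ler_wpM2l ?invr_ge0 ?(ltW q0)//.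
  rewrite powRN -rho_powR lef_pV2 ?posrE ?powR_gt0 ?rho_gt0//.
  apply: (ge0_ler_powR (ltW t0)); rewrite ?nnegrE ?(ltW D0)//.
    by rewrite ltW// rho_gt0.
  exact: (ltW near).
have prB : pr mu B <= pr mu (B `\` fiber x).
  rewrite (prDI mu mB (mfiber x)) -[leRHS]add0r lerD2r -(fiber0 Hx).
  by apply: pr_le => //; exact: measurableI.
apply: (le_trans prB).
move: main; rewrite -invfM mulrC ler_pdivrMr; last by rewrite mulr_gt0.
move=> /le_trans; apply.
apply: (@le_trans _ _ (j.+1%:R ^+ 2 * (2^-1 `^ t) ^+ l * (j.+1%:R^-1 * inv_succ R n ^+ #|Q|))).
  by rewrite le_eqVlt; apply/orP; left; apply/eqP; field; rewrite addrC natr1 gt_eqF.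
by rewrite ler_wpM2l ?(le_trans fat HP)// mulr_ge0 ?exprn_ge0// ltW.
Qed.

End good.

(** * Conditional measures on a piece *)

Section piece_null.
Context {R : realType} {N : nat} {X : set 'rV[R]_N} (cX : compact X) (X0 : X !=set0).
Notation XT := (psubspace X0).
Variables (mu : probability (borel XT) R) (T : X -> X) (k : nat).
Hypotheses (lipT : lipschitz_self_map T).
Notation last_pt := (@last_pt R N X X0 T k).
Variables (H : set (borel XT)) (Q : {set 'I_k}) (r : 'I_k -> 'I_k).
Hypotheses (mH : measurable H) (rQ : forall i, r i \in Q).
Hypothesis Hr : forall x, H x -> forall i : 'I_k, iter i T x = iter (r i) T x.
Variables (s t : R) (C : nat).
Hypotheses (s0 : 0 < s) (t0 : 0 < t).
Hypothesis HC : forall x, H x -> forall n,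
  pr mu (H `&` near_pi last_pt (last_pt x) (rho R n)) <= C%:R * (2^-1 `^ s) ^+ n.
Variable h : Lip cX.
Hypothesis hJ : finite_liminf (energy (cX := cX) mu T H Q t) h.
Notation phi := (delay_map k T h : XT -> 'rV[R]_k).

Lemma near_open (x : XT) l : open (near_pi last_pt (last_pt x) (rho R l) : set XT).
Proof.
have -> : (near_pi last_pt (last_pt x) (rho R l) : set XT) =
   (last_pt : XT -> 'rV[R]_N) @^-1` (ball (last_pt x : 'rV[R]_N) (rho R l)).
  by rewrite /near_pi -ball_normE.
apply: open_comp; last exact: ball_open.
move=> y _; apply: (@continuous_comp _ _ _ (iter k.-1 T : XT -> XT) (fun x : XT => set_val x : 'rV[R]_N)).
  exact: iter_continuous.
exact: set_val_continuous.
Qed.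

(** The sets near x 2^-l are open, so that [cond_upper] passes from relative masses
    to the conditional measure at the same point. *)
Lemma cond_decay : {ae mu, forall x, H x -> exists C' : nat,
  forall nu, is_cond_measure mu phi (phi x) nu -> forall l,
    (nu (H `&` near_pi last_pt (last_pt x) (rho R l)) <= (C'%:R * (2^-1 `^ t) ^+ l)%:E)%E}.
Proof.
have cphi := @delay_continuous R N X cX X0 T k lipT h.
have mphi := phi_coord_measurable cphi.
have bphi := phi_bounded cX cphi.
have h1 := good_points lipT mH rQ Hr s0 t0 HC hJ.
have h2 := cond_upper cX mu cphi mH.
have h3 := pball_positive mu mphi bphi.
apply: ae_mp (ae_and h1 (ae_and h2 h3)) => x [H1 [H2 H3]] Hx.
have [j Hj] := H1 Hx; exists (j.+1 ^ 2)%N => nu nuP l.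
apply: (H2 nu nuP) => [|n0]; first exact: near_open.
have [n nn0 Hn] := Hj n0; exists n => //.
rewrite /mass_ratio ler_pdivrMr ?H3 ?inv_succ_gt0// natrX; exact: Hn.
Qed.

(** The bound of [cond_decay] concerns the conditional measure at x itself.  Since
    nu is carried by the fibre through x and does not charge the exceptional set,
    at nu-almost every y the conditional measure is nu again. *)
Lemma piece_null : {ae mu, forall x, forall nu, is_cond_measure mu phi (phi x) nu ->
  forall E : set 'rV[R]_N, (measurable : set (set (borel 'rV[R]_N))) E -> Hnull t E ->
  nu (H `&` last_pt @^-1` E) = 0%E}.
Proof.
have cphi := @delay_continuous R N X cX X0 T k lipT h.
have [Z [mZ Z0 ZP]] := cond_decay.
have := cond_null cX cphi mZ Z0; apply: ae_mp => x HZ nu nuP E mE hE.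
have mpik := @measurable_last_pt R N X X0 T k lipT.
have mHE : measurable (H `&` last_pt @^-1` E) by apply: measurableI => //; exact: pi_pre.
apply: measure_negligible => //.
have negC (C' : nat) := mass_distribution nu mpik C' mH t0 hE.
have nZ : nu.-negligible Z by exists Z; split => //; exact: HZ nuP.
have nF : nu.-negligible ([set y | phi y != phi x] : set (borel XT)).
  exists [set y | phi y != phi x]; split => //; last exact: (cond_fiber cX cphi nuP).
  apply: mopen => //.
  apply: (@open_comp XT 'rV[R]_k phi [set v | v != phi x]); first by move=> y _; exact: (cphi y).
  by rewrite (_ : [set v | _] = ~` [set phi x]); [apply: closed_openC; exact: (accessible_closed_set1 (hausdorff_accessible (@norm_hausdorff R 'rV[R]_k)))|apply/seteqP; split => v /= /eqP].
have nU : nu.-negligible (\bigcup_C' (H `&` last_pt @^-1` E `&` [set y | forall l,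
    (nu (H `&` near_pi last_pt (last_pt y) (rho R l)) <= (C'%:R * (2^-1 `^ t) ^+ l)%:E)%E])).
  exact: negligible_bigcup.
apply: negligibleS (negligibleU nZ (negligibleU nF nU)) => y [Hy Ey].
have [Zy|nZy] := pselect (Z y); [by left|right].
have [fy|fy] := eqVneq (phi y) (phi x); [right|by left].
have := contrapT (contra_not (@ZP y) nZy) Hy => -[C' C'P].
exists C' => //; split => // l; apply: C'P; rewrite fy; exact: nuP.
Qed.

End piece_null.

(** * Decomposition into pieces *)

Section pieces.
Context {R : realType} {N : nat} {X : set 'rV[R]_N} (cX : compact X) (X0 : X !=set0).
Notation XT := (psubspace X0).
Variables (mu : probability (borel XT) R) (T : X -> X) (k : nat).
Hypotheses (lipT : lipschitz_self_map T) (k0 : (0 < k)%N).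
Notation last_pt := (@last_pt R N X X0 T k).

(** The map r selects a representative index of each point of the orbit segment. *)
Definition reps (r : {ffun 'I_k -> 'I_k}) : {set 'I_k} := [set i | r i == i].

(** Index triples for which the near-diagonal polynomials of [directions] exist on
    all balls of radius 1/(l+1) about the rational centres.  Requiring
    existence rather than a choice of the polynomials leaves countably many triples. *)
Definition directed (r : {ffun 'I_k -> 'I_k}) (c : {ffun 'I_k -> 'rV[rat]_N}) (l : nat) : Prop :=
  (forall i, r i \in reps r) /\
  exists A : 'I_k -> 'I_N -> {ffun 'I_k -> option (option 'I_N)} -> R,
  forall i i' c0, i \in reps r -> i' \in reps r ->
   forall u v, X u -> X v ->
    `|u - map_mx ratr (c i')| < inv_succ R l -> `|v - map_mx ratr (c i')| < inv_succ R l ->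
    `|\sum_sg A i c0 sg * gpoly sg u - \sum_sg A i c0 sg * gpoly sg v - (i == i')%:R * (u - v) 0 c0|
     <= (2 * k%:R)^-1 * `|u - v|.

Definition same_orbit (r : {ffun 'I_k -> 'I_k}) : set (borel XT) :=
  [set x : XT | forall i : 'I_k, iter i T x = iter (r i) T x].

Definition near_centres (c : {ffun 'I_k -> 'rV[rat]_N}) (l : nat) : set (borel XT) :=
  [set x : XT | forall i : 'I_k, `|orbit_pt T i x - map_mx ratr (c i)| < inv_succ R l].

Lemma measurable_same_orbit r : measurable (same_orbit r).
Proof.
rewrite (_ : same_orbit r = \bigcap_(i in [set: 'I_k]) \bigcap_(d in [set: 'I_N])
    ((fun x : borel XT => orbit_pt T i x 0 d - orbit_pt T (r i) x 0 d) @^-1` [set 0])); last first.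
  apply/seteqP; split => x /=.
    by move=> h i _ d _; rewrite /= /orbit_pt h subrr.
  move=> h i; apply: val_inj; apply/rowP => d.
  by apply/eqP; rewrite -subr_eq0; apply/eqP; exact: (h i Logic.I d Logic.I).
have mc i (d : 'I_N) : measurable_fun setT (fun x : borel XT => orbit_pt T i x 0 d).
  have mcoord : measurable_fun setT (fun u : borel 'rV[R]_N => (u : 'rV[R]_N) 0 d).
    by apply: continuous_borel_measurable; exact: (@coord_continuous R 1 N 0 d).
  exact: (measurableT_comp mcoord (@orbit_pt_measurable R N X X0 T lipT i)).
apply: fin_bigcap_measurable => [|i _]; first exact: finite_finset.
apply: fin_bigcap_measurable => [|d _]; first exact: finite_finset.
rewrite -[X in measurable X]setTI.
by apply: (measurable_funB (mc i d) (mc (r i) d)) => //; exact: measurable_set1.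
Qed.

Lemma measurable_near_centres c l : measurable (near_centres c l).
Proof.
rewrite (_ : near_centres c l = \bigcap_(i in [set: 'I_k])
    ((orbit_pt T i : borel XT -> borel 'rV[R]_N) @^-1` ball (map_mx ratr (c i) : 'rV[R]_N) (inv_succ R l))); last first.
  apply/seteqP; split => x /=.
    by move=> h i _; rewrite /= -ball_normE /= distrC.
  by move=> h i; have := h i Logic.I; rewrite /= -ball_normE /= distrC.
apply: fin_bigcap_measurable => [|i _]; first exact: finite_finset.
rewrite -[X in measurable X]setTI; apply: (@orbit_pt_measurable R N X X0 T lipT i) => //.
by apply: sub_sigma_algebra; exact: ball_open.
Qed.

(** Apply [directions] to the orbit segment of x itself, then choose rational
    centres so close that their balls lie in the ones obtained there. *)
Lemma directed_cover (x : XT) : exists r c l, [/\ directed r c l, same_orbit r x & near_centres c l x].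
Proof.
pose P (i : 'I_k) := [pred j : 'I_k | orbit_pt T j x == orbit_pt T i x].
(* the least index with the same point, which is its own representative *)
pose r := [ffun i : 'I_k => [arg min_(j < i | P i j) (j : nat)]].
have rP i : orbit_pt T (r i) x = orbit_pt T i x /\ forall j : 'I_k, orbit_pt T j x = orbit_pt T i x -> (r i <= j)%N.
  rewrite /r ffunE; case: arg_minnP => [|j /eqP h1 h2]; first by rewrite /P /=.
  by split => // j' /eqP; exact: h2.
have rr i : r i \in reps r.
  rewrite inE; apply/eqP/val_inj/eqP; rewrite /= eqn_leq.
  have [h1 h2] := rP i; have [h3 h4] := rP (r i).
  by rewrite h4// h2// h3.
have inj : {in reps r &, injective (fun i : 'I_k => orbit_pt T i x)}.
  move=> i j; rewrite !inE => /eqP ri /eqP rj ij.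
  have [h1 h2] := rP i; have [h3 h4] := rP j.
  apply/val_inj/eqP; rewrite /= eqn_leq -{1}ri -[in X in _ && X]rj.
  by rewrite h2// h4.
have [M XM] := X_bound cX.
have e0 : 0 < (2 * k%:R)^-1 :> R by rewrite invr_gt0 mulr_gt0// ltr0n.
have [A [rad rad0 AP]] := directions XM (fun i => orbit_pt_in T i x) inj e0.
have r2 : 0 < rad / 2 by rewrite divr_gt0.
have [l Hl] := inv_succ_small r2.
have /choice[c cP] := fun i : 'I_k => rat_rV_dense (orbit_pt T i x) (inv_succ_gt0 R l).
exists r, [ffun i => c i], l; split.
- split => //; exists A => i i' c0 iQ i'Q u v Xu Xv ur vr.
  have near w : `|w - map_mx ratr ([ffun i => c i] i')| < inv_succ R l -> `|w - orbit_pt T i' x| < rad.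
    rewrite ffunE => wr; rewrite -(subrKA (map_mx ratr (c i'))).
    apply: (le_lt_trans (ler_normD _ _)); have -> : rad = rad / 2 + rad / 2 by field.
    apply: ltrD; first exact: (lt_trans wr (Hl _ (leqnn _))).
    by rewrite distrC; exact: (lt_trans (cP i') (Hl _ (leqnn _))).
  by apply: AP => //; exact: near.
- move=> i; apply: val_inj; have [h1 _] := rP i; exact: esym h1.
- by move=> i; rewrite ffunE; exact: cP.
Qed.

Variables (A0 : set (borel 'rV[R]_N)) (s s' t : R).
Hypotheses (mA0 : measurable A0) (s'0 : 0 < s') (ss' : s' < s) (t0 : 0 < t) (ts' : t + k%:R < s').
Hypothesis HA : forall E : set (borel 'rV[R]_N), measurable E -> Hnull s E -> mu (last_pt @^-1` (E `&` A0)) = 0%E.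

Definition frostman_set (C : nat) : set (borel XT) :=
  (last_pt @^-1` A0) `&` [set x | forall n,
    pr mu (last_pt @^-1` A0 `&` near_pi last_pt (last_pt x) (rho R n)) <= C%:R * (2^-1 `^ s') ^+ n].

Let mpik := @measurable_last_pt R N X X0 T k lipT.

Let mA : measurable (last_pt @^-1` A0). Proof. exact: pi_pre. Qed.

Lemma measurable_frostman_set C : measurable (frostman_set C).
Proof.
apply: measurableI => //.
rewrite (_ : [set x | _] = \bigcap_n ((fun x => mu (last_pt @^-1` A0 `&` near_pi last_pt (last_pt x) (rho R n))) @^-1`
   `]-oo, (C%:R * (2^-1 `^ s') ^+ n)%:E]%classic)); last first.
  have mm x n : measurable (last_pt @^-1` A0 `&` near_pi last_pt (last_pt x) (rho R n)).
    by apply: measurableI => //; exact: measurable_near_pi.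
  apply/seteqP; split => x /= h n.
    by move=> _; rewrite /= in_itv /= prE// lee_fin.
  by have := h n Logic.I; rewrite /= in_itv /= prE// lee_fin.
apply: bigcapT_measurable => n; rewrite -[X in measurable X]setTI.
have mn := measurable_mu_near mu mpik (rho R n) mA.
by apply: (measurableT_comp mn mpik) => //; exact: emeasurable_itv.
Qed.

Definition piece_index := (nat * {ffun 'I_k -> 'I_k} * {ffun 'I_k -> 'rV[rat]_N} * nat)%type.

Definition piece_of (a : piece_index) : set (borel XT) :=
  frostman_set a.1.1.1 `&` same_orbit a.1.1.2 `&` near_centres a.1.2 a.2.

Lemma measurable_piece_of a : measurable (piece_of a).
Proof.
apply: measurableI; last exact: measurable_near_centres.
apply: measurableI; [exact: measurable_frostman_set|exact: measurable_same_orbit].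
Qed.

Lemma piece_frostman a x : piece_of a x -> forall n,
  pr mu (piece_of a `&` near_pi last_pt (last_pt x) (rho R n)) <= a.1.1.1%:R * (2^-1 `^ s') ^+ n.
Proof.
move=> [[[Ax Fx] _] _] n; apply: le_trans (Fx n); apply: pr_le.
- by apply: measurableI; [exact: measurable_piece_of|exact: measurable_near_pi].
- by apply: measurableI => //; exact: measurable_near_pi.
- by move=> y [[[[Ay _] _] _] h]; split.
Qed.

Definition good_set (a : piece_index) : set (borel (Lip cX)) :=
  if pselect (directed a.1.1.2 a.1.2 a.2)
  then finite_liminf (energy (cX := cX) mu T (piece_of a) (reps a.1.1.2) t) else setT.

Lemma good_setP a : measurable (good_set a) /\
  forall v, iterint (lip_gpoly cX (k := k)) (window 1) (gpoly_indices (N := N) k)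
     (fun u => (\1_(~` good_set a) u)%:E) v = 0%E.
Proof.
have [da|nda] := pselect (directed a.1.1.2 a.1.2 a.2); last first.
  have -> : good_set a = setT by rewrite /good_set; case: pselect.
  split => [|v]; first exact: measurableT.
  rewrite setCT (_ : (fun u => _) = fun=> 0%E) ?iterint0//.
  by apply/funext => u; rewrite indic0.
have -> : good_set a = finite_liminf (energy (cX := cX) mu T (piece_of a) (reps a.1.1.2) t).
  by rewrite /good_set; case: pselect.
have [_ [A AP]] := da.
have ts : t + #|reps a.1.1.2|%:R < s'.
  apply: le_lt_trans ts'; rewrite lerD2l ler_nat -[leqRHS](card_ord k); exact: max_card.
apply: (piece_energy cX lipT k0 AP (measurable_piece_of a) _ t0 ts (@piece_frostman a)).
by move=> x [_ nx] i _; exact: nx.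
Qed.

(** Countably many pieces cover almost all of pi^-1 A0, by [frostman] and
    [directed_cover]. *)
Lemma scale_lemma : exists B : set (borel (Lip cX)), [/\ measurable B,
  (forall v, iterint (lip_gpoly cX (k := k)) (window 1) (gpoly_indices (N := N) k)
     (fun u => (\1_(~` B) u)%:E) v = 0%E) &
  forall h, B h -> let phi := delay_map k T h in
   {ae mu, forall x, forall nu, is_cond_measure mu phi (phi x) nu ->
    forall E : set 'rV[R]_N, (measurable : set (set (borel 'rV[R]_N))) E -> Hnull t E ->
    nu (last_pt @^-1` (E `&` A0)) = 0%E}].
Proof.
have [mB B0] := iterint_bigcap (fun a => (good_setP a).1) (fun a => (good_setP a).2).
exists (\bigcap_a good_set a); split => // h Bh phi.
have cphi := @delay_continuous R N X cX X0 T k lipT h.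
pose dec n : option piece_index := unpickle n.
have ae1 : {ae mu, forall x, forall n, forall nu, is_cond_measure mu phi (phi x) nu ->
    forall E : set 'rV[R]_N, (measurable : set (set (borel 'rV[R]_N))) E -> Hnull t E ->
    if dec n is Some a then directed a.1.1.2 a.1.2 a.2 -> nu (piece_of a `&` last_pt @^-1` E) = 0%E else True}.
  apply: ae_foralln => n; case: (dec n) => [a|]; last exact: aeW.
  have [da|nda] := pselect (directed a.1.1.2 a.1.2 a.2); last by apply: aeW.
  have Ba := Bh a Logic.I; rewrite /good_set in Ba.
  case: pselect Ba => // da' Ba.
  have Hr x : piece_of a x -> forall i : 'I_k, iter i T x = iter (a.1.1.2 i) T x.
    by move=> [[_ so] _]; exact: so.
  apply: ae_mp (piece_null lipT (measurable_piece_of a) da.1 Hr s'0 t0 (@piece_frostman a) Ba).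
  by move=> x hx nu nuP E mE hE _; exact: (hx nu nuP E mE hE).
have ae2 := frostman mpik mA0 s'0 ss' HA.
have [Z [mZ Z0 ZP]] := ae2.
apply: ae_mp (ae_and ae1 (cond_null cX cphi mZ Z0)) => x [H1 H2] nu nuP E mE hE.
have nZ : nu.-negligible Z by exists Z; split => //; exact: H2 nuP.
pose F n : set (borel XT) := if dec n is Some a
  then (if pselect (directed a.1.1.2 a.1.2 a.2) then piece_of a `&` last_pt @^-1` E else set0) else set0.
have nF : nu.-negligible (\bigcup_n F n).
  apply: negligible_bigcup => n; rewrite /F; have := H1 n nu nuP E mE hE.
  case: (dec n) => [a|_]; last exact: negligible_set0.
  have [da|nda] := pselect (directed a.1.1.2 a.1.2 a.2); last first.
    by move=> _; rewrite (_ : (if _ then _ else _) = set0); [exact: negligible_set0|case: pselect].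
  move=> /(_ da) h0; rewrite (_ : (if _ then _ else _) = piece_of a `&` last_pt @^-1` E); last by case: pselect.
  exists (piece_of a `&` last_pt @^-1` E); split => //.
  by apply: measurableI; [exact: measurable_piece_of|exact: pi_pre].
apply: measure_negligible; first by apply: pi_pre => //; exact: measurableI.
apply: negligibleS (negligibleU nZ nF) => y [Ey Ay].
have [Zy|nZy] := pselect (Z y); [by left|right].
have [C CP] := contrapT (contra_not (@ZP y) nZy) Ay.
have [r [c [l [dr so nc]]]] := directed_cover y.
exists (pickle ((C, r, c, l) : piece_index)) => //; rewrite /F /dec pickleK.
by case: pselect => // _; split => //; split => //; split.
Qed.

End pieces.

(** * The dimension bounds *)

Lemma real_between (R : realType) (a : R) (L : \bar R) : (a%:E < L)%E ->
  exists s, a < s /\ (s%:E < L)%E.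
Proof.
case: L => [l|_|//]; last by exists (a + 1); rewrite ltrDl ltry.
by rewrite lte_fin => al; exists ((a + l) / 2); rewrite lte_fin; split; lra.
Qed.

Lemma rat_between (R : realType) (L M : \bar R) : (0 <= L)%E -> (L < M)%E ->
  exists q : rat, (L < (ratr q)%:E)%E /\ ((ratr q)%:E < M)%E.
Proof.
case: L => [l| |]//; last by move=> _; rewrite ltNge leey.
move=> _ lM; have [s [ls sM]] := real_between lM.
have /rat_in_itvoo[q] := ls; rewrite in_itv /= => /andP[lq qs].
by exists q; rewrite lte_fin; split => //; apply: lt_trans sM; rewrite lte_fin.
Qed.

Section assemble.
Context {R : realType} {N : nat} {X : set 'rV[R]_N} (cX : compact X) (X0 : X !=set0).
Notation XT := (psubspace X0).
Variables (T : X -> X) (mu : probability (borel XT) R) (k : nat).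
Hypotheses (lipT : lipschitz_self_map T) (k0 : (0 < k)%N).
Notation last_pt := (@last_pt R N X X0 T k).
Notation null_set B := (forall v, iterint (lip_gpoly cX (k := k)) (window 1) (gpoly_indices (N := N) k)
     (fun u => (\1_(~` B) u)%:E) v = 0%E).
Notation charges_no h t A0 := {ae mu, forall x, forall nu,
    is_cond_measure mu (delay_map k T h) (delay_map k T h x) nu ->
    forall E : set 'rV[R]_N, (measurable : set (set (borel 'rV[R]_N))) E -> Hnull t E ->
    nu (last_pt @^-1` (E `&` A0)) = 0%E}.

Let mpik := @measurable_last_pt R N X X0 T k lipT.

Lemma trivial_null : null_set (setT : set (borel (Lip cX))).
Proof.
move=> v; rewrite setCT (_ : (fun u => _) = fun=> 0%E) ?iterint0//.
by apply/funext => u; rewrite indic0.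
Qed.

(** By definition of the lower dimension, sets of dimension less than s have mass
    0, so that A0 can be the whole space. *)
Lemma lower_scale (t : R) : exists B : set (borel (Lip cX)), [/\ measurable B, null_set B &
  forall h, B h -> 0 < t -> ((t + k%:R)%:E < lower_dimH_measure (iter_push T k.-1 mu))%E ->
  charges_no h t setT].
Proof.
have [[t0 tL]|nt] := pselect (0 < t /\ ((t + k%:R)%:E < lower_dimH_measure (iter_push T k.-1 mu))%E);
  last first.
  exists setT; split; [exact: measurableT|exact: trivial_null|].
  by move=> h _ t0 tL; exfalso; apply: nt.
have [s [ts sL]] := real_between tL.
have [s' [ts' s's]] : exists s', t + k%:R < s' /\ s' < s.
  by exists ((t + k%:R + s) / 2); split; lra.
have s'0 : 0 < s' by apply: le_lt_trans ts'; rewrite addr_ge0// ltW.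
have HA (E : set (borel 'rV[R]_N)) : measurable E -> Hnull s E -> mu (last_pt @^-1` (E `&` setT)) = 0%E.
  move=> mE hE; rewrite setIT; apply/eqP; rewrite eq_le measure_ge0 andbT leNgt; apply/negP => E0.
  have : (lower_dimH_measure (iter_push T k.-1 mu) <= s%:E)%E.
    apply: le_trans (dimH_le (ltW (lt_trans s'0 s's)) hE).
    by apply: ereal_inf_lbound; exists E.
  by rewrite leNgt sL.
have [B [mB B0 BP]] := scale_lemma cX lipT k0 measurableT s'0 s's t0 ts' HA.
by exists B; split => // h Bh _ _; exact: BP.
Qed.

(** Since s is less than the dimension, no set of vanishing s-dimensional measure
    has full mass, and [exhaustion] provides A0. *)
Lemma upper_scale (t : R) : exists B : set (borel (Lip cX)), [/\ measurable B, null_set B &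
  forall h, B h -> 0 < t -> ((t + k%:R)%:E < dimH_measure (iter_push T k.-1 mu))%E ->
  exists A0 : set (borel 'rV[R]_N), [/\ measurable A0, (0 < mu (last_pt @^-1` A0))%E & charges_no h t A0]].
Proof.
have [[t0 tL]|nt] := pselect (0 < t /\ ((t + k%:R)%:E < dimH_measure (iter_push T k.-1 mu))%E);
  last first.
  exists setT; split; [exact: measurableT|exact: trivial_null|].
  by move=> h _ t0 tL; exfalso; apply: nt.
have [s [ts sL]] := real_between tL.
have [s' [ts' s's]] : exists s', t + k%:R < s' /\ s' < s.
  by exists ((t + k%:R + s) / 2); split; lra.
have s'0 : 0 < s' by apply: le_lt_trans ts'; rewrite addr_ge0// ltW.
have [E mE hE E0|A0 [mA0 A0pos HA]] := @exhaustion R N _ _ mu last_pt mpik s.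
  have : (dimH_measure (iter_push T k.-1 mu) <= s%:E)%E.
    apply: le_trans (dimH_le (ltW (lt_trans s'0 s's)) hE).
    by apply: ereal_inf_lbound; exists E.
  by rewrite leNgt sL.
have [B [mB B0 BP]] := scale_lemma cX lipT k0 mA0 s'0 s's t0 ts' HA.
by exists B; split => // h Bh _ _; exists A0; split => //; exact: BP.
Qed.

Lemma cond_measureP (h : Lip cX) (y : 'rV[R]_k) :
  (exists nu, is_cond_measure mu (delay_map k T h) y nu) ->
  is_cond_measure mu (delay_map k T h) y (cond_measure mu (delay_map k T h) y).
Proof. by move=> ex; rewrite /cond_measure; case: pselect => // e; exact: (projT2 (cid e)). Qed.

Lemma Hnull_of_dimH_lt (E : set 'rV[R]_N) t : (dimH E < t%:E)%E -> Hnull t E.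
Proof. by move=> /dimH_lt[s [s0 st hs]]; apply: Hnull_mono hs => //; exact: ltW. Qed.

(** A set of positive conditional measure and dimension less than
    lower_dim - k would have vanishing t-dimensional measure for some rational t
    with t + k less than the lower dimension.  The zero measure, which stands for a
    missing limit, charges no set. *)
Lemma lower_bound (h : Lip cX) :
  (forall q : rat, 0 < (ratr q : R) ->
    ((ratr q + k%:R)%:E < lower_dimH_measure (iter_push T k.-1 mu))%E -> charges_no h (ratr q) setT) ->
  {ae mu, forall x, (lower_dimH_measure (iter_push T k.-1 mu) - k%:R%:E <=
     lower_dimH_measure (iter_push T k.-1 (cond_measure mu (delay_map k T h) (delay_map k T h x))))%E}.
Proof.
set L := lower_dimH_measure _ => HQ.
have ae1 : {ae mu, forall x, forall n, forall q : rat, unpickle n = Some q ->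
    0 < (ratr q : R) -> ((ratr q + k%:R)%:E < L)%E -> forall nu,
    is_cond_measure mu (delay_map k T h) (delay_map k T h x) nu ->
    forall E : set 'rV[R]_N, (measurable : set (set (borel 'rV[R]_N))) E -> Hnull (ratr q) E ->
    nu (last_pt @^-1` (E `&` setT)) = 0%E}.
  apply: ae_foralln => n; case: (unpickle n) => [q|]; last exact: aeW.
  have [[q0 qL]|nq] := pselect (0 < (ratr q : R) /\ ((ratr q + k%:R)%:E < L)%E); last first.
    by apply: aeW => x q' [<-] h1 h2; exfalso; apply: nq.
  by apply: ae_mp (HQ q q0 qL) => x hx q' [<-] _ _; exact: hx.
apply: ae_mp ae1 => x hx; rewrite leNgt; apply/negP => /ereal_inf_lt[_ [E [mE E0] <-] EL].
have [q [Eq qL]] := rat_between (dimH_ge0 E) EL.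
have q0 : 0 < (ratr q : R) by rewrite -lte_fin (le_lt_trans (dimH_ge0 E)).
have qL' : ((ratr q + k%:R)%:E < L)%E by rewrite EFinD -lteBrDr.
move: E0; rewrite /iter_push /pushforward.
have [ex|nex] := pselect (exists nu, is_cond_measure mu (delay_map k T h) (delay_map k T h x) nu); last first.
  rewrite /cond_measure; case: pselect => [//|_]; by rewrite /= /mzero ltxx.
have := hx (pickle q) q (pickleK q) q0 qL' _ (cond_measureP ex) E mE (Hnull_of_dimH_lt Eq).
by rewrite setIT => e0; rewrite [X in (_ < X)%E -> _]e0 ltxx.
Qed.

Lemma dimH_measure_fin : exists d : R, dimH_measure (iter_push T k.-1 mu) = d%:E.
Proof.
have [M XM] := X_bound cX.
have M0 : 0 <= Num.max M 0 by rewrite le_max lexx orbT.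
have hX : Hnull N.+1%:R X.
  apply: (Hnull_bounded M0) => v Xv c; rewrite le_max; apply/orP; left.
  by apply: le_trans (XM v Xv); rewrite [leRHS]mx_normrE; exact: (le_bigmax _ _ (0, c)).
have mX : measurable (X : set (borel 'rV[R]_N)).
  rewrite -[X in measurable X]setCK; apply: measurableC; apply: sub_sigma_algebra.
  by rewrite openC; apply: compact_closed => //; exact: norm_hausdorff.
have ub : (dimH_measure (iter_push T k.-1 mu) <= N.+1%:R%:E)%E.
  apply: le_trans (dimH_le (ler0n R _) hX); apply: ereal_inf_lbound; exists X => //; split => //.
  rewrite /iter_push /pushforward (_ : _ @^-1` _ = set0) ?measure0//.
  by rewrite -subset0 => x /=; apply; exact: orbit_pt_in.
have lb : (0 <= dimH_measure (iter_push T k.-1 mu))%E.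
  by apply: le_ereal_inf_tmp => _ [E _ <-]; exact: dimH_ge0.
by move: ub lb; case: dimH_measure => [d|//|//] _ _; exists d.
Qed.

(** At almost every point of pi^-1 A0 the conditional measure charges pi^-1 A0, but
    not its part above a set of dimension less than t; so a set of full conditional
    measure has dimension at least t. *)
Lemma upper_bound (h : Lip cX) (eps : R) : 0 < eps ->
  (forall q : rat, 0 < (ratr q : R) ->
    ((ratr q + k%:R)%:E < dimH_measure (iter_push T k.-1 mu))%E ->
    exists A0 : set (borel 'rV[R]_N), [/\ measurable A0, (0 < mu (last_pt @^-1` A0))%E &
      charges_no h (ratr q) A0]) ->
  exists A : set (borel XT), [/\ measurable A, (0 < mu A)%E & forall x, A x ->
    (dimH_measure (iter_push T k.-1 mu) - k%:R%:E - eps%:E <=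
     dimH_measure (iter_push T k.-1 (cond_measure mu (delay_map k T h) (delay_map k T h x))))%E].
Proof.
have [d ->] := dimH_measure_fin => eps0 HQ.
rewrite -!EFinB.
have [dk|dk] := leP (d - k%:R - eps) 0.
  exists setT; split; first exact: measurableT.
    by rewrite (lt_le_trans lte01)// [leRHS]probability_setT.
  move=> x _; apply: (@le_trans _ _ 0%E); first by rewrite lee_fin.
  by apply: le_ereal_inf_tmp => _ [E _ <-]; exact: dimH_ge0.
(* eps makes room for a rational exponent *)
have /rat_in_itvoo[q] : d - k%:R - eps < d - k%:R by rewrite ltrBlDr ltrDl.
rewrite in_itv /= => /andP[q1 q2].
have q0 : 0 < (ratr q : R) by exact: lt_trans q1.
have [|A0 [mA0 A0pos HA]] := HQ q q0; first by rewrite lte_fin; lra.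
have cphi := @delay_continuous R N X cX X0 T k lipT h.
have mA : measurable (last_pt @^-1` A0) by exact: pi_pre.
have [Z [mZ Z0 ZP]] := ae_and HA (ae_and (cond_exists cX mu cphi) (cond_positive cX mu cphi mA)).
exists (last_pt @^-1` A0 `\` Z); split; first exact: measurableD.
  rewrite (lt_le_trans A0pos)//.
  apply: (@le_trans _ _ (mu (last_pt @^-1` A0 `\` Z) + mu Z)%E); last by rewrite Z0 adde0.
  apply: (@le_trans _ _ (mu ((last_pt @^-1` A0 `\` Z) `|` Z))).
    apply: le_measure; rewrite ?inE//; first by apply: measurableU => //; exact: measurableD.
    by move=> x Ax; have [Zx|nZx] := pselect (Z x); [right|left].
  by apply: measureU2 => //; exact: measurableD.
move=> x [Ax nZx].
have [H1 [ex H3]] := contrapT (contra_not (@ZP x) nZx).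
have cP := cond_measureP ex.
apply: (@le_trans _ _ (ratr q)%:E); first by rewrite lee_fin ltW.
apply: le_ereal_inf_tmp => _ [E [mE E0] <-]; rewrite leNgt; apply/negP => Eq.
have n1 := H1 _ cP E mE (Hnull_of_dimH_lt Eq).
have := H3 Ax _ cP; rewrite ltNge => /negP; apply.
set nu := cond_measure _ _ _ in n1 E0 *.
apply: (@le_trans _ _ (nu (last_pt @^-1` (E `&` A0)) + nu (last_pt @^-1` (~` E)))%E); last first.
  by rewrite [X in (X + _)%E]n1 add0e [leLHS]E0.
have mEA : measurable (last_pt @^-1` (E `&` A0)) by apply: pi_pre => //; exact: measurableI.
have mEc : measurable (last_pt @^-1` (~` E)) by apply: pi_pre => //; exact: measurableC.
apply: le_trans (measureU2 _ _ _) => //.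
apply: le_measure; rewrite ?inE//; first exact: measurableU.
by move=> y Ay; have [Ey|nEy] := pselect (E (last_pt y)); [left|right].
Qed.

End assemble.

Theorem theorem1p21 (R : realType) (N : nat) (N_gt0 : (0 < N)%N)
    (X : set 'rV[R]_N) (cX : compact X) (X0 : X !=set0)
    (T : X -> X) (lipT : lipschitz_self_map T)
    (mu : probability (borel (psubspace X0)) R)
    (k : nat) (k_gt0 : (0 < k)%N) :
  prevalent [set h : Lip cX |
    let phi := delay_map k T h in
    {ae mu, forall x,
      (lower_dimH_measure (iter_push T k.-1 mu) - k%:R%:E <=
       lower_dimH_measure (iter_push T k.-1 (cond_measure mu phi (phi x))))%E}
    /\
    forall eps : R, 0 < eps ->
      exists A : set (borel (psubspace X0)),
        [/\ measurable A, (0 < mu A)%E &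
          forall x, A x ->
            (dimH_measure (iter_push T k.-1 mu) - k%:R%:E - eps%:E <=
             dimH_measure
               (iter_push T k.-1 (cond_measure mu phi (phi x))))%E]].
Proof.
have /choice[BL BLP] := fun q : rat => lower_scale cX mu lipT k_gt0 (ratr q).
have /choice[BU BUP] := fun q : rat => upper_scale cX mu lipT k_gt0 (ratr q).
(* the boolean distinguishes the two dimensions *)
pose B (a : rat * bool) : set (borel (Lip cX)) := if a.2 then BL a.1 else BU a.1.
have mB a : measurable (B a).
  by case: a => q [|]; rewrite /B /=; [have [] := BLP q|have [] := BUP q].
have B0 a v : iterint (lip_gpoly cX (k := k)) (window 1) (gpoly_indices (N := N) k) (fun u => (\1_(~` B a) u)%:E) v = 0%E.
  by case: a => q [|]; rewrite /B /=; [have [_ + _] := BLP q|have [_ + _] := BUP q]; apply.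
have [mBB BB0] := iterint_bigcap mB B0.
exists (\bigcap_a B a); split => //; last exact: borel_prevalent_probe BB0.
move=> h Bh /=; split.
  apply: lower_bound => q q0 qL; have [_ _ H] := BLP q.
  by apply: H => //; exact: (Bh (q, true) Logic.I).
move=> eps eps0; apply: upper_bound => // q q0 qL; have [_ _ H] := BUP q.
by apply: H => //; exact: (Bh (q, false) Logic.I).
Qed.
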